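(* There exists an absolute constant $\alpha\in(0,1)$ such that the following holds for all integers $d\ge1$, $1\le s\le\alpha d$, all $\sigma>0$, any $\boldsymbol\theta\in B_0(s,d)$ and any $\boldsymbol\Sigma$ satisfying Assumptions $(\varepsilon^*0)$ and $(\varepsilon^*1)$. (i) If $s>\|\boldsymbol\Sigma\|_F$, then $\mathbf E_{\boldsymbol\theta,\boldsymbol\Sigma}[(\hat N^*-\|\boldsymbol\theta\|_2)^2]\le c_1\sigma^2\psi^*(s,\boldsymbol\Sigma)$ for an absolute constant $c_1>0$. (ii) If $s\le\|\boldsymbol\Sigma\|_F$, then there is an absolute constant $c_2>0$ such that for any $\eta\in(c_2\|\boldsymbol\Sigma\|_F/d,1)$, \[ \mathbf P_{\boldsymbol\theta,\boldsymbol\Sigma}\left((\hat N^*-\|\boldsymbol\theta\|_2)^2\le c_\eta\sigma^2\psi^*(s,\boldsymbol\Sigma)\right)\ge1-\eta, \] where $c_\eta>0$ depends only on $\eta$. (iii) If in addition $\boldsymbol\Sigma$ is positive definite, then for an absolute constant $c_3>0$, \[ \mathbf E_{\boldsymbol\theta,\boldsymbol\Sigma}[(\hat N^*-\|\boldsymbol\theta\|_2)^2]\le c_3\left(\sqrt{\lambda_{\max}(\boldsymbol\Sigma^{-1})}+1\right)\sigma^2\psi^*(s,\boldsymbol\Sigma)+c_3\sigma^2\frac{\|\boldsymbol\Sigma\|_F^2}{d}\log(1+\|\boldsymbol\Sigma\|_F^2/s^2). \]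
   Context: Model: one observes $\boldsymbol Y=\boldsymbol\theta+\sigma\boldsymbol\varepsilon\in\mathbb R^d$, $\boldsymbol\varepsilon\sim\mathcal N(\boldsymbol0,\boldsymbol\Sigma)$, $\boldsymbol\Sigma$ a covariance matrix with known diagonal entries $\sigma_i^2$ and known $\|\boldsymbol\Sigma\|_F$; $\sigma>0$ is unknown. $\mathbf P_{\boldsymbol\theta,\boldsymbol\Sigma},\mathbf E_{\boldsymbol\theta,\boldsymbol\Sigma}$ refer to this model. $B_0(s,d)=\{\boldsymbol\theta:\|\boldsymbol\theta\|_0\le s\}$. Assumption $(\varepsilon^*0)$: $\max_i\sigma_i^2\le1$. Assumption $(\varepsilon^*1)$: $\min_i\sigma_i^2\ge c_*$ for a constant $c_*>0$. Noise estimators: $\tilde Y_i=Y_i/\sigma_i$, $\tilde{\boldsymbol\Sigma}_{ij}=\boldsymbol\Sigma_{ij}/(\sigma_i\sigma_j)$; $\hat F_{Y^2}$ the empirical c.d.f. of $\tilde Y_1^2,\dots,\tilde Y_d^2$; $F$ the c.d.f. of $\chi^2_1$; $\hat\sigma_S^2(t)=t/F^{-1}(\hat F_{Y^2}(t))$ if $\hat F_{Y^2}(t)>0$, $+\infty$ otherwise; $\hat t=\min\{2^\ell:\ell\in\mathbb Z,\hat F_{Y^2}(2^\ell)\ge0.5\}$; $\hat\sigma_S^2=\hat\sigma_S^2(\hat t)$, $\hat\sigma_S=\sqrt{\hat\sigma_S^2}$; $\hat\varphi_d(u)=\frac1d\sum_i\cos(u\tilde Y_i)$; $\lambda=(1\vee\log(s/\|\tilde{\boldsymbol\Sigma}\|_F))/6$;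 $\tilde\sigma_D^2=-\frac{2\hat t}{\lambda}\log|\hat\varphi_d(\sqrt{\lambda/\hat t})|$; $\hat\sigma_D^2=\min\{\tilde\sigma_D^2,2\hat\sigma_S^2\}$. Norm estimator: $\tau=3\sqrt{\log(1+\|\boldsymbol\Sigma\|_F^2/s^2)}$, $\alpha_s=\mathbf E[Z^2\mathbb 1\{|Z|\ge\tau\}]$ with $Z\sim\mathcal N(0,1)$, \[ \hat Q^*=\begin{cases}\sum_{i=1}^dY_i^2\mathbb 1\{|Y_i|>\hat\sigma_S\sigma_i\tau\}-\hat\sigma_S^2\alpha_s\sum_{i=1}^d\sigma_i^2,& s\le\|\boldsymbol\Sigma\|_F,\\ \sum_{i=1}^d(Y_i^2-\hat\sigma_D^2\sigma_i^2),&\text{otherwise},\end{cases}\qquad\hat N^*=\sqrt{|\hat Q^*|}. \] Rate: $\psi^*(s,\boldsymbol\Sigma)=s\log(1+\|\boldsymbol\Sigma\|_F^2/s^2)$ if $s\le\|\boldsymbol\Sigma\|_F$ and $\psi^*(s,\boldsymbol\Sigma)=\frac{s}{1\vee\log(s/\|\boldsymbol\Sigma\|_F)}$ otherwise. *)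

(* Defs.v *)
From HB Require Import structures.
From mathcomp Require Import all_boot all_order all_algebra.
From mathcomp Require Import all_classical all_reals all_analysis.
Set Implicit Arguments. Unset Strict Implicit. Unset Printing Implicit Defensive.
Import Order.TTheory GRing.Theory Num.Theory.
Local Open Scope classical_set_scope.
Local Open Scope ring_scope.

Section Defs.
Variable R : realType.

(** Standard Gaussian expectation of a nonnegative functional of
    Z = (Z_0, ..., Z_{n-1}) i.i.d. N(0,1), written as an iterated integral
    against the N(0,1) density (coordinates other than 0..n-1 are set to 0). *)
Fixpoint gauss_int (n : nat) (f : (nat -> R) -> \bar R) : \bar R :=
  match n with
  | 0 => f (fun _ => 0)
  | n'.+1 => (\int[@lebesgue_measure R]_x
               ((normal_pdf 0 1 x)%:E *
                 gauss_int n' (fun z => f (fun k => if k == n' then x else z k))))%E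
  end.

Variable d : nat.

(** Observation Y = theta + sigma * A Z with Z standard Gaussian in R^d,
    so that eps = A Z ~ N(0, Sigma) with Sigma = A A^T. *)
Definition Yobs (theta : 'I_d -> R) (sigma : R) (A : 'M[R]_d) (z : nat -> R)
  : 'I_d -> R := fun i => theta i + sigma * \sum_(j < d) A i j * z j.

Definition Expect (theta : 'I_d -> R) (sigma : R) (A : 'M[R]_d)
  (g : ('I_d -> R) -> R) : \bar R :=
  gauss_int d (fun z => (g (Yobs theta sigma A z))%:E).

Definition Prob (theta : 'I_d -> R) (sigma : R) (A : 'M[R]_d)
  (P : ('I_d -> R) -> Prop) : \bar R :=
  gauss_int d (fun z => (if `[< P (Yobs theta sigma A z) >] then 1 else 0)%:E).

Definition frob (M : 'M[R]_d) : R :=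
  Num.sqrt (\sum_(i < d) \sum_(j < d) M i j ^+ 2).

Definition l0norm (theta : 'I_d -> R) : nat := #|[set i | theta i != 0]|.
Definition l2norm (theta : 'I_d -> R) : R := Num.sqrt (\sum_(i < d) theta i ^+ 2).

Definition lambda_max (M : 'M[R]_d) : R := sup [set a : R | eigenvalue M a].

Definition pos_def (M : 'M[R]_d) : Prop :=
  forall v : 'cV[R]_d, v != 0 -> 0 < (v^T *m M *m v) 0 0.

Variables (Sig : 'M[R]_d) (s : nat).

Definition sigi (i : 'I_d) : R := Num.sqrt (Sig i i).
Definition Sigtil : 'M[R]_d := \matrix_(i, j) (Sig i j / (sigi i * sigi j)).

(** c.d.f. of chi^2_1 and its (generalized) inverse, +oo at level 1 *)
Definition chi2cdf (x : R) : R :=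
  if 0 <= x then
    fine (\int[@lebesgue_measure R]_(z in [set z : R | (`|z| <= Num.sqrt x)%R])
            (normal_pdf 0 1 z)%:E)%E
  else 0.
Definition chi2quant (p : R) : \bar R :=
  ereal_inf [set x%:E | x in [set x : R | 0 <= x /\ p <= chi2cdf x]].

Variable Y : 'I_d -> R.

Definition Ytil (i : 'I_d) : R := Y i / sigi i.
Definition Fhat (t : R) : R := #|[set i | Ytil i ^+ 2 <= t]|%:R / d%:R.

Definition sigS2_at (t : R) : \bar R :=
  if 0 < Fhat t then
    match chi2quant (Fhat t) with
    | EFin q => (t / q)%:E
    | +oo%E => 0%E
    | -oo%E => +oo%E
    end
  else +oo%E.

Definition that : R :=
  inf [set (2 : R) ^ l | l in [set l : int | 2^-1 <= Fhat ((2 : R) ^ l)]].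

(** hat sigma_S^2 = hat sigma_S^2(hat t) (always finite, Fhat(hat t) >= 1/2) *)
Definition sigS2 : R := fine (sigS2_at that).
Definition sigS : R := Num.sqrt sigS2.

Definition phihat (u : R) : R := d%:R^-1 * \sum_(i < d) cos (u * Ytil i).
Definition lam : R := Num.max 1 (ln (s%:R / frob Sigtil)) / 6.
Definition sigD2til : R :=
  - (2 * that / lam) * ln `|phihat (Num.sqrt (lam / that))|.
(** when phihat = 0, tilde sigma_D^2 = +oo and the minimum is 2 sigS2 *)
Definition sigD2 : R :=
  if phihat (Num.sqrt (lam / that)) == 0 then 2 * sigS2
  else Num.min sigD2til (2 * sigS2).

Definition tau : R := 3 * Num.sqrt (ln (1 + frob Sig ^+ 2 / s%:R ^+ 2)).
Definition alpha_s : R :=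
  fine (\int[@lebesgue_measure R]_x
          ((normal_pdf 0 1 x) * x ^+ 2 * (if (tau <= `|x|)%R then 1 else 0))%:E)%E.

Definition Qstar : R :=
  if s%:R <= frob Sig then
    \sum_(i < d) (if sigS * sigi i * tau < `|Y i| then Y i ^+ 2 else 0)
      - sigS2 * alpha_s * \sum_(i < d) Sig i i
  else \sum_(i < d) (Y i ^+ 2 - sigD2 * Sig i i).

Definition Nstar : R := Num.sqrt `|Qstar|.

End Defs.

Definition psistar (R : realType) (d : nat) (s : nat) (Sig : 'M[R]_d) : R :=
  if s%:R <= frob Sig then s%:R * ln (1 + frob Sig ^+ 2 / s%:R ^+ 2)
  else s%:R / Num.max 1 (ln (s%:R / frob Sig)).

(* Main.v *)
Require Import Defs.
From HB Require Import structures.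
From mathcomp Require Import all_boot all_order all_algebra.
From mathcomp Require Import all_classical all_reals all_analysis.
From mathcomp Require Import measurable_realfun lebesgue_measure ring lra.
Set Implicit Arguments. Unset Strict Implicit. Unset Printing Implicit Defensive.
Import Order.TTheory GRing.Theory Num.Theory.
Import numFieldNormedType.Exports.
Local Open Scope classical_set_scope.
Local Open Scope ring_scope.

(** Write [x_i = (A z)_i / sigi i] for the standardized noise; its correlation matrix is
    [Sigtil Sig], and [cstar * frob (Sigtil Sig) <= frob Sig]. The Mehler kernel shows that
    [|Cov(f x_i, f x_j)| <= C rho_ij^2] for even [f] of moderate growth, so a sum of centered
    [f x_i] has second moment at most [C * frob (Sigtil Sig) ^+ 2]. The squared loss is dominated
    pointwise by a linear combination of squares of such sums, so that the estimator is never
    integrated itself.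

    The good event is that the empirical c.d.f. of the [x_i ^+ 2] is close to [chi2cdf] at three
    consecutive dyadic points; there [that / sigma ^+ 2] takes one of two values and [sigS2] is
    accurate, while the complement has probability at most [C * (frob (Sigtil Sig) / d) ^+ 2].
    In the dense zone the error of [sigD2] is that of the empirical characteristic function divided
    by [expR (- lam / (2 * y))], and [lam] is small enough for the noise to be absorbed by the bias
    [s / lam]. In the sparse zone the random threshold is handled by peeling: an error [D] in
    [sigS2] affects only the [x_i] in a band of relative width [D] around [tau], and the dyadic
    widths starting at [frob Sig / d] are summed with geometric weights. On the bad event the loss is
    at most [C * sigma ^+ 2 * ln (1 + frob Sig ^+ 2 / s ^+ 2) * d], whence the last term of (iii). *)

(** The estimator contains an infimum over powers of two, a quantile and a logarithm, and
    [gauss_int] is an iterated integral with no measurability requirement. Hence [upE]: only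
    measurable majorants are ever added or scaled. Only a square root [A] of the covariance is
    given, so two noise coordinates may be perfectly correlated and have no joint density. The
    Mehler kernel is therefore compared with 1 only for [|r| <= 1 / 4]; beyond, [r ^+ 2] is bounded
    below and Cauchy-Schwarz is enough. Evenness cancels the first-order term in [r]. The one odd
    sum, of sines, keeps [|r|], but its weights vanish off the support of [theta]. Three constants
    of the estimator drive the estimates. The 3 in [tau] makes [expR (- (tau ^+ 2 / 18))] the
    inverse square root of [1 + frob Sig ^+ 2 / s ^+ 2], so fluctuations above the threshold are of
    order [s]. The 1/6 in [lam] lets [expR (6 * lam)] be compared with [s / frob (Sigtil Sig)],
    while the noise costs at most [expR (4 * lam)]. The dyadic scale of [that] suits the window
    [9 / 32 < y0 <= 9 / 16]: the median of [chi2cdf] lies between its ends, with room for the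
    empirical error. *)

Section gaussian_measure.
Variable R : realType.
Local Notation mu := (@lebesgue_measure R).
Local Notation RT := (measurableTypeR R).

(** For nonnegative functions the integral is a supremum over simple functions below the integrand,
    which is monotone without measurability. This lets [gauss_int] of the loss be bounded although
    the loss is never shown measurable. *)
Lemma ge0_le_integral_nomeas d (T : measurableType d) (nu : {measure set T -> \bar R})
    (f g : T -> \bar R) : (forall x, 0 <= f x)%E -> (forall x, f x <= g x)%E ->
  (\int[nu]_x f x <= \int[nu]_x g x)%E.
Proof.
move=> f0 fg; have g0 x : (0 <= g x)%E by exact: le_trans (fg x).
rewrite !ge0_integralTE//; apply: ereal_sup_le => _ [h hf <-].
by exists h => // x; exact: le_trans (fg x).
Qed.

(** Lebesgue measure equals its pushforward under the affine map scaled by [|a|]: both agree on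
    half-open intervals, and uniqueness of Lebesgue measure does the rest. *)
Lemma ge0_integral_affine (a b : R) (f : R -> \bar R) : a != 0 ->
  measurable_fun [set: R] f -> (forall x, 0 <= f x)%E ->
  (\int[mu]_x f (a * x + b)%R = (`|a|^-1)%:E * \int[mu]_x f x)%E.
Proof.
move=> a0 mf f0.
pose phi := fun x : R => a * x + b.
have mphi : measurable_fun [set: R] phi.
  by apply: measurable_funD => //; apply: measurable_funM.
have na : 0 <= `|a| by [].
pose k : {nonneg R} := NngNum na.
have mphi' : @measurable_fun _ _ RT RT setT phi := mphi.
pose psi : RT -> RT := phi.
have eqm : forall A : set RT, measurable A -> mu A = mscale k (pushforward mu psi) A.
  have H := @lebesgue_measure_unique R (mscale k (pushforward mu psi)). move=> m; refine (H m _) => _ [[c d] _ <-].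
  change (mu `]c, d]%classic = (`|a|%:E * mu (psi @^-1` `]c, d]%classic))%E).
  have a1 : 0 < `|a| by rewrite normr_gt0.
  have [ap|an] := ltP 0 a.
    have -> : psi @^-1` `]c, d]%classic = `](c - b) / a, (d - b) / a]%classic.
      apply/seteqP; split => x /=; rewrite !in_itv/= /psi /phi => /andP[h1 h2];
      [rewrite ltr_pdivrMr// ler_pdivlMr//|move: h1 h2; rewrite ltr_pdivrMr// ler_pdivlMr// => h1 h2];
      by apply/andP; split; lra.
    rewrite !lebesgue_measure_itv/= !lte_fin ltr_pM2r ?invr_gt0// ltrD2r.
    case: ifPn => cd; last by rewrite mule0.
    rewrite gtr0_norm// -!EFinB -EFinM -mulrBl.
    by congr EFin; rewrite mulrCA divff// mulr1; ring.
  (* A decreasing map turns the half-open interval around, closed on the left and open on the right;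
     its length is unchanged. *)
  have an' : a < 0 by rewrite lt_neqAle a0 an.
  have -> : psi @^-1` `]c, d]%classic = `[(d - b) / a, (c - b) / a[%classic.
    apply/seteqP; split => x /=; rewrite !in_itv/= /psi /phi => /andP[h1 h2];
    [rewrite ler_ndivrMr// ltr_ndivlMr//|move: h1 h2; rewrite ler_ndivrMr// ltr_ndivlMr// => h1 h2];
    by apply/andP; split; lra.
  rewrite !lebesgue_measure_itv/= !lte_fin ltr_nM2r ?invr_lt0// ltrD2r.
  case: ifPn => cd; last by rewrite mule0.
  rewrite ltr0_norm// -!EFinB -EFinM -mulrBl.
  by congr EFin; field.
have I : (\int[mu]_x f x = \int[mscale k (pushforward mu psi)]_x f x)%E.
  by move=> m; apply: eq_measure_integral => A mA _; exact: eqm.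
rewrite (I mphi').
rewrite ge0_integral_mscale//= ge0_integral_pushforward//=.
by rewrite preimage_setT muleA -EFinM mulVf ?mul1e// normr_eq0.
Qed.

Definition gam : probability RT R := @normal_prob R 0 1.
Definition phi (x : R) : R := normal_pdf 0 1 x.

Lemma phiE x : phi x = (Num.sqrt (pi *+ 2))^-1 * expR (- (x ^+ 2 / 2)).
Proof.
rewrite /phi normal_pdfE ?oner_eq0// /normal_peak /normal_fun subr0.
by rewrite expr1n mul1r mulNr.
Qed.

Lemma phi_gt0 x : 0 < phi x.
Proof.
by rewrite phiE mulr_gt0 ?expR_gt0// invr_gt0 sqrtr_gt0 pmulrn_lgt0// pi_gt0.
Qed.

Lemma phi_ge0 x : 0 <= phi x. Proof. exact/ltW/phi_gt0. Qed.

Lemma measurable_phi : measurable_fun [set: R] phi.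
Proof. exact: measurable_normal_pdf. Qed.

(** The Radon-Nikodym derivative of [gam] and the explicit density have the same integral over every
    measurable set, so they agree almost everywhere. *)
Lemma ge0_integral_gam (f : R -> \bar R) : measurable_fun [set: R] f ->
  (forall x, 0 <= f x)%E ->
  (\int[gam]_x f x = \int[mu]_x ((phi x)%:E * f x))%E.
Proof.
move=> mf f0.
have dom : gam `<< mu by exact: normal_prob_dominates.
rewrite -(Radon_Nikodym_SigmaFinite.change_of_variables dom)//.
pose g := Radon_Nikodym_SigmaFinite.f gam mu.
have ig := Radon_Nikodym_SigmaFinite.f_integrable dom.
have mphi : measurable_fun [set: R] (fun x => (phi x)%:E).
  by apply/measurable_EFinP; exact: measurable_phi.
have ae : ae_eq mu setT g (fun x => (phi x)%:E).
  apply: integral_ae_eq => // E _ mE.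
  by rewrite -(Radon_Nikodym_SigmaFinite.f_integral dom).
apply: ae_eq_integral => //.
- by apply: emeasurable_funM => //; exact: measurable_int ig.
- exact: emeasurable_funM.
- rewrite /=; case: ae => N [mN N0 sub]; exists N; split => // x /= h.
  by apply: sub => /= h'; apply: h => /h' h2; rewrite muleC -h2.
Qed.

End gaussian_measure.

(** * Rotation invariance of the standard Gaussian measure of the plane *)

Section gaussian_rotation.
Variable R : realType.
Local Notation mu := (@lebesgue_measure R).
Local Notation gam := (gam R).

Lemma measurable_fun_comp2 d (T : measurableType d) d2 (U : measurableType d2)
  (H : R * R -> U) (f g : T -> R) :
  measurable_fun [set: R * R] H -> measurable_fun setT f -> measurable_fun setT g ->
  measurable_fun setT (fun t => H (f t, g t)).
Proof.
by move=> mH mf mg; have := measurableT_comp mH (measurable_fun_pair mf mg).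
Qed.

Lemma measurable_sectionl (H : R * R -> \bar R) x :
  measurable_fun [set: R * R] H -> measurable_fun [set: R] (fun y => H (x, y)).
Proof. by move=> mH; apply: measurable_fun_comp2. Qed.

Lemma measurable_sectionr (H : R * R -> \bar R) y :
  measurable_fun [set: R * R] H -> measurable_fun [set: R] (fun x => H (x, y)).
Proof. by move=> mH; apply: measurable_fun_comp2. Qed.

Lemma measurable_int2 (nu : {sigma_finite_measure set (measurableTypeR R) -> \bar R})
    (H : R * R -> \bar R) :
  measurable_fun [set: R * R] H -> (forall z, 0 <= H z)%E ->
  measurable_fun [set: R] (fun x => \int[nu]_y H (x, y))%E.
Proof. by move=> mH H0; exact: (measurable_fun_fubini_tonelli_F (m2 := nu) H mH H0). Qed.

Lemma measurable_int1 (nu : {sigma_finite_measure set (measurableTypeR R) -> \bar R})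
    (H : R * R -> \bar R) :
  measurable_fun [set: R * R] H -> (forall z, 0 <= H z)%E ->
  measurable_fun [set: R] (fun y => \int[nu]_x H (x, y))%E.
Proof. by move=> mH H0; exact: (measurable_fun_fubini_tonelli_G (m1 := nu) H mH H0). Qed.

(** For [c != 0] the rotation is a composition of two one-dimensional affine changes of variable:
    first [v = - s * x + c * y] at fixed [x], then, after exchanging the integrals, a change in [x]
    at fixed [v]. Their factors [|c|^-1] and [|c|] cancel. *)
Lemma lebesgue2_rotation (c s : R) (G : R * R -> \bar R) : c != 0 -> c ^+ 2 + s ^+ 2 = 1 ->
  measurable_fun [set: R * R] G -> (forall z, 0 <= G z)%E ->
  (\int[mu]_x \int[mu]_y G (c * x + s * y, - s * x + c * y)%R =
   \int[mu]_x \int[mu]_y G (x, y))%E.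
Proof.
move=> c0 cs mG G0.
have fst_ : measurable_fun [set: R * R] (fun z : R * R => z.1) by exact: measurable_fst.
have snd_ : measurable_fun [set: R * R] (fun z : R * R => z.2) by exact: measurable_snd.
have mG1 : measurable_fun [set: R * R] (fun z : R * R => G ((z.1 + s * z.2) / c, z.2)).
  apply: measurable_fun_comp2 => //; apply: measurable_funM => //.
  by apply: measurable_funD => //; apply: measurable_funM.
transitivity (\int[mu]_x ((`|c|^-1)%:E * \int[mu]_v G ((x + s * v) / c, v)%R))%E.
  apply: eq_integral => x _.
  rewrite -(@ge0_integral_affine _ c (- s * x) (fun v => G ((x + s * v) / c, v)))//.
    apply: eq_integral => y _; rewrite (addrC (c * y)); congr (G (_, _)).
    have -> : c * x + s * y = (c ^+ 2 * x + c * s * y) / c by field.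
    by congr (_ / _); have -> : c ^+ 2 = 1 - s ^+ 2; [rewrite -cs; ring|ring].

  exact: (measurable_sectionl x mG1).
rewrite ge0_integralZl//; first last.
- by move=> x _; exact: integral_ge0.
- exact: (measurable_int2 mu mG1).
rewrite (fubini_tonelli (m1 := mu) (m2 := mu) _ mG1)//= .
rewrite -ge0_integralZl//; first last.
- by move=> x _; exact: integral_ge0.
- exact: (measurable_int1 mu mG1).
rewrite (fubini_tonelli (m1 := mu) (m2 := mu) _ mG)//=.
apply: eq_integral => v _.
have ci0 : c^-1 != 0 by rewrite invr_eq0.
have := @ge0_integral_affine _ c^-1 (s * v / c) (fun x => G (x, v)) ci0.
have mGv := measurable_sectionr v mG.
move=> /(_ mGv (fun x => G0 (x, v))) e.
have -> : (\int[mu]_x G ((x + s * v) / c, v)%R = \int[mu]_x G (c^-1 * x + s * v / c, v)%R)%E.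
  by apply: eq_integral => x _; rewrite mulrDl (mulrC c^-1).
by rewrite e muleA -EFinM normfV invrK mulVf ?mul1e// normr_eq0.
Qed.

Lemma gam2E (H : R * R -> \bar R) : measurable_fun [set: R * R] H -> (forall z, 0 <= H z)%E ->
  (\int[gam]_x \int[gam]_y H (x, y) =
   \int[mu]_x \int[mu]_y ((phi x * phi y)%:E * H (x, y)))%E.
Proof.
move=> mH H0.
have msec x := measurable_sectionl x mH.
rewrite ge0_integral_gam; first last.
- by move=> x; exact: integral_ge0.
- exact: (measurable_int2 gam mH).
apply: eq_integral => x _; rewrite ge0_integral_gam//.
rewrite -ge0_integralZl//.
- by apply: eq_integral => y _; rewrite muleA.
- apply: emeasurable_funM; [apply/measurable_EFinP; exact: measurable_phi|exact: msec].
- by move=> y _; rewrite mule_ge0// lee_fin phi_ge0.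
- by rewrite lee_fin phi_ge0.
Qed.

Lemma gam_opp (f : R -> \bar R) : measurable_fun [set: R] f -> (forall x, 0 <= f x)%E ->
  (\int[gam]_x f (- x)%R = \int[gam]_x f x)%E.
Proof.
move=> mf f0; rewrite !ge0_integral_gam//; last first.
  by apply: measurableT_comp => //.
have mg : measurable_fun [set: R] (fun x => (phi x)%:E * f x)%E.
  by apply: emeasurable_funM => //; apply/measurable_EFinP; exact: measurable_phi.
have g0 x : (0 <= (phi x)%:E * f x)%E by rewrite mule_ge0// lee_fin phi_ge0.
have := @ge0_integral_affine _ (-1) 0 _ _ mg g0; rewrite normrN1 invr1 mul1e.
move=> <-; last by rewrite oppr_eq0 oner_eq0.
by apply: eq_integral => x _; rewrite addr0 mulN1r !phiE sqrrN.
Qed.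

(** The product density depends on the sum of squares only, which a rotation preserves, so
    invariance is inherited from Lebesgue measure. *)
Lemma gam2_rotation (c s : R) (H : R * R -> \bar R) : c ^+ 2 + s ^+ 2 = 1 ->
  measurable_fun [set: R * R] H -> (forall z, 0 <= H z)%E ->
  (\int[gam]_x \int[gam]_y H (c * x + s * y, - s * x + c * y)%R =
   \int[gam]_x \int[gam]_y H (x, y))%E.
Proof.
move=> cs mH H0.
have fst_ : measurable_fun [set: R * R] (fun z : R * R => z.1) by exact: measurable_fst.
have snd_ : measurable_fun [set: R * R] (fun z : R * R => z.2) by exact: measurable_snd.
have msec x := measurable_sectionl x mH.
(* The factorisation above divides by [c]. For [c = 0] the rotation is an exchange of coordinates
   with one sign change, settled by Tonelli and the symmetry of [gam]. *)
have [c0|c0] := eqVneq c 0.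
  have s1 : (s == 1) || (s == -1).
    by rewrite -sqrf_eq1; move: cs; rewrite c0 expr0n/= add0r => ->.
  have mH' : measurable_fun [set: R * R] (fun z : R * R => H (s * z.2, z.1)).
    by apply: measurable_fun_comp2 => //; apply: measurable_funM.
  have -> : (\int[gam]_x \int[gam]_y H (c * x + s * y, - s * x + c * y)%R =
     \int[gam]_x \int[gam]_y H (s * y, - s * x)%R)%E.
    by apply: eq_integral => x _; apply: eq_integral => y _; rewrite c0 !mul0r add0r addr0.
  transitivity (\int[gam]_x \int[gam]_y H (s * y, x)%R)%E.
    case/orP : s1 => /eqP ->.
      under eq_integral do under eq_integral do rewrite mulN1r.
      rewrite (@gam_opp (fun x => \int[gam]_y H (1 * y, x)%R)%E)//.
      - apply: (measurable_int2 gam (H := fun z : R * R => H (1 * z.2, z.1)))=> //.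
        by apply: measurable_fun_comp2 => //; apply: measurable_funM.
      - by move=> x; exact: integral_ge0.
    by apply: eq_integral => x _; apply: eq_integral => y _; rewrite opprK mul1r.
  rewrite (fubini_tonelli (m1 := gam) (m2 := gam) _ mH')//=.
  case/orP : s1 => /eqP ->.
    by apply: eq_integral => x _; apply: eq_integral => y _; rewrite mul1r.
  under eq_integral do under eq_integral do rewrite mulN1r.
  rewrite (@gam_opp (fun x => \int[gam]_y H (x, y)%R)%E)//.
  - exact: (measurable_int2 gam mH).
  - by move=> x; exact: integral_ge0.
have mH1 : measurable_fun [set: R * R]
    (fun z : R * R => H (c * z.1 + s * z.2, - s * z.1 + c * z.2)).
  by apply: measurable_fun_comp2 => //; apply: measurable_funD => //; apply: measurable_funM.
transitivity (\int[mu]_x \int[mu]_y ((phi x * phi y)%:E *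
    H (c * x + s * y, - s * x + c * y)%R))%E.
  exact: (gam2E mH1 (fun z => H0 _)).
transitivity (\int[mu]_x \int[mu]_y ((phi x * phi y)%:E * H (x, y)))%E; last first.
  exact/esym/(gam2E mH H0).
pose G := (fun z : R * R => (phi z.1 * phi z.2)%:E * H z)%E.
have mG : measurable_fun [set: R * R] G.
  apply: emeasurable_funM => //; apply/measurable_EFinP.
  by apply: measurable_funM; apply: measurableT_comp => //; exact: measurable_phi.
have G0 z : (0 <= G z)%E by rewrite mule_ge0// lee_fin mulr_ge0// phi_ge0.
transitivity (\int[mu]_x \int[mu]_y G (c * x + s * y, - s * x + c * y)%R)%E; last first.
  exact: (lebesgue2_rotation c0 cs mG G0).
apply: eq_integral => x _; apply: eq_integral => y _; rewrite /G/=; congr (_ * _)%E.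
congr EFin; rewrite !phiE mulrACA [RHS]mulrACA -!expRD; congr (_ * expR _).
have e : (c * x + s * y) ^+ 2 + (- s * x + c * y) ^+ 2 = x ^+ 2 + y ^+ 2.
  by transitivity ((c ^+ 2 + s ^+ 2) * (x ^+ 2 + y ^+ 2)); [ring|rewrite cs mul1r].
by rewrite -!opprD -!mulrDl e.
Qed.

End gaussian_rotation.

(** * Iterated Gaussian integrals: a probability space behind them, and laws of pairs of linear
    forms *)

Section gauss_int_theory.
Variable R : realType.
Local Notation mu := (@lebesgue_measure R).
Local Notation gam := (gam R).
Implicit Types (z : nat -> R) (f g : (nat -> R) -> \bar R).

Lemma gam_cst (c : \bar R) : (\int[gam]_x c = c)%E.
Proof.
rewrite (integral_cst gam)// [X in (_ * X)%E](_ : _ = 1%E) ?mule1//.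
exact: (probability_setT gam).
Qed.

Lemma gauss_int_ge0 n f : (forall z, 0 <= f z)%E -> (0 <= gauss_int n f)%E.
Proof.
elim: n f => [|n IH] f f0 //=; apply: integral_ge0 => x _.
by rewrite mule_ge0 ?lee_fin ?normal_pdf_ge0//; apply: IH.
Qed.

Lemma gauss_int_le n f g : (forall z, 0 <= f z)%E -> (forall z, f z <= g z)%E ->
  (gauss_int n f <= gauss_int n g)%E.
Proof.
elim: n f g => [|n IH] f g f0 fg //=; apply: ge0_le_integral_nomeas => x.
  by rewrite mule_ge0 ?lee_fin ?normal_pdf_ge0//; apply: gauss_int_ge0.
by apply: lee_wpmul2l; [rewrite lee_fin normal_pdf_ge0|exact: IH].
Qed.

(* Measurability along every sequence of measurable coordinates. *)
Definition mfunctional f := forall d (T : measurableType d) (Z : nat -> T -> R),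
  (forall k, measurable_fun setT (Z k)) -> measurable_fun setT (fun t => f (fun k => Z k t)).

(** Links the recursion [gauss_int] to one integral over a probability space, where linearity and
    integrability theory are available. *)
Definition gauss_repr n d (T : measurableType d) (P : probability T R) (Z : nat -> T -> R) :=
  (forall k, measurable_fun setT (Z k)) /\
  forall f, (forall z, 0 <= f z)%E -> mfunctional f ->
    gauss_int n f = (\int[P]_t f (fun k => Z k t))%E.

(** Each step takes the product with one more copy of [gam], carrying coordinate [n]; Tonelli
    unfolds the product integral exactly as [gauss_int] recurses. *)
Lemma gauss_reprP n : exists d (T : measurableType d) (P : probability T R) Z,
  @gauss_repr n d T P Z.
Proof.
elim: n => [|n [d [T [P [Z [mZ IH]]]]]].
  exists _, (measurableTypeR R), gam, (fun _ _ => 0); split.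
    by move=> k; exact: measurable_cst.
  by move=> f f0 mf /=; rewrite gam_cst.
exists _, (measurableTypeR R * T)%type, (gam \x P)%E,
  (fun k t => if k == n then t.1 else Z k t.2).
have mZ' k : measurable_fun [set: measurableTypeR R * T]
    (fun t => if k == n then t.1 else Z k t.2).
  case: (k == n); first exact: measurable_fst.
  exact: (measurableT_comp (mZ k) (@measurable_snd _ _ (measurableTypeR R) T)).
split => // f f0 mf /=.
have mF := mf _ _ _ mZ'.
rewrite fubini_tonelli1//= ge0_integral_gam; first last.
- by move=> x; exact: integral_ge0.
- exact: (measurable_fun_fubini_tonelli_F (m2 := P) _ mF).
apply: eq_integral => x _; congr (_ * _)%E.
rewrite IH//.
move=> d' T' Z2 mZ2; have := mf _ _ (fun k t => if k == n then x else Z2 k t).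
by apply => k; case: eqP.
Qed.

Definition lin n (a : nat -> R) z : R := \sum_(j < n) a j * z j.

Lemma linS n a z x : lin n.+1 a (fun k => if k == n then x else z k) = lin n a z + a n * x.
Proof.
rewrite /lin big_ord_recr/= eqxx; congr (_ + _); apply: eq_bigr => j _.
by rewrite ltn_eqF.
Qed.

Lemma polar (a b : R) : exists c s, c ^+ 2 + s ^+ 2 = 1 /\
  a = Num.sqrt (a ^+ 2 + b ^+ 2) * c /\ b = Num.sqrt (a ^+ 2 + b ^+ 2) * s.
Proof.
have h : 0 <= a ^+ 2 + b ^+ 2 by rewrite addr_ge0 ?sqr_ge0.
set r := Num.sqrt _; have r2 : r ^+ 2 = a ^+ 2 + b ^+ 2 by rewrite sqr_sqrtr.
have [r0|r0] := eqVneq r 0.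
  exists 1, 0; rewrite expr1n expr0n addr0 r0 !mul0r; split=> //.
  move: r2; rewrite r0 expr0n/= => /esym/eqP; rewrite paddr_eq0 ?sqr_ge0// !sqrf_eq0.
  by move=> /andP[/eqP -> /eqP ->].
exists (a / r), (b / r); split; last by split; field.
by rewrite !expr_div_n -mulrDl -r2 divff// sqrf_eq0.
Qed.

(** Rotating the pair by the angle of [(w, m)] makes the argument of [h] a multiple of the second
    coordinate alone; the first integrates out. *)
Lemma gam_conv (m w : R) (h : R -> \bar R) : measurable_fun [set: R] h ->
  (forall x, 0 <= h x)%E ->
  (\int[gam]_t \int[gam]_y h (m * t + w * y)%R =
   \int[gam]_y h (Num.sqrt (w ^+ 2 + m ^+ 2) * y)%R)%E.
Proof.
move=> mh h0; have [c [s [cs [e1 e2]]]] := polar w m; set r := Num.sqrt _ in e1 e2 *.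
have mH : measurable_fun [set: R * R] (fun z : R * R => h (m * z.1 + w * z.2)).
  apply: measurableT_comp => //.
  by apply: measurable_funD; apply: measurable_funM.
rewrite -(@gam2_rotation _ c s (fun z : R * R => h (m * z.1 + w * z.2)))//=.
transitivity (\int[gam]_t \int[gam]_y h (r * y)%R)%E; last by rewrite gam_cst.
apply: eq_integral => t _; apply: eq_integral => y _; congr h.
rewrite e1 e2; transitivity (r * y * (c ^+ 2 + s ^+ 2)); last by rewrite cs mulr1.
by ring.
Qed.

(** The Cholesky form of a centred Gaussian pair: variances [p ^+ 2] and [q ^+ 2 + w ^+ 2],
    covariance [p * q]. Degenerate pairs ([p = 0] or [w = 0]) are included. *)
Definition pair_law (p q w : R) (H : R * R -> \bar R) : \bar R :=
  (\int[gam]_x \int[gam]_y H (p * x, q * x + w * y)%R)%E.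

(** Gram-Schmidt by induction on the number of coordinates. A new coordinate gives three independent
    directions; a rotation brings the first form back to one direction, and the two directions left
    in the second form merge into one. *)
Lemma gauss_pair n (a b : nat -> R) : exists p q w : R, [/\ 0 <= p, 0 <= w,
   p ^+ 2 = \sum_(j < n) a j ^+ 2, p * q = \sum_(j < n) a j * b j &
   q ^+ 2 + w ^+ 2 = \sum_(j < n) b j ^+ 2] /\
  forall H : R * R -> \bar R, measurable_fun [set: R * R] H -> (forall u, 0 <= H u)%E ->
   gauss_int n (fun z => H (lin n a z, lin n b z)) = pair_law p q w H.
Proof.
elim: n => [|n [p [q [w [[p0 w0 pp pq qw] IH]]]]].
  exists 0, 0, 0; rewrite !big_ord0; split.
    by split => //; rewrite ?mul0r ?expr0n/= ?addr0.
  move=> H mH H0 /=; rewrite /pair_law /lin !big_ord0.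
  by under eq_integral do under eq_integral do rewrite !mul0r addr0; rewrite !gam_cst.
have [c [s [cs [e1 e2]]]] := polar p (a n); set p' := Num.sqrt _ in e1 e2.
pose q' := q * c + b n * s; pose m := b n * c - q * s.
pose w' := Num.sqrt (w ^+ 2 + m ^+ 2).
have w'2 : w' ^+ 2 = w ^+ 2 + m ^+ 2 by rewrite sqr_sqrtr// addr_ge0 ?sqr_ge0.
have p'2 : p' ^+ 2 = p ^+ 2 + a n ^+ 2 by rewrite sqr_sqrtr// addr_ge0 ?sqr_ge0.
exists p', q', w'; rewrite !big_ord_recr/= -pp -pq -qw; split.
  split; rewrite ?sqrtr_ge0//.
    rewrite [in RHS]e1 [in RHS]e2 /q'; ring.
  rewrite w'2; transitivity ((q ^+ 2 + b n ^+ 2) * (c ^+ 2 + s ^+ 2) + w ^+ 2).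
    by rewrite /q' /m; ring.
  by rewrite cs; ring.
move=> H mH H0 /=.
have fst_ d1 d2 (T1 : measurableType d1) (T2 : measurableType d2) :
  measurable_fun setT (fun z : T1 * T2 => z.1) by exact: measurable_fst.
have snd_ d1 d2 (T1 : measurableType d1) (T2 : measurableType d2) :
  measurable_fun setT (fun z : T1 * T2 => z.2) by exact: measurable_snd.
have mcs (k : R) (d1 : measure_display) (T1 : measurableType d1) (f : T1 -> R) :
   measurable_fun setT f -> measurable_fun setT (fun u => k * f u).
  by move=> mf; apply: measurable_funM.
have mff d1 d2 d3 (T1 : measurableType d1) (T2 : measurableType d2) (T3 : measurableType d3) :
  measurable_fun setT (fun z : T1 * T2 * T3 => z.1.1).
  exact: (measurableT_comp (fst_ _ _ _ _) (fst_ _ _ _ _)).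
have mfs d1 d2 d3 (T1 : measurableType d1) (T2 : measurableType d2) (T3 : measurableType d3) :
  measurable_fun setT (fun z : T1 * T2 * T3 => z.1.2).
  exact: (measurableT_comp (snd_ _ _ _ _) (fst_ _ _ _ _)).
pose K (tx : R * R) := (\int[gam]_y H (p * tx.2 + a n * tx.1, q * tx.2 + w * y + b n * tx.1)%R)%E.
have mK3 : measurable_fun setT (fun u : R * R * R =>
    H (p * u.1.2 + a n * u.1.1, q * u.1.2 + w * u.2 + b n * u.1.1)).
  apply: measurable_fun_comp2 => //; repeat apply: measurable_funD; apply: mcs; first [exact: mff|exact: mfs|exact: snd_].
have mK : measurable_fun [set: R * R] K by exact: (measurable_fun_fubini_tonelli_F (m2 := gam) _ mK3).
have K0 u : (0 <= K u)%E by exact: integral_ge0.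
transitivity (\int[gam]_t \int[gam]_x K (t, x))%E.
  rewrite ge0_integral_gam; first last.
  - by move=> x; exact: integral_ge0.
  - exact: (measurable_int2 gam mK).
  apply: eq_integral => t _; congr (_ * _)%E.
  transitivity (pair_law p q w (fun u : R * R => H (u.1 + a n * t, u.2 + b n * t))) => //.
  rewrite -IH//.
    by congr gauss_int; apply/funext => z; rewrite !linS.
  by apply: measurable_fun_comp2 => //; apply: measurable_funD.
(* Rotating the new coordinate with the old first direction removes the former from the first form,
   by the choice of [c] and [s]. *)
rewrite -(gam2_rotation cs mK K0).
pose K2 (tx : R * R) := (\int[gam]_y H (p' * tx.2, q' * tx.2 + (m * tx.1 + w * y))%R)%E.
have mK23 : measurable_fun setT (fun u : R * R * R =>
    H (p' * u.1.2, q' * u.1.2 + (m * u.1.1 + w * u.2))).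
  apply: measurable_fun_comp2 => //; repeat apply: measurable_funD; apply: mcs; first [exact: mff|exact: mfs|exact: snd_].
have mK2 : measurable_fun [set: R * R] K2 by exact: (measurable_fun_fubini_tonelli_F (m2 := gam) _ mK23).
transitivity (\int[gam]_t \int[gam]_x K2 (t, x))%E.
  apply: eq_integral => t _; apply: eq_integral => x _; apply: eq_integral => y _ /=.
  congr (H (_, _)); rewrite ?e1 ?e2 /q' /m; last by ring.
  by transitivity (p' * x * (c ^+ 2 + s ^+ 2)); [ring|rewrite cs mulr1].
rewrite (fubini_tonelli (m1 := gam) (m2 := gam) _ mK2); last by move=> u; exact: integral_ge0.
apply: eq_integral => x _; rewrite /K2/=.
(* The second form now has the residue [m * t + w * y], independent of [x], which is a single
   Gaussian of variance [w' ^+ 2]. *)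
rewrite -(@gam_conv m w (fun u => H (p' * x, q' * x + u)))//.
by apply: measurable_fun_comp2 => //; apply: measurable_funD.
Qed.

End gauss_int_theory.

(** * Moments and integrability under the standard Gaussian on the line *)

Section gaussian_scalar.
Variable R : realType.
Local Notation mu := (@lebesgue_measure R).
Local Notation gam := (gam R).
Implicit Types (x a B : R) (f : R -> R).

Lemma integrableZ_EFin d (T : measurableType d) (P : {measure set T -> \bar R}) (c : R)
    (f : T -> R) : P.-integrable setT (EFin \o f) ->
  P.-integrable setT (EFin \o (fun t => c * f t)).
Proof. by move=> h; apply: eq_integrable (integrableZl measurableT c h) => // t _. Qed.

Lemma integrableD_EFin d (T : measurableType d) (P : {measure set T -> \bar R})
    (f g : T -> R) : P.-integrable setT (EFin \o f) -> P.-integrable setT (EFin \o g) ->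
  P.-integrable setT (EFin \o (fun t => f t + g t)).
Proof. by move=> h1 h2; apply: eq_integrable (integrableD measurableT h1 h2) => // t _. Qed.

Lemma integrableB_EFin d (T : measurableType d) (P : {measure set T -> \bar R})
    (f g : T -> R) : P.-integrable setT (EFin \o f) -> P.-integrable setT (EFin \o g) ->
  P.-integrable setT (EFin \o (fun t => f t - g t)).
Proof. by move=> h1 h2; apply: eq_integrable (integrableB measurableT h1 h2) => // t _. Qed.

(** The integrand times the N(0, 1) density is [s] times the N(0, s^2) density. This one formula
    yields both the integrable envelope and the second moment. *)
Lemma gam_expR_sq (s : R) : 0 < s ->
  (\int[gam]_x (expR ((1 - s ^- 2) / 2 * x ^+ 2))%:E = s%:E)%E.
Proof.
move=> s0; rewrite ge0_integral_gam; first last.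
- by move=> x; rewrite lee_fin expR_ge0.
- apply/measurable_EFinP; apply: measurableT_comp => //.
  by apply: measurable_funM => //; apply: measurable_funX.
rewrite -[RHS]mule1 -(integral_normal_pdf 0 s) -ge0_integralZl//; first last.
- by rewrite lee_fin ltW.
- by move=> x _; rewrite lee_fin normal_pdf_ge0.
- by apply/measurable_EFinP; exact: measurable_normal_pdf.
apply: eq_integral => x _; rewrite -!EFinM; congr EFin.
rewrite phiE -[LHS]mulrA -expRD normal_pdfE ?gt_eqF// /normal_fun. rewrite [RHS]mulrA; congr (_ * expR _).
  rewrite /normal_peak -mulrnAr sqrtrM ?sqr_ge0// sqrtr_sqr gtr0_norm// invfM.
  by rewrite mulrA divff ?mul1r// gt_eqF.
by rewrite subr0; field; rewrite gt_eqF.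
Qed.

Lemma gam_expR38 : (\int[gam]_x (expR (3 / 8 * x ^+ 2))%:E = 2%:E)%E.
Proof.
apply: etrans (gam_expR_sq (ltr0n R 2)); apply: eq_integral => x _.
by have -> : (3 / 8 : R) = (1 - 2 ^- 2) / 2 by field.
Qed.

(** The exponent 1/8 is a budget: in each variable [f] contributes 1/8 and the kernel bounds 1/4, so
    an integrand [f x * f v] against a kernel stays below the exponent 3/8, whose Gaussian integral
    is 2. *)
Definition growth B f := measurable_fun setT f /\ forall x, `|f x| <= B * expR (x ^+ 2 / 8).

Lemma growth_ge0 B f : growth B f -> 0 <= B.
Proof.
move=> [_ /(_ 0)]; rewrite expr0n/= mul0r expR0 mulr1.
exact: le_trans (normr_ge0 _).
Qed.

Lemma measurable_expR_sq (k : R) : measurable_fun [set: R] (fun x => expR (k * x ^+ 2)).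
Proof.
apply: measurableT_comp => //; apply: measurable_funM => //; exact: measurable_funX.
Qed.

Lemma le_gam_integral f B : measurable_fun setT f -> (forall x, `|f x| <= B * expR (3 / 8 * x ^+ 2)) ->
  gam.-integrable setT (EFin \o f) /\ `|\int[gam]_x f x| <= 2 * B.
Proof.
move=> mf fB.
have B0 : 0 <= B.
  by have := fB 0; rewrite expr0n/= mulr0 expR0 mulr1; exact: le_trans (normr_ge0 _).
have mE : measurable_fun [set: R] (fun x => (B * expR (3 / 8 * x ^+ 2))%:E).
  by apply/measurable_EFinP/measurable_funM => //; exact: measurable_expR_sq.
have IE : (\int[gam]_x (B * expR (3 / 8 * x ^+ 2))%:E = (2 * B)%:E)%E.
  under eq_integral do rewrite EFinM.
  rewrite ge0_integralZl//; first last.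
  - by apply/measurable_EFinP; exact: measurable_expR_sq.
  by rewrite gam_expR38 -EFinM mulrC.
have le : (\int[gam]_x `|(f x)%:E| <= (2 * B)%:E)%E.
  rewrite -IE; apply: ge0_le_integral => //.
  - by apply: measurableT_comp => //; apply/measurable_EFinP.
  - by move=> x _; rewrite lee_fin.
have intf : gam.-integrable setT (EFin \o f).
  by apply/integrableP; split; [apply/measurable_EFinP|exact: le_lt_trans le (ltry _)].
split => //; apply: (le_trans (le_normr_Rintegral _ intf)) => //.
rewrite /Rintegral -[leRHS]/(fine (2 * B)%:E) fine_le//.
rewrite ge0_fin_numE//; first exact: le_lt_trans le (ltry _).
by apply: integral_ge0 => x _.
Qed.

Lemma growth_le38 B f : growth B f -> forall x, `|f x| <= B * expR (3 / 8 * x ^+ 2).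
Proof.
move=> h x; have B0 := growth_ge0 h; apply: le_trans (h.2 x) _.
by apply: ler_wpM2l => //; rewrite ler_expR; have := sqr_ge0 x; lra.
Qed.

Lemma growth_integrable B f : growth B f -> gam.-integrable setT (EFin \o f).
Proof. by move=> h; have [] := le_gam_integral h.1 (growth_le38 h). Qed.

Lemma growth_mean B f : growth B f -> `|\int[gam]_x f x| <= 2 * B.
Proof. by move=> h; have [] := le_gam_integral h.1 (growth_le38 h). Qed.

Lemma growth_sqr B f : growth B f -> forall x, `|f x ^+ 2| <= B ^+ 2 * expR (3 / 8 * x ^+ 2).
Proof.
move=> h x; have B0 := growth_ge0 h; rewrite normrX.
have h1 : `|f x| ^+ 2 <= (B * expR (x ^+ 2 / 8)) ^+ 2.
  by rewrite ler_sqr ?nnegrE ?mulr_ge0 ?expR_ge0//; exact: h.2.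
apply: le_trans h1 _; rewrite exprMn; apply: ler_wpM2l; first exact: sqr_ge0.
by rewrite expr2 -expRD ler_expR; have := sqr_ge0 x; lra.
Qed.

Lemma expR_sq8_ge1 x : 1 <= expR (x ^+ 2 / 8).
Proof. by rewrite -[leLHS]expR0 ler_expR divr_ge0 ?sqr_ge0. Qed.

Lemma growth_center B f : growth B f -> growth (3 * B) (fun x => f x - \int[gam]_y f y).
Proof.
move=> h; have B0 := growth_ge0 h; split; first by apply: measurable_funB => //; exact: h.1.
move=> x; apply: le_trans (ler_normB _ _) _.
have := h.2 x; have := growth_mean h; have := expR_sq8_ge1 x.
set e := expR _; set m := `|_|; set n := `|f x| => e1 hm hn.
have : 2 * B * 1 <= 2 * B * e by apply: ler_wpM2l => //; rewrite mulr_ge0.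
lra.
Qed.

Lemma Rintegral_gam_cst (c : R) : \int[gam]_x c = c.
Proof. by rewrite /Rintegral gam_cst. Qed.

Lemma growth_center0 B f : growth B f -> \int[gam]_x (f x - \int[gam]_y f y) = 0.
Proof.
move=> h; rewrite RintegralB//; last 2 first.
- exact: growth_integrable h.
- exact: finite_measure_integrable_cst.
by rewrite Rintegral_gam_cst subrr.
Qed.

Lemma growth_sq : growth 8 (fun x => x ^+ 2).
Proof.
split; first exact: measurable_funX.
move=> x; rewrite ger0_norm ?sqr_ge0//.
have := expR_ge1Dx (x ^+ 2 / 8); lra.
Qed.

(** No integration by parts: [1 + u <= expR u] in the formula for [gam_expR_sq] gives
    [(1 - s ^- 2) / 2 * m <= s - 1] for every [s] in (0, 2], and values of [s] on either side of 1
    force [m = 1]. *)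
Lemma gam_sq : \int[gam]_x (x ^+ 2) = 1.
Proof.
have I2 := growth_integrable growth_sq; set m := \int[gam]_x _.
have IE (s : R) : 0 < s -> s <= 2 ->
    gam.-integrable setT (EFin \o (fun x => expR ((1 - s ^- 2) / 2 * x ^+ 2))).
  move=> s0 s2; apply/integrableP; split.
    by apply/measurable_EFinP; exact: measurable_expR_sq.
  under eq_integral do rewrite /= ger0_norm ?expR_ge0//.
  by rewrite gam_expR_sq// ltry.
have key (s : R) : 0 < s -> s <= 2 -> (1 - s ^- 2) / 2 * m <= s - 1.
  move=> s0 s2; rewrite -RintegralZl//.
  have -> : s - 1 = \int[gam]_x (expR ((1 - s ^- 2) / 2 * x ^+ 2) - 1).
    rewrite RintegralB//; last 2 first.
    - exact: IE.
    - exact: finite_measure_integrable_cst.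
    by rewrite Rintegral_gam_cst /Rintegral gam_expR_sq.
  apply: le_Rintegral => //.
  - exact: integrableZ_EFin.
  - apply: integrableB_EFin => //; first exact: IE.
    exact: finite_measure_integrable_cst.
  - by move=> x _; rewrite lerBrDl; exact: expR_ge1Dx.
have key2 (s : R) : 0 < s -> s <= 2 -> (s - 1) * (s + 1) * m <= 2 * s ^+ 2 * (s - 1).
  move=> s0 s2; have h := key s s0 s2.
  have -> : (s - 1) * (s + 1) * m = 2 * s ^+ 2 * ((1 - s ^- 2) / 2 * m).
    by field; rewrite gt_eqF.
  by apply: ler_wpM2l => //; rewrite mulr_ge0// sqr_ge0.
apply/eqP; rewrite eq_le; apply/andP; split; rewrite leNgt; apply/negP => hm.
(* If [m > 1], this [s] exceeds 1 and [m >= 2 * s - 1], so [(s + 1) * m > 2 * s ^+ 2], against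
   [key2]. The case [m < 1] is the mirror image. *)
- pose s := Num.min 2 ((m + 1) / 2).
  have s1 : 1 < s by rewrite lt_min ltr1n/=; lra.
  have s2 : s <= 2 by rewrite ge_min lexx.
  have sm : s <= (m + 1) / 2 by rewrite ge_min lexx orbT.
  have := key2 s (lt_trans ltr01 s1) s2.
  rewrite -mulrA (mulrC (_ * _) (s - 1)) ler_pM2l ?subr_gt0// => h.
  nra.
- have m0 : 0 <= m by apply: Rintegral_ge0 => x _; exact: sqr_ge0.
  pose s := (m + 1) / 2.
  have s1 : s < 1 by rewrite /s; lra.
  have s0 : 0 < s by rewrite /s; lra.
  have := key2 s s0 (ltW (lt_trans s1 (ltr1n _ 2))).
  rewrite -mulrA (mulrC (_ * _) (s - 1)) ler_nM2l ?subr_lt0//.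
  have -> : m = 2 * s - 1 by rewrite /s; lra.
  nra.
Qed.

End gaussian_scalar.

(** * Taylor bounds for sine and cosine, and an upper bound for [pi] *)

Section trig_bounds.
Variable R : realType.
Implicit Types (x u : R).

(** Applied four times in a row, each use integrating the previous inequality, it produces the
    alternating Taylor bounds of sine and cosine. *)
Lemma derive_ge0_ge0 (f df : R -> R) u : (forall x, is_derive x 1 f (df x)) -> f 0 = 0 ->
  (forall x, 0 <= x -> 0 <= df x) -> 0 <= u -> 0 <= f u.
Proof.
move=> fd f0 d0; rewrite le_eqVlt => /predU1P[<-|u0]; first by rewrite f0.
have cf : {within `[0, u], continuous f}.
  apply: derivable_within_continuous => x _; exact: ex_derive.
have [c + e] := MVT u0 (fun x _ => fd x) cf.
rewrite in_itv/= => /andP[c0 _]; move: e; rewrite f0 !subr0 => ->.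
by rewrite mulr_ge0 ?d0 ?ltW.
Qed.

Let sin_le u : 0 <= u -> sin u <= u.
Proof.
move=> u0; rewrite -subr_ge0.
apply: (@derive_ge0_ge0 (fun x => x - sin x) (fun x => 1 - cos x)).
- by rewrite sin0 subr0.
- by move=> x _; rewrite subr_ge0 cos_le1.
- exact: u0.
Qed.

Lemma cos_ge_quad u : 0 <= u -> 1 - u ^+ 2 / 2 <= cos u.
Proof.
move=> u0; rewrite -subr_ge0.
apply: (@derive_ge0_ge0 (fun x => cos x - (1 - x ^+ 2 / 2)) (fun x => x - sin x)).
- move=> x; apply: is_derive_eq; rewrite /GRing.scale/=; by field.
- by rewrite cos0 expr0n/= mul0r subr0 subrr.
- by move=> x x0; rewrite subr_ge0 sin_le.
- exact: u0.
Qed.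

Let sin_ge u : 0 <= u -> u - u ^+ 3 / 6 <= sin u.
Proof.
move=> u0; rewrite -subr_ge0.
apply: (@derive_ge0_ge0 (fun x => sin x - (x - x ^+ 3 / 6)) (fun x => cos x - (1 - x ^+ 2 / 2))).
- move=> x; apply: is_derive_eq; rewrite /GRing.scale/=; by field.
- by rewrite sin0 expr0n/= mul0r subr0 subrr.
- by move=> x x0; rewrite subr_ge0 cos_ge_quad.
- exact: u0.
Qed.

Let cos_le u : 0 <= u -> cos u <= 1 - u ^+ 2 / 2 + u ^+ 4 / 24.
Proof.
move=> u0; rewrite -subr_ge0.
apply: (@derive_ge0_ge0 (fun x => 1 - x ^+ 2 / 2 + x ^+ 4 / 24 - cos x)
   (fun x => sin x - (x - x ^+ 3 / 6))).
- move=> x; apply: is_derive_eq; rewrite /GRing.scale/=; by field.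
- by rewrite cos0 !expr0n/= !mul0r subr0 addr0 subrr.
- by move=> x x0; rewrite subr_ge0 sin_ge.
- exact: u0.
Qed.

Lemma cos_taylor4 u : `|cos u - (1 - u ^+ 2 / 2)| <= u ^+ 4 / 24.
Proof.
wlog u0 : u / 0 <= u.
  move=> H; have [|/ltW] := leP 0 u; first exact: H.
  by rewrite -oppr_ge0 => /H; rewrite cosN sqrrN (_ : (- u) ^+ 4 = u ^+ 4)//; ring.
rewrite ger0_norm ?subr_ge0 ?cos_ge_quad// lerBlDl; exact: cos_le.
Qed.

(** The fourth-order Taylor bound makes the cosine negative at 42/25, so half of [pi] is smaller. *)
Lemma pi_lt : (pi : R) < 84 / 25.
Proof.
suff : pi / 2 < (42 / 25 : R) by lra.
have c : cos (42 / 25 : R) < 0.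
  have := cos_taylor4 (42 / 25); rewrite ler_norml => /andP[_].
  set w := cos _; lra.
rewrite ltNge; apply/negP => h.
have : 0 <= cos (42 / 25 : R).
  by apply: cos_ge0_pihalf; apply/andP; split => //; have := @pi_gt0 R; lra.
by rewrite leNgt c.
Qed.

End trig_bounds.

(** * The characteristic function of the standard Gaussian *)

Section gaussian_cos.
Variable R : realType.
Local Notation gam := (gam R).
Implicit Types (x a : R).

Lemma bounded_growth (f : R -> R) : measurable_fun setT f -> (forall x, `|f x| <= 1) -> growth 1 f.
Proof.
by move=> mf f1; split => // x; rewrite mul1r; apply: le_trans (f1 x) (expR_sq8_ge1 x).
Qed.

Lemma measurable_cosM a : measurable_fun [set: R] (fun x => cos (a * x)).
Proof.
apply: measurableT_comp; last exact: measurable_funM.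
by apply: continuous_measurable_fun; exact: continuous_cos.
Qed.

Lemma measurable_sinM a : measurable_fun [set: R] (fun x => sin (a * x)).
Proof.
apply: measurableT_comp; last exact: measurable_funM.
by apply: continuous_measurable_fun; exact: continuous_sin.
Qed.

Lemma growth_cos a : growth 1 (fun x => cos (a * x)).
Proof. by apply: bounded_growth => [|x]; [exact: measurable_cosM|exact: cos_max]. Qed.

Lemma growth_sin a : growth 1 (fun x => sin (a * x)).
Proof. by apply: bounded_growth => [|x]; [exact: measurable_sinM|exact: sin_max]. Qed.

Let g a : R := \int[gam]_x cos (a * x).

Lemma Rintegral_gam_opp (f : R -> R) : measurable_fun setT f ->
  \int[gam]_x f (- x) = \int[gam]_x f x.
Proof.
move=> mf; have mE : measurable_fun [set: R] (EFin \o f) by apply/measurable_EFinP.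
rewrite /Rintegral integralE [in RHS]integralE; congr (fine (_ - _)).
- have H := @gam_opp R ((EFin \o f)^\+)%E (measurable_funepos mE) (fun x => funepos_ge0 _ x).
  by etransitivity; last (refine H); apply: eq_integral => x _; rewrite !funeposE.
- have H := @gam_opp R ((EFin \o f)^\-)%E (measurable_funeneg mE) (fun x => funeneg_ge0 _ x).
  by etransitivity; last (refine H); apply: eq_integral => x _; rewrite !funenegE.
Qed.

Lemma gam_odd (f : R -> R) : gam.-integrable setT (EFin \o f) -> (forall x, f (- x) = - f x) ->
  \int[gam]_x f x = 0.
Proof.
move=> fi fo.
have mf : measurable_fun setT f by apply/measurable_EFinP; exact: measurable_int fi.
have := Rintegral_gam_opp mf; under eq_Rintegral do rewrite fo -mulN1r.
by rewrite RintegralZl// => h; lra.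
Qed.

Lemma gam_fin (f : R -> R) : gam.-integrable setT (EFin \o f) ->
  (\int[gam]_x (f x)%:E = (\int[gam]_x f x)%:E)%E.
Proof. by move=> fi; rewrite /Rintegral fineK//; exact: (integrable_fin_num measurableT fi). Qed.

(** Stability of the Gaussian read on cosines: expand [cos (b * t + a * y)] and drop the sine terms,
    which are odd. The constant 1 is added because [gam_conv] is stated for nonnegative
    functions. *)
Let g_mul a b : g a * g b = g (Num.sqrt (a ^+ 2 + b ^+ 2)).
Proof.
have m1 : measurable_fun [set: R] (fun x : R => (1 + cos x)%:E).
  apply/measurable_EFinP; apply: measurable_funD => //.
  by apply: continuous_measurable_fun; exact: continuous_cos.
have p1 x : (0 <= (1 + cos x)%:E)%E.
  by rewrite lee_fin; have := cos_geN1 x; lra.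
have := gam_conv b a m1 p1.
have ic c : gam.-integrable setT (EFin \o (fun x => cos (c * x))).
  exact: growth_integrable (growth_cos c).
have is_ c : gam.-integrable setT (EFin \o (fun x => sin (c * x))).
  exact: growth_integrable (growth_sin c).
have i1 : gam.-integrable setT (EFin \o cst (1 : R)).
  exact: finite_measure_integrable_cst.
have gs c : \int[gam]_x sin (c * x) = 0.
  by apply: gam_odd => // x; rewrite mulrN sinN.
have Ic c k : (\int[gam]_y (1 + k * cos (c * y))%:E = (1 + k * g c)%:E)%E.
  rewrite (gam_fin (f := fun y => 1 + k * cos (c * y))); last first.
    by apply: integrableD_EFin => //; exact: integrableZ_EFin.
  rewrite RintegralD//; last by exact: integrableZ_EFin.
  by rewrite Rintegral_gam_cst RintegralZl.
have -> : (\int[gam]_t \int[gam]_y (1 + cos (b * t + a * y))%:E =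
   \int[gam]_t (1 + g a * cos (b * t))%:E)%E.
  apply: eq_integral => t _.
  have i2 : gam.-integrable setT (EFin \o (fun y => 1 + cos (b * t) * cos (a * y))).
    by apply: integrableD_EFin => //; exact: integrableZ_EFin.
  transitivity (\int[gam]_y ((1 + cos (b * t) * cos (a * y)) - sin (b * t) * sin (a * y))%:E)%E.
    by apply: eq_integral => y _; rewrite cosD addrA.
  rewrite (gam_fin (f := fun y => 1 + cos (b * t) * cos (a * y) - sin (b * t) * sin (a * y)));
    last by apply: integrableB_EFin => //; exact: integrableZ_EFin.
  rewrite RintegralB//; last exact: integrableZ_EFin.
  rewrite RintegralZl// gs mulr0 subr0 -(gam_fin i2) Ic.
  by rewrite (mulrC (g a)).
rewrite Ic.
under [X in _ = X -> _]eq_integral do rewrite -[cos _]mul1r.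
by rewrite Ic mul1r => -[/addrI].
Qed.

Let g_sqrtn n (s : R) : 0 <= s -> g (Num.sqrt s) ^+ n = g (Num.sqrt (n%:R * s)).
Proof.
move=> s0; elim: n => [|n IH].
  rewrite expr0 mul0r sqrtr0 /g; under eq_Rintegral do rewrite mul0r cos0.
  by rewrite Rintegral_gam_cst.
rewrite exprS IH g_mul !sqr_sqrtr// ?mulr_ge0// -natr1.
by congr (g (Num.sqrt _)); ring.
Qed.

(** Both sides equal [1 - a ^+ 2 / 2] up to fourth order, the left one through the second and fourth
    Gaussian moments. *)
Let g_near0 a : `|g a - expR (- (a ^+ 2 / 2))| <= 200 * a ^+ 4.
Proof.
have g4 : growth 128 (fun x : R => x ^+ 4).
  split; first exact: measurable_funX.
  move=> x; rewrite ger0_norm ?exprn_even_ge0//.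
  have := @expR_ge1Dxn R (x ^+ 2 / 8) 1.
  have x2 : 0 <= x ^+ 2 / 8 by rewrite divr_ge0 ?sqr_ge0.
  move=> /(_ x2); rewrite (_ : 2`!%:R = 2 :> R)// => h.
  have -> : x ^+ 4 = (x ^+ 2) ^+ 2 by ring.
  lra.
have i4 := growth_integrable g4.
have i2 := growth_integrable (growth_sq R).
have ic := growth_integrable (growth_cos a).
have i1 : gam.-integrable setT (EFin \o cst (1 : R)).
  exact: finite_measure_integrable_cst.
have iq : gam.-integrable setT (EFin \o (fun x : R => 1 - a ^+ 2 / 2 * x ^+ 2)).
  by apply: integrableB_EFin => //; exact: integrableZ_EFin.
have h1 : `|g a - (1 - a ^+ 2 / 2)| <= 11 * a ^+ 4.
  have -> : g a - (1 - a ^+ 2 / 2) = \int[gam]_x (cos (a * x) - (1 - a ^+ 2 / 2 * x ^+ 2)).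
    rewrite RintegralB// RintegralB//; last exact: integrableZ_EFin.
    by rewrite Rintegral_gam_cst RintegralZl// gam_sq mulr1.
  have id : gam.-integrable setT (EFin \o (fun x : R => cos (a * x) - (1 - a ^+ 2 / 2 * x ^+ 2))).
    exact: integrableB_EFin.
  apply: (le_trans (le_normr_Rintegral _ id)) => //.
  apply: (@le_trans _ _ (\int[gam]_x (a ^+ 4 / 24 * x ^+ 4))).
    apply: le_Rintegral => //; first exact: integrable_norm id.
      exact: integrableZ_EFin.
    move=> x _; have := cos_taylor4 (a * x); rewrite !exprMn.
    by rewrite mulrAC (mulrAC (a ^+ 4)).
  rewrite RintegralZl//; have := growth_mean g4; rewrite ler_norml => /andP[_ h].
  have a4 : 0 <= a ^+ 4 by rewrite exprn_even_ge0.
  set I := Rintegral _ _ _ in h *.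
  have : a ^+ 4 * I <= a ^+ 4 * 256 by apply: ler_wpM2l => //; lra.
  lra.
have a2 : 0 <= a ^+ 2 / 2 by rewrite divr_ge0 ?sqr_ge0.
have h2 : `|expR (- (a ^+ 2 / 2)) - (1 - a ^+ 2 / 2)| <= a ^+ 4.
  have l := expR_ge1Dx (- (a ^+ 2 / 2)).
  rewrite ger0_norm; last lra.
  have u := expR_ge1Dx (a ^+ 2 / 2).
  have e : expR (- (a ^+ 2 / 2)) * expR (a ^+ 2 / 2) = 1 by rewrite -expRD addNr expR0.
  have p := expR_gt0 (- (a ^+ 2 / 2)).
  have -> : a ^+ 4 = 4 * (a ^+ 2 / 2) ^+ 2 by field.
  set y := a ^+ 2 / 2 in a2 l u e p *; set E := expR (- y) in l e p *.
  have : E * (1 + y) <= E * expR y by rewrite ler_pM2l.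
  rewrite e => h3.
  nra.
have a4 : 0 <= a ^+ 4 by rewrite exprn_even_ge0.
have -> : g a - expR (- (a ^+ 2 / 2)) =
  (g a - (1 - a ^+ 2 / 2)) - (expR (- (a ^+ 2 / 2)) - (1 - a ^+ 2 / 2)) by ring.
apply: le_trans (ler_normB _ _) _; lra.
Qed.

Let pow_diff n (A B : R) : `|A| <= 1 -> `|B| <= 1 -> `|A ^+ n - B ^+ n| <= n%:R * `|A - B|.
Proof.
move=> A1 B1; elim: n => [|n IH]; first by rewrite subrr normr0 mul0r.
have -> : A ^+ n.+1 - B ^+ n.+1 = A * (A ^+ n - B ^+ n) + (A - B) * B ^+ n.
  by rewrite !exprS; ring.
apply: le_trans (ler_normD _ _) _; rewrite !normrM -natr1 mulrDl mul1r; apply: lerD.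
  by apply: le_trans IH; rewrite ler_piMl.
by rewrite ler_piMr// normrX exprn_ile1.
Qed.

(** A central limit argument in place of a differential equation: [g a] is the [n]-th power of
    [g (a / sqrt n)], and replacing each factor by its Gaussian value costs at most [n] times a
    multiple of [(a / sqrt n) ^+ 4], which tends to 0. *)
Lemma gam_cos a : \int[gam]_x cos (a * x) = expR (- (a ^+ 2 / 2)).
Proof.
apply/eqP; rewrite -subr_eq0 -normr_eq0 eq_le normr_ge0 andbT -/(g a).
apply/ler_addgt0Pr => e e0; rewrite add0r.
pose C := 200 * a ^+ 4.
have C0 : 0 <= C by rewrite mulr_ge0 ?exprn_even_ge0.
pose n := (Num.truncn (C / e)).+1.
have nC : C / e < n%:R by exact: truncnS_gt.
have n0 : 0 < n%:R :> R by rewrite ltr0n.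
pose h := Num.sqrt (a ^+ 2 / n%:R).
have h2 : h ^+ 2 = a ^+ 2 / n%:R by rewrite sqr_sqrtr// divr_ge0 ?sqr_ge0.
have -> : g a = g h ^+ n.
  rewrite /h g_sqrtn ?divr_ge0 ?sqr_ge0// mulrCA divff ?gt_eqF// mulr1 sqrtr_sqr.
  have [//|a0] := ger0P a; rewrite /g; apply: eq_Rintegral => x _.
  by rewrite mulNr cosN.
have -> : expR (- (a ^+ 2 / 2)) = expR (- (h ^+ 2 / 2)) ^+ n.
  by rewrite -expRM_natl h2; congr expR; field; rewrite gt_eqF.
have g1 : `|g h| <= 1.
  have ic := growth_integrable (growth_cos h).
  apply: (le_trans (le_normr_Rintegral _ ic)) => //.
  rewrite -[leRHS]Rintegral_gam_cst; apply: le_Rintegral => //.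
  - exact: integrable_norm ic.
  - exact: finite_measure_integrable_cst.
  - by move=> x _; exact: cos_max.
have e1 : `|expR (- (h ^+ 2 / 2))| <= 1.
  rewrite ger0_norm ?expR_ge0// -[leRHS]expR0 ler_expR oppr_le0 divr_ge0 ?sqr_ge0//.
apply: le_trans (pow_diff n g1 e1) _.
apply: le_trans (ler_wpM2l (ltW n0) (g_near0 h)) _.
have -> : n%:R * (200 * h ^+ 4) = C / n%:R.
  have -> : h ^+ 4 = (h ^+ 2) ^+ 2 by ring.
  by rewrite h2 /C; field; rewrite gt_eqF.
by rewrite ler_pdivrMr// mulrC -ler_pdivrMr// ltW.
Qed.

End gaussian_cos.

(** * Distance of the Mehler kernel from 1 for small correlation *)

Section kernel_bounds.
Variable R : realType.
Implicit Types (r x v u w : R).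

(* Density of [N(r x, w^2)] with respect to [N(0, 1)]. *)
Definition mehler r w x v : R := w^-1 * expR (v ^+ 2 / 2 - (v - r * x) ^+ 2 / (2 * w ^+ 2)).

Lemma mehler_ge0 r w x v : 0 <= w -> 0 <= mehler r w x v.
Proof. by move=> w0; rewrite mulr_ge0 ?expR_ge0// invr_ge0. Qed.

Lemma expR_ge_sq u : 0 <= u -> u ^+ 2 / 2 <= expR u.
Proof.
move=> u0; have := @expR_ge1Dxn R u 1 u0; rewrite (_ : 2`!%:R = 2 :> R)//; lra.
Qed.

Lemma expR_ge_id u : u <= expR u.
Proof. by have := expR_ge1Dx u; lra. Qed.

Lemma expRDN_ge2 u : 2 <= expR u + expR (- u).
Proof.
have e : expR u * expR (- u) = 1 by rewrite -expRD subrr expR0.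
have := expR_gt0 u; have := expR_gt0 (- u); set a := expR u in e *; set b := expR _ in e *.
move=> b0 a0; rewrite -subr_ge0.
have -> : a + b - 2 = (a - 1) ^+ 2 * b.
  by transitivity (a * (a * b) - 2 * (a * b) + b); [rewrite e; ring|ring].
by rewrite mulr_ge0 ?sqr_ge0// ltW.
Qed.

Lemma expR_abs_bound u : expR u <= 1 + `|u| * expR `|u|.
Proof.
apply: (@le_trans _ _ (expR `|u|)); first by rewrite ler_expR ler_norm.
set y := `|u|; have y0 : 0 <= y by exact: normr_ge0.
have := expR_ge1Dx (- y); have e : expR y * expR (- y) = 1 by rewrite -expRD subrr expR0.
have := expR_gt0 y; set a := expR y in e *; set b := expR _ in e *.
move=> a0 hb; have : a * (1 - y) <= a * b by rewrite ler_pM2l.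
rewrite e; nra.
Qed.

(** The left side is the square of [expR (u / 2) - expR (- (u / 2))], so a first-order bound on that
    difference suffices. *)
Lemma cosh_bound u : expR u + expR (- u) - 2 <= u ^+ 2 * expR `|u|.
Proof.
wlog u0 : u / 0 <= u.
  move=> H; have [|/ltW] := leP 0 u; first exact: H.
  by rewrite -oppr_ge0 => /H; rewrite opprK sqrrN normrN (addrC (expR (- u))).
rewrite ger0_norm//.
pose y := u / 2; have uE : u = y + y by rewrite /y; field.
have y0 : 0 <= y by rewrite divr_ge0.
have e : expR y * expR (- y) = 1 by rewrite -expRD subrr expR0.
have hb := expR_ge1Dx (- (y + y)).
have e2 : expR u = expR y ^+ 2 by rewrite uE expRD expr2.
have e3 : expR (- u) = expR (- y) ^+ 2 by rewrite uE opprD expRD expr2.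
have a0 := expR_gt0 y; have b0 := expR_gt0 (- y).
rewrite e2 e3 {1}uE; rewrite opprD expRD in hb.
set a := expR y in e a0 *; set b := expR (- y) in e b0 hb *.
have h1 : a - b <= 2 * y * a.
  have : a * (1 - 2 * y) <= a * (b * b) by rewrite ler_pM2l//; lra.
  by rewrite mulrA e; lra.
have h2 : 0 <= a - b.
  by rewrite subr_ge0 ler_expR; lra.
have -> : a ^+ 2 + b ^+ 2 - 2 = (a - b) ^+ 2.
  by transitivity (a ^+ 2 + b ^+ 2 - 2 * (a * b)); [rewrite e mulr1|ring].
have -> : (y + y) ^+ 2 * a ^+ 2 = (2 * y * a) ^+ 2 by ring.
by rewrite ler_sqr ?nnegrE// !mulr_ge0// ltW.
Qed.

Section small_corr.
Variables (r w : R).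
Hypotheses (r4 : `|r| <= 1 / 4) (w0 : 0 <= w) (rw : r ^+ 2 + w ^+ 2 = 1).

Let k := (w ^+ 2)^-1.
Let r2 : r ^+ 2 <= 1 / 16.
Proof.
have -> : 1 / 16 = (1 / 4) ^+ 2 :> R by field.
by rewrite -real_normK ?num_real// ler_sqr ?nnegrE//; lra.
Qed.
Let wgt0 : 0 < w.
Proof.
rewrite lt_neqAle w0 andbT; apply/eqP => h; move: rw r2.
by rewrite -h expr0n/= addr0 => ->; lra.
Qed.
Let w2 : 15 / 16 <= w ^+ 2. Proof. by move: rw r2; lra. Qed.
Let kE : k = 1 + r ^+ 2 * k.
Proof.
have wn : w ^+ 2 != 0 by rewrite sqrf_eq0 gt_eqF.
by rewrite /k -{1}(divff wn) -mulrDl addrC rw mul1r.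
Qed.
Let k_ge1 : 1 <= k.
Proof. by rewrite kE lerDl mulr_ge0 ?sqr_ge0// invr_ge0 sqr_ge0. Qed.
Let k_le : k <= 16 / 15.
Proof. by rewrite /k -div1r ler_pdivrMr ?exprn_gt0//; move: w2; lra. Qed.
Let wV_ge1 : 1 <= w^-1.
Proof.
rewrite -(@ler_sqr R) ?nnegrE ?invr_ge0// expr1n exprVn; exact: k_ge1.
Qed.
Let wV_le : w^-1 <= 1 + r ^+ 2.
Proof.
have r0 := sqr_ge0 r.
rewrite -(@ler_sqr R) ?nnegrE ?invr_ge0//; last by lra.
rewrite exprVn -/k kE; move: k_le; nra.
Qed.

(** The exponent of the kernel is [U - A]: [U] is of order [r] and odd in [v], [A] is nonnegative,
    even in [v] and of order [r ^+ 2]. Everything of first order in [r] is in [U]. *)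
Let U x v := r * k * x * v.
Let A x v := r ^+ 2 * k * (x ^+ 2 + v ^+ 2) / 2.

Let mehlerE x v : mehler r w x v = w^-1 * expR (U x v - A x v).
Proof.
rewrite /mehler; congr (_ * expR _).
have -> : v ^+ 2 / 2 = (1 - r ^+ 2) / w ^+ 2 * v ^+ 2 / 2.
  have -> : 1 - r ^+ 2 = w ^+ 2 by rewrite -rw; ring.
  by rewrite divff ?mul1r// sqrf_eq0 gt_eqF.
by rewrite /U /A /k; field; rewrite gt_eqF.
Qed.

Let S x v := x ^+ 2 + v ^+ 2.
Let S0 x v : 0 <= S x v. Proof. by rewrite addr_ge0 ?sqr_ge0. Qed.

Let xv_le x v : `|x * v| <= S x v / 2.
Proof.
rewrite ler_norml /S; apply/andP; split.
  by have := sqr_ge0 (x + v); rewrite sqrrD; lra.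
by have := sqr_ge0 (x - v); rewrite sqrrB; lra.
Qed.

Let absU x v : `|U x v| <= `|r| * (8 / 15) * S x v.
Proof.
rewrite /U -!mulrA normrM; apply: ler_wpM2l => //.
rewrite normrM ger0_norm; last by apply: le_trans k_ge1.
have := xv_le x v; have := normr_ge0 (x * v); set n := `|_|; set s := S x v => n0 ns.
move: k_le k_ge1; nra.
Qed.

Let absU2 x v : `|U x v| <= 2 / 15 * S x v.
Proof.
apply: le_trans (absU x v) _; apply: ler_wpM2r => //; move: r4; lra.
Qed.

Let A_ge0 x v : 0 <= A x v.
Proof.
apply: divr_ge0 => //; apply: mulr_ge0; last by rewrite addr_ge0 ?sqr_ge0.
by apply: mulr_ge0; [exact: sqr_ge0|apply: le_trans k_ge1].
Qed.

Let A_le x v : A x v <= r ^+ 2 * S x v.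
Proof.
have -> : A x v = r ^+ 2 * (k * S x v / 2) by rewrite /A /S; field.
apply: ler_wpM2l; first exact: sqr_ge0.
have := S0 x v; set s := S x v; move: k_le => h s0; nra.
Qed.

Let expS x v := expR (x ^+ 2 / 4) * expR (v ^+ 2 / 4).
Let expSE x v : expS x v = expR (S x v / 4).
Proof. by rewrite /expS -expRD; congr expR; rewrite /S; lra. Qed.

(** Averaging over the sign of [v] turns [expR U] into [expR U + expR (- U)], which exceeds 2 only
    by [O(U ^+ 2)]; the remaining factors [w^-1] and [expR (- A)] are 1 up to [O(r ^+ 2)]. *)
Lemma mehler_even_bound x v :
  `|mehler r w x v + mehler r w x (- v) - 2| <= 100 * r ^+ 2 * (expR (x ^+ 2 / 4) * expR (v ^+ 2 / 4)).
Proof.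
rewrite -/(expS x v) expSE !mehlerE.
have -> : U x (- v) = - U x v by rewrite /U mulrN.
have -> : A x (- v) = A x v by rewrite /A sqrrN.
rewrite -mulrDr !expRD -mulrDl.
have r0 := sqr_ge0 r; have s0 := S0 x v.
have eA0 := expR_gt0 (- A x v).
have eA1 : expR (- A x v) <= 1 by rewrite -[leRHS]expR0 ler_expR oppr_le0.
have eA2 := expR_ge1Dx (- A x v).
have c2 := expRDN_ge2 (U x v).
have cb := cosh_bound (U x v).
have Al := A_le x v.
have i1 := expR_ge_id (S x v / 4).
have i3 : 1 <= expR (S x v / 4) by rewrite -[leLHS]expR0 ler_expR divr_ge0.
have U2 : U x v ^+ 2 * expR `|U x v| <= r ^+ 2 * 45 * expR (S x v / 4).
  have h1 : expR `|U x v| <= expR (2 / 15 * S x v) by rewrite ler_expR.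
  have h2 : U x v ^+ 2 <= r ^+ 2 * (8 / 15) ^+ 2 * S x v ^+ 2.
    rewrite -real_normK ?num_real//.
    have -> : r ^+ 2 * (8 / 15) ^+ 2 * S x v ^+ 2 = (`|r| * (8 / 15) * S x v) ^+ 2.
      by rewrite !exprMn real_normK ?num_real.
    by rewrite ler_sqr ?nnegrE ?mulr_ge0//; lra.
  (* The budget [S / 4] is split as 2/15 + 7/60: the first share absorbs the exponential of [|U|],
     the second the polynomial factor [S ^+ 2]. *)
  have y0 : 0 <= 7 / 60 * S x v by rewrite mulr_ge0//; lra.
  have h3 := expR_ge_sq y0.
  have -> : expR (S x v / 4) = expR (7 / 60 * S x v) * expR (2 / 15 * S x v).
    by rewrite -expRD; congr expR; field.
  apply: le_trans (ler_pM _ _ h2 h1) _; rewrite ?sqr_ge0 ?expR_ge0//.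
  rewrite mulrA; apply: ler_wpM2r; first exact: expR_ge0.
  have -> : r ^+ 2 * (8 / 15) ^+ 2 * S x v ^+ 2 = r ^+ 2 * (64 / 225 * S x v ^+ 2) by field.
  rewrite -[r ^+ 2 * 45 * _]mulrA; apply: ler_wpM2l => //.
  move: h3; have -> : (7 / 60 * S x v) ^+ 2 / 2 = 49 / 7200 * S x v ^+ 2 by field.
  have := expR_gt0 (7 / 60 * S x v); set e := expR _; set s := S x v ^+ 2 => e0 h3; lra.
set E := expR (S x v / 4) in i1 i3 U2 *; set C := _ + expR (- U x v) in c2 cb *.
set e := expR (- A x v) in eA0 eA1 eA2 *.
have WV := wV_ge1; have WVl := wV_le.
set W := w^-1 in WV WVl *.
have WC : W * (C * e) <= (1 + r ^+ 2) * C.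
  have C0 : 0 <= C by lra.
  have W0 : 0 <= W by lra.
  apply: ler_pM => //; first by rewrite mulr_ge0// ltW.
  by rewrite ler_piMr.
have WC2 : 2 * e <= W * (C * e).
  rewrite mulrA; apply: ler_wpM2r; first exact: ltW.
  have C0 : 0 <= C by lra.
  by apply: le_trans c2 _; rewrite ler_peMl.
have rE : 0 <= r ^+ 2 * E by rewrite mulr_ge0//; lra.
have rS : r ^+ 2 * (S x v / 4) <= r ^+ 2 * E by apply: ler_wpM2l.
have r1E : r ^+ 2 <= r ^+ 2 * E by rewrite ler_peMr.
rewrite ler_norml; apply/andP; split; first by lra.
have : r ^+ 2 * (C - 2) <= 1 / 16 * (r ^+ 2 * 45 * E).
  by apply: ler_pM => //; lra.
lra.
Qed.

(** Same decomposition without symmetrisation: the linear term of [U] survives, hence [|r|] instead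
    of its square. *)
Lemma mehler_bound x v :
  `|mehler r w x v - 1| <= 100 * `|r| * (expR (x ^+ 2 / 4) * expR (v ^+ 2 / 4)).
Proof.
rewrite -/(expS x v) expSE !mehlerE expRD.
have r0 := normr_ge0 r; have s0 := S0 x v.
have r2r : r ^+ 2 <= `|r|.
  by rewrite -real_normK ?num_real// expr2 ler_piMr//; move: r4; lra.
have eA0 := expR_gt0 (- A x v).
have eA1 : expR (- A x v) <= 1 by rewrite -[leRHS]expR0 ler_expR oppr_le0.
have eUA := expR_ge1Dx (U x v - A x v).
rewrite expRD in eUA.
have eU := expR_abs_bound (U x v).
have Al := A_le x v; have Ul := absU x v.
have i1 := expR_ge_id (S x v / 4).
have i3 : 1 <= expR (S x v / 4) by rewrite -[leLHS]expR0 ler_expR divr_ge0.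
have Ulo : - `|U x v| <= U x v by rewrite lerNl -normrN ler_norm.
have h1 : expR `|U x v| <= expR (2 / 15 * S x v) by rewrite ler_expR.
have UE : `|U x v| * expR `|U x v| <= `|r| * 5 * expR (S x v / 4).
  have h3 := expR_ge_id (7 / 60 * S x v).
  have -> : expR (S x v / 4) = expR (7 / 60 * S x v) * expR (2 / 15 * S x v).
    by rewrite -expRD; congr expR; field.
  apply: le_trans (ler_pM _ _ Ul h1) _; rewrite ?expR_ge0//.
  rewrite [leRHS]mulrA; apply: ler_wpM2r; first exact: expR_ge0.
  rewrite -[`|r| * (8 / 15) * _]mulrA -[`|r| * 5 * _]mulrA; apply: ler_wpM2l => //.
  move: h3; have := expR_gt0 (7 / 60 * S x v); set e := expR _; set s := S x v => e0 h3; lra.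
set E := expR (S x v / 4) in i1 i3 UE *; set F := expR (U x v) in eU eUA *.
have F0 : 0 < F by exact: expR_gt0.
set e := expR (- A x v) in eA0 eA1 eUA *.
have WV := wV_ge1; have WVl := wV_le.
set W := w^-1 in WV WVl *.
have r20 := sqr_ge0 r.
have WC : W * (F * e) <= (1 + r ^+ 2) * F.
  have W0 : 0 <= W by lra.
  apply: ler_pM => //; first by rewrite mulr_ge0// ltW.
  by rewrite ler_piMr// ltW.
have WC2 : F * e <= W * (F * e) by rewrite ler_peMl// mulr_ge0// ltW.
have rE : `|r| <= `|r| * E by rewrite ler_peMr.
have rS : `|r| * (S x v / 4) <= `|r| * E by apply: ler_wpM2l.
have r2S : r ^+ 2 * S x v <= `|r| * S x v by apply: ler_wpM2r.
rewrite ler_norml; apply/andP; split; first by lra.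
have : r ^+ 2 * F <= `|r| * F by apply: ler_wpM2r; [exact: ltW|].
have : `|r| * F <= `|r| * (1 + `|r| * 5 * E) by apply: ler_wpM2l => //; lra.
have : `|r| * (`|r| * 5 * E) <= 1 / 4 * (`|r| * 5 * E).
  by apply: ler_wpM2r => //; rewrite !mulr_ge0// ltW// expR_gt0.
lra.
Qed.

End small_corr.
End kernel_bounds.

(** * Integrals against two independent standard Gaussians *)

Section gam2.
Variable R : realType.
Local Notation mu := (@lebesgue_measure R).
Local Notation gam := (gam R).
Local Notation gam2 := (gam \x gam)%E.
Implicit Types (x v : R).

Let mD : measurable_fun [set: R * R]
  (fun z : R * R => expR (3 / 8 * z.1 ^+ 2) * expR (3 / 8 * z.2 ^+ 2)).
Proof.
apply: measurable_funM.
- exact: (measurableT_comp (measurable_expR_sq _) (@measurable_fst _ _ R R)).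
- exact: (measurableT_comp (measurable_expR_sq _) (@measurable_snd _ _ R R)).
Qed.

Let intD : (\int[gam2]_z (expR (3 / 8 * z.1 ^+ 2) * expR (3 / 8 * z.2 ^+ 2))%:E = 4%:E)%E.
Proof.
have mE : measurable_fun [set: R * R]
    (fun z : R * R => (expR (3 / 8 * z.1 ^+ 2) * expR (3 / 8 * z.2 ^+ 2))%:E).
  exact/measurable_EFinP.
have D0 (z : R * R) : (0 <= (expR (3 / 8 * z.1 ^+ 2) * expR (3 / 8 * z.2 ^+ 2))%:E)%E.
  by rewrite lee_fin mulr_ge0 ?expR_ge0.
have me k : measurable_fun [set: R] (fun x => (expR (k * x ^+ 2))%:E).
  by apply/measurable_EFinP; exact: measurable_expR_sq.
rewrite (fubini_tonelli1 (m1 := gam) (m2 := gam) _ mE D0).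
transitivity (\int[gam]_x ((expR (3 / 8 * x ^+ 2))%:E * 2%:E))%E.
  apply: eq_integral => x _; rewrite /fubini_F/=.
  under eq_integral do rewrite EFinM.
  rewrite ge0_integralZl ?gam_expR38//; first exact: me.
rewrite ge0_integralZr//; last exact: me.
by rewrite gam_expR38 -EFinM; congr EFin; lra.
Qed.

Lemma le_gam2_integral (f : R * R -> R) (B : R) : measurable_fun setT f ->
  (forall z, `|f z| <= B * (expR (3 / 8 * z.1 ^+ 2) * expR (3 / 8 * z.2 ^+ 2))) ->
  gam2.-integrable setT (EFin \o f) /\ `|\int[gam2]_z f z| <= 4 * B.
Proof.
move=> mf fB.
have B0 : 0 <= B.
  have := fB (0, 0); rewrite expr0n/= mulr0 expR0 !mulr1; exact: le_trans (normr_ge0 _).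
have mE : measurable_fun [set: R * R]
    (fun z : R * R => (B * (expR (3 / 8 * z.1 ^+ 2) * expR (3 / 8 * z.2 ^+ 2)))%:E).
  by apply/measurable_EFinP/measurable_funM.
have IE : (\int[gam2]_z (B * (expR (3 / 8 * z.1 ^+ 2) * expR (3 / 8 * z.2 ^+ 2)))%:E = (4 * B)%:E)%E.
  under eq_integral do rewrite EFinM.
  rewrite ge0_integralZl//; first last.
  - exact/measurable_EFinP.
  by rewrite intD -EFinM mulrC.
have le : (\int[gam2]_z `|(f z)%:E| <= (4 * B)%:E)%E.
  rewrite -IE; apply: ge0_le_integral => //.
  - by apply: measurableT_comp => //; apply/measurable_EFinP.
  - by move=> x _; rewrite lee_fin.
have intf : gam2.-integrable setT (EFin \o f).
  by apply/integrableP; split; [apply/measurable_EFinP|exact: le_lt_trans le (ltry _)].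
split => //; apply: (le_trans (le_normr_Rintegral _ intf)) => //.
rewrite /Rintegral -[leRHS]/(fine (4 * B)%:E) fine_le//.
rewrite ge0_fin_numE//; first exact: le_lt_trans le (ltry _).
by apply: integral_ge0 => x _.
Qed.

Lemma gam2_prod0 (f : R -> R) B : growth B f -> \int[gam]_x f x = 0 ->
  gam2.-integrable setT (EFin \o (fun z : R * R => f z.1 * f z.2)) /\
  \int[gam2]_z (f z.1 * f z.2) = 0.
Proof.
move=> gf f0; have B0 := growth_ge0 gf.
have mg : measurable_fun [set: R * R] (fun z : R * R => f z.1 * f z.2).
  apply: measurable_funM.
  - exact: (measurableT_comp gf.1 (@measurable_fst _ _ R R)).
  - exact: (measurableT_comp gf.1 (@measurable_snd _ _ R R)).
have gb (z : R * R) : `|f z.1 * f z.2| <= B ^+ 2 * (expR (3 / 8 * z.1 ^+ 2) * expR (3 / 8 * z.2 ^+ 2)).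
  rewrite normrM expr2 mulrACA; apply: ler_pM => //; exact: growth_le38.
have [ig _] := le_gam2_integral mg gb; split => //.
rewrite /Rintegral.
have <- := integral12_prod_meas1 (m1 := gam) (m2 := gam) ig.
rewrite integral0_eq// => x _; rewrite /fubini_F /=.
have fi := growth_integrable gf.
under eq_integral do rewrite EFinM.
rewrite (integralZl measurableT fi).
by rewrite (gam_fin fi) f0 mule0.
Qed.

(** Lets an even function be integrated against the kernel symmetrised in its second variable. *)
Lemma gam2_oppr (g : R * R -> R) : measurable_fun setT g ->
  (\int[gam2]_z (g (z.1, - z.2))%:E = \int[gam2]_z (g z)%:E)%E.
Proof.
move=> mg.
have mo : measurable_fun [set: R * R] (fun z : R * R => (z.1, - z.2)).
  apply: measurable_fun_pair; first exact: measurable_fst.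
  exact: (measurableT_comp (@oppr_measurable R setT) (@measurable_snd _ _ R R)).
have key (h : R * R -> \bar R) : measurable_fun setT h -> (forall z, 0 <= h z)%E ->
    (\int[gam2]_z h (z.1, - z.2)%R = \int[gam2]_z h z)%E.
  move=> mh h0.
  have mh' : measurable_fun [set: R * R] (fun z : R * R => h (z.1, - z.2)).
    exact: (measurableT_comp mh mo).
  rewrite (fubini_tonelli1 (m1 := gam) (m2 := gam) _ mh' (fun z => h0 _)).
  rewrite (fubini_tonelli1 (m1 := gam) (m2 := gam) _ mh h0).
  apply: eq_integral => x _; rewrite /fubini_F/=.
  exact: (gam_opp (measurable_sectionl x mh) (fun v => h0 _)).
have mE : measurable_fun [set: R * R] (EFin \o g) by apply/measurable_EFinP.
rewrite integralE [in RHS]integralE; congr (_ - _)%E.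
- have H := key ((EFin \o g)^\+)%E (measurable_funepos mE) (fun z => funepos_ge0 _ z).
  by etransitivity; last (refine H); apply: eq_integral => z _; rewrite !funeposE.
- have H := key ((EFin \o g)^\-)%E (measurable_funeneg mE) (fun z => funeneg_ge0 _ z).
  by etransitivity; last (refine H); apply: eq_integral => z _; rewrite !funenegE.
Qed.

End gam2.

(** * Density of a correlated Gaussian pair with respect to an independent one *)

Section covariance.
Variable R : realType.
Local Notation mu := (@lebesgue_measure R).
Local Notation gam := (gam R).
Local Notation gam2 := (gam \x gam)%E.
Variables (d : measure_display) (T : measurableType d) (P : probability T R).
Variables (X Y : T -> R) (r w : R).
Hypotheses (mX : measurable_fun setT X) (mY : measurable_fun setT Y).
Hypotheses (w0 : 0 <= w) (rw : r ^+ 2 + w ^+ 2 = 1).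
Hypothesis law : forall H : R * R -> \bar R, measurable_fun [set: R * R] H ->
  (forall u, 0 <= H u)%E -> (\int[P]_t H (X t, Y t) = pair_law 1 r w H)%E.

Lemma law1 (h : R -> \bar R) : measurable_fun setT h -> (forall x, 0 <= h x)%E ->
  (\int[P]_t h (X t) = \int[gam]_x h x)%E.
Proof.
move=> mh h0.
have := @law (fun z => h z.1) (measurableT_comp mh (@measurable_fst _ _ R R)) (fun z => h0 _).
move=> /= ->; rewrite /pair_law; apply: eq_integral => x _ /=.
by rewrite gam_cst mul1r.
Qed.

Lemma law2 (h : R -> \bar R) : measurable_fun setT h -> (forall x, 0 <= h x)%E ->
  (\int[P]_t h (Y t) = \int[gam]_x h x)%E.
Proof.
move=> mh h0.
have := @law (fun z => h z.2) (measurableT_comp mh (@measurable_snd _ _ R R)) (fun z => h0 _).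
move=> /= ->; rewrite /pair_law/= gam_conv// addrC rw sqrtr1.
by apply: eq_integral => x _; rewrite mul1r.
Qed.

Hypothesis wgt0 : 0 < w.

(** The substitution [v = r * x + w * y]; it divides by [w], so it is restricted to nondegenerate
    pairs. *)
Let kernel (h : R -> \bar R) x : measurable_fun setT h -> (forall v, 0 <= h v)%E ->
  (\int[gam]_y h (r * x + w * y)%R = \int[gam]_v (h v * (mehler r w x v)%:E))%E.
Proof.
move=> mh h0.
have mm : measurable_fun [set: R] (mehler r w x).
  apply: measurable_funM => //; apply: measurableT_comp => //.
  apply: measurable_funB; apply: measurable_funM => //; apply: measurable_funX => //.
  exact: measurable_funB.
have mhc : measurable_fun [set: R] (fun y => h (r * x + w * y)).
  by apply: measurableT_comp => //; apply: measurable_funD => //; exact: measurable_funM.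
rewrite ge0_integral_gam// [RHS]ge0_integral_gam; first last.
- by move=> v; rewrite mule_ge0// lee_fin mehler_ge0.
- by apply: emeasurable_funM => //; apply/measurable_EFinP.
pose g v := ((phi ((v - r * x) / w))%:E * h v)%E.
have mg : measurable_fun [set: R] g.
  apply: emeasurable_funM => //; apply/measurable_EFinP.
  apply: measurableT_comp; first exact: measurable_phi.
  by apply: measurable_funM => //; exact: measurable_funB.
have g0 v : (0 <= g v)%E by rewrite mule_ge0// lee_fin phi_ge0.
transitivity (\int[mu]_y g (w * y + r * x)%R)%E.
  apply: eq_integral => y _; rewrite /g addrK mulrAC divff ?mul1r ?gt_eqF//.
  by rewrite addrC.
rewrite (ge0_integral_affine _ _ mg g0) ?gt_eqF// -ge0_integralZl//.
apply: eq_integral => v _; rewrite /g muleA (muleC (h v)) muleA -!EFinM; congr (_%:E * _)%E.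
rewrite gtr0_norm// !phiE /mehler mulrA (mulrC w^-1) [RHS]mulrACA -expRD; congr (_ * expR _).
by field; rewrite gt_eqF.
Qed.

(** The law is known on nonnegative test functions only, so a signed [g] is treated through its
    positive and negative parts. *)
Lemma law_density (g : R * R -> R) : measurable_fun setT g ->
  (\int[P]_t (g (X t, Y t))%:E = \int[gam2]_z (g z * mehler r w z.1 z.2)%:E)%E.
Proof.
move=> mg.
have f1 : measurable_fun [set: R * R] (fun z : R * R => z.1) by exact: measurable_fst.
have f2 : measurable_fun [set: R * R] (fun z : R * R => z.2) by exact: measurable_snd.
have mM : measurable_fun [set: R * R] (fun z : R * R => mehler r w z.1 z.2).
  apply: measurable_funM => //; apply: measurableT_comp => //.
  apply: measurable_funB; apply: measurable_funM => //; apply: measurable_funX => //.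
  by apply: measurable_funB => //; exact: measurable_funM.
have M0 (z : R * R) : 0 <= mehler r w z.1 z.2 by exact: mehler_ge0.
have key (h : R * R -> \bar R) : measurable_fun setT h -> (forall z, 0 <= h z)%E ->
    (\int[P]_t h (X t, Y t) = \int[gam2]_z (h z * (mehler r w z.1 z.2)%:E))%E.
  move=> mh h0; rewrite law//.
  have mh' : measurable_fun [set: R * R] (fun z : R * R => h z * (mehler r w z.1 z.2)%:E)%E.
    by apply: emeasurable_funM => //; apply/measurable_EFinP.
  have h0' (z : R * R) : (0 <= h z * (mehler r w z.1 z.2)%:E)%E.
    by rewrite mule_ge0// lee_fin.
  rewrite (fubini_tonelli1 (m1 := gam) (m2 := gam) _ mh' h0').
  apply: eq_integral => x _; rewrite /fubini_F/=.
  under eq_integral do rewrite mul1r.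
  exact: (kernel x (measurable_sectionl x mh) (fun v => h0 _)).
have mE : measurable_fun [set: R * R] (EFin \o g) by apply/measurable_EFinP.
rewrite integralE [in RHS]integralE; congr (_ - _)%E.
- have H := key ((EFin \o g)^\+)%E (measurable_funepos mE) (fun z => funepos_ge0 _ z).
  etransitivity; [|etransitivity; first (refine H)]; apply: eq_integral => z _; rewrite !funeposE//=.
  by rewrite -!EFin_max -EFinM; congr EFin; rewrite maxr_pMl// mul0r.
- have H := key ((EFin \o g)^\-)%E (measurable_funeneg mE) (fun z => funeneg_ge0 _ z).
  etransitivity; [|etransitivity; first (refine H)]; apply: eq_integral => z _; rewrite !funenegE//=.
  by rewrite -!EFin_max -EFinM; congr EFin; rewrite maxr_pMl// mul0r mulNr.
Qed.

End covariance.

(** * Covariance of one function of growth class along a correlated pair *)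

Section covariance_bounds.
Variable R : realType.
Local Notation gam := (gam R).
Local Notation gam2 := (gam \x gam)%E.

(** The law is specified through nonnegative measurable test functions, the form in which
    [gauss_pair] delivers it; [w = 0], that is [r = 1] or [r = -1], is allowed. *)
Definition gpair d (T : measurableType d) (P : probability T R) (X Y : T -> R) (r : R) :=
  measurable_fun setT X /\ measurable_fun setT Y /\
  exists w, [/\ 0 <= w, r ^+ 2 + w ^+ 2 = 1 &
    forall H : R * R -> \bar R, measurable_fun [set: R * R] H ->
      (forall u, 0 <= H u)%E -> (\int[P]_t H (X t, Y t) = pair_law 1 r w H)%E].

Section one_pair.
Variables (d : measure_display) (T : measurableType d) (P : probability T R).
Variables (X Y : T -> R) (r : R) (f : R -> R) (B : R).
Hypotheses (XY : gpair P X Y r) (gf : growth B f).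

Let mX : measurable_fun setT X := XY.1.
Let mY : measurable_fun setT Y := XY.2.1.
Let B0 : 0 <= B := growth_ge0 gf.

Let mf2 : measurable_fun [set: R] (fun x => (f x ^+ 2)%:E).
Proof. by apply/measurable_EFinP; apply: measurable_funX; exact: gf.1. Qed.

Let f2_fin : (\int[gam]_x (f x ^+ 2)%:E <= (2 * B ^+ 2)%:E)%E.
Proof.
have mf : measurable_fun setT (fun x => f x ^+ 2) by apply: measurable_funX; exact: gf.1.
have [i h] := le_gam_integral mf (growth_sqr gf).
rewrite (gam_fin i) lee_fin; apply: le_trans h; exact: ler_norm.
Qed.

Let mfXY : measurable_fun setT (fun t => f (X t) * f (Y t)).
Proof.
apply: measurable_funM.
- exact: (measurableT_comp gf.1 mX).
- exact: (measurableT_comp gf.1 mY).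
Qed.

(** The crude bound by second moments, which ignores the correlation; it gives integrability and
    serves for large [|r|]. *)
Let cov_cs : (\int[P]_t `|(f (X t) * f (Y t))%:E| <= (2 * B ^+ 2)%:E)%E.
Proof.
have [_ [_ [w [w0 rw law]]]] := XY.
have mfX : measurable_fun setT (fun t => (f (X t) ^+ 2)%:E).
  exact: (measurableT_comp mf2 mX).
have mfY : measurable_fun setT (fun t => (f (Y t) ^+ 2)%:E).
  exact: (measurableT_comp mf2 mY).
apply: (@le_trans _ _ (\int[P]_t (2^-1%:E * ((f (X t) ^+ 2)%:E + (f (Y t) ^+ 2)%:E)))%E).
  apply: ge0_le_integral => //.
  - by apply: measurableT_comp => //; apply/measurable_EFinP.
  - by apply: emeasurable_funM => //; exact: emeasurable_funD.
  - move=> t _; rewrite -EFinD -EFinM lee_fin normrM.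
    have := sqr_ge0 (`|f (X t)| - `|f (Y t)|); rewrite sqrrB !real_normK ?num_real//.
    by set a := `|_|; set b := `|_|; lra.
rewrite ge0_integralZl//; first last.
- by move=> t _; rewrite -EFinD lee_fin addr_ge0 ?sqr_ge0.
- exact: emeasurable_funD.
rewrite ge0_integralD//; last 2 first.
- by move=> t _; rewrite lee_fin sqr_ge0.
- by move=> t _; rewrite lee_fin sqr_ge0.
have sq0 x : (0 <= (f x ^+ 2)%:E)%E by rewrite lee_fin sqr_ge0.
have -> : (\int[P]_t (f (X t) ^+ 2)%:E = \int[gam]_x (f x ^+ 2)%:E)%E.
  exact: (law1 law mf2 sq0).
have -> : (\int[P]_t (f (Y t) ^+ 2)%:E = \int[gam]_x (f x ^+ 2)%:E)%E.
  exact: (law2 rw law mf2 sq0).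
apply: (@le_trans _ _ (2^-1%:E * ((2 * B ^+ 2)%:E + (2 * B ^+ 2)%:E))%E).
  by apply: lee_wpmul2l; [rewrite lee_fin|exact: leeD].
by rewrite -EFinD -EFinM lee_fin; lra.
Qed.

Lemma cov_integrable : P.-integrable setT (EFin \o (fun t => f (X t) * f (Y t))).
Proof.
apply/integrableP; split; first exact/measurable_EFinP.
exact: le_lt_trans cov_cs (ltry _).
Qed.

Let cov_large : `|\int[P]_t (f (X t) * f (Y t))| <= 2 * B ^+ 2.
Proof.
apply: (le_trans (le_normr_Rintegral _ cov_integrable)) => //.
rewrite /Rintegral -[leRHS]/(fine (2 * B ^+ 2)%:E) fine_le//.
- rewrite ge0_fin_numE; first exact: le_lt_trans cov_cs (ltry _).
  by apply: integral_ge0 => x _.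
Qed.

Hypothesis f0 : \int[gam]_x f x = 0.

Section small.
Variable w : R.
Hypotheses (r4 : `|r| <= 1 / 4) (w0 : 0 <= w) (rw : r ^+ 2 + w ^+ 2 = 1).
Let g (z : R * R) := f z.1 * f z.2.
Let M (z : R * R) := mehler r w z.1 z.2.

Let f1 : measurable_fun [set: R * R] (fun z : R * R => z.1).
Proof. exact: measurable_fst. Qed.
Let f2 : measurable_fun [set: R * R] (fun z : R * R => z.2).
Proof. exact: measurable_snd. Qed.
Let mg : measurable_fun [set: R * R] g.
Proof.
apply: measurable_funM; [exact: (measurableT_comp gf.1 f1)|exact: (measurableT_comp gf.1 f2)].
Qed.
Let mM : measurable_fun [set: R * R] M.
Proof.
apply: measurable_funM => //; apply: measurableT_comp => //.
apply: measurable_funB; apply: measurable_funM => //; apply: measurable_funX => //.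
by apply: measurable_funB => //; exact: measurable_funM.
Qed.
Let M' (z : R * R) := mehler r w z.1 (- z.2).
Let mM' : measurable_fun [set: R * R] M'.
Proof.
have mo : measurable_fun [set: R * R] (fun z : R * R => (z.1, - z.2)).
  apply: measurable_fun_pair => //; exact: (measurableT_comp (@oppr_measurable R setT) f2).
exact: (measurableT_comp mM mo).
Qed.

Let gbound (c : R) (N : R * R -> R) z : 0 <= c ->
  `|N z| <= c * (expR (z.1 ^+ 2 / 4) * expR (z.2 ^+ 2 / 4)) ->
  `|g z * N z| <= c * B ^+ 2 * (expR (3 / 8 * z.1 ^+ 2) * expR (3 / 8 * z.2 ^+ 2)).
Proof.
move=> c0 hN; rewrite normrM.
have hg : `|g z| <= B ^+ 2 * (expR (z.1 ^+ 2 / 8) * expR (z.2 ^+ 2 / 8)).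
  by rewrite normrM expr2 mulrACA; apply: ler_pM => //; exact: gf.2.
apply: le_trans (ler_pM _ _ hg hN) _ => //.
rewrite mulrACA (mulrC (B ^+ 2)) [X in _ * X <= _]mulrACA -!expRD.
by rewrite le_eqVlt; apply/orP; left; apply/eqP; congr (_ * expR _); field.
Qed.

Let exp4_ge1 (z : R * R) : 1 <= expR (z.1 ^+ 2 / 4) * expR (z.2 ^+ 2 / 4).
Proof. by rewrite -expRD -[leLHS]expR0 ler_expR addr_ge0// divr_ge0 ?sqr_ge0. Qed.

Let igM : gam2.-integrable setT (EFin \o (fun z => g z * M z)).
Proof.
have mm : measurable_fun setT (fun z => g z * M z) by exact: measurable_funM.
suff hb z : `|g z * M z| <= (100 * `|r| + 1) * B ^+ 2 *
    (expR (3 / 8 * z.1 ^+ 2) * expR (3 / 8 * z.2 ^+ 2)).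
  by have [] := le_gam2_integral mm hb.
apply: gbound; first by rewrite addr_ge0 ?mulr_ge0.
have -> : M z = (M z - 1) + 1 by ring.
apply: le_trans (ler_normD _ _) _; rewrite mulrDl mul1r normr1; apply: lerD => //.
exact: (mehler_bound r4 w0 rw).
Qed.

Let igM' : gam2.-integrable setT (EFin \o (fun z => g z * M' z)).
Proof.
have mm : measurable_fun setT (fun z => g z * M' z) by exact: measurable_funM.
suff hb z : `|g z * M' z| <= (100 * `|r| + 1) * B ^+ 2 *
    (expR (3 / 8 * z.1 ^+ 2) * expR (3 / 8 * z.2 ^+ 2)).
  by have [] := le_gam2_integral mm hb.
apply: gbound; first by rewrite addr_ge0 ?mulr_ge0.
have -> : M' z = (M' z - 1) + 1 by ring.
apply: le_trans (ler_normD _ _) _; rewrite mulrDl mul1r normr1; apply: lerD => //.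
by have := mehler_bound r4 w0 rw z.1 (- z.2); rewrite sqrrN.
Qed.

(** Since [f] has mean zero, the product [g] integrates to 0 under independence, and the kernel may
    be replaced by its difference with 1. *)
Lemma small_gen : `|\int[gam2]_z (g z * M z)| <= 400 * `|r| * B ^+ 2.
Proof.
have [ig g0] := gam2_prod0 gf f0.
have -> : \int[gam2]_z (g z * M z) = \int[gam2]_z (g z * (M z - 1)).
  rewrite -[LHS]subr0 -{1}g0 -RintegralB//.
  by apply: eq_Rintegral => z _; rewrite mulrBr mulr1.
have mm : measurable_fun setT (fun z => g z * (M z - 1)).
  by apply: measurable_funM => //; exact: measurable_funB.
have hb z : `|g z * (M z - 1)| <= 100 * `|r| * B ^+ 2 *
    (expR (3 / 8 * z.1 ^+ 2) * expR (3 / 8 * z.2 ^+ 2)).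
  apply: (gbound (N := fun z => M z - 1)); first by rewrite mulr_ge0.
  exact: (mehler_bound r4 w0 rw).
have [_ h] := le_gam2_integral mm hb.
by apply: le_trans h _; rewrite !mulrA; lra.
Qed.

(** Evenness of [f] allows the kernel to be averaged with its reflection before 1 is subtracted; the
    first order in [r] then disappears. *)
Lemma small_even : (forall x, f (- x) = f x) ->
  `|\int[gam2]_z (g z * M z)| <= 400 * r ^+ 2 * B ^+ 2.
Proof.
move=> fe; have [ig g0] := gam2_prod0 gf f0.
have mgM : measurable_fun [set: R * R] (fun z => g z * M z) by exact: measurable_funM.
have sym : \int[gam2]_z (g z * M' z) = \int[gam2]_z (g z * M z).
  rewrite /Rintegral; congr fine; rewrite -(gam2_oppr mgM).
  by apply: eq_integral => z _; rewrite /g /M' /M/= fe.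
have ig2 : gam2.-integrable setT (EFin \o (fun z => 2 * g z)) by exact: integrableZ_EFin.
have igs : gam2.-integrable setT (EFin \o (fun z => g z * M z + g z * M' z)).
  exact: integrableD_EFin.
have e : \int[gam2]_z (g z * (M z + M' z - 2)) = 2 * \int[gam2]_z (g z * M z).
  transitivity (\int[gam2]_z (g z * M z + g z * M' z - 2 * g z)).
    by apply: eq_Rintegral => z _; ring.
  by rewrite RintegralB// RintegralD// RintegralZl// sym g0; ring.
have mm : measurable_fun setT (fun z => g z * (M z + M' z - 2)).
  by apply: measurable_funM => //; apply: measurable_funB => //; exact: measurable_funD.
have hb z : `|g z * (M z + M' z - 2)| <= 100 * r ^+ 2 * B ^+ 2 *
    (expR (3 / 8 * z.1 ^+ 2) * expR (3 / 8 * z.2 ^+ 2)).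
  apply: (gbound (N := fun z => M z + M' z - 2)).
    by rewrite mulr_ge0 ?sqr_ge0.
  exact: (mehler_even_bound r4 w0 rw).
have [_ h] := le_gam2_integral mm hb.
rewrite e normrM ger0_norm// in h.
set I := `|_| in h *; have : 0 <= r ^+ 2 * B ^+ 2 by rewrite mulr_ge0 ?sqr_ge0.
by move=> ?; rewrite -!mulrA in h *; lra.
Qed.

End small.

Let small_w w : `|r| <= 1 / 4 -> 0 <= w -> r ^+ 2 + w ^+ 2 = 1 -> 0 < w.
Proof.
move=> r4 w0 rw; rewrite lt_neqAle w0 andbT; apply/eqP => h; move: rw.
rewrite -h expr0n/= addr0 -real_normK ?num_real// => e.
have : `|r| ^+ 2 <= (1 / 4) ^+ 2 by rewrite ler_sqr ?nnegrE//; lra.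
by rewrite e; lra.
Qed.

Let mg : measurable_fun [set: R * R] (fun z : R * R => f z.1 * f z.2).
Proof.
apply: measurable_funM.
- exact: (measurableT_comp gf.1 (@measurable_fst _ _ R R)).
- exact: (measurableT_comp gf.1 (@measurable_snd _ _ R R)).
Qed.

Lemma cov_gen : `|\int[P]_t (f (X t) * f (Y t))| <= 400 * `|r| * B ^+ 2.
Proof.
have [r4|r4] := leP `|r| (1 / 4).
  have [_ [_ [w [w0 rw law]]]] := XY.
  have wg := small_w r4 w0 rw.
  rewrite /Rintegral (law_density w0 law wg mg).
  exact: small_gen r4 w0 rw.
apply: le_trans cov_large _.
have b2 := sqr_ge0 B; have : 1 / 4 * B ^+ 2 <= `|r| * B ^+ 2 by apply: ler_wpM2r => //; exact: ltW.
by rewrite -!mulrA; lra.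
Qed.

Lemma cov_even : (forall x, f (- x) = f x) ->
  `|\int[P]_t (f (X t) * f (Y t))| <= 400 * r ^+ 2 * B ^+ 2.
Proof.
move=> fe; have [r4|r4] := leP `|r| (1 / 4).
  have [_ [_ [w [w0 rw law]]]] := XY.
  have wg := small_w r4 w0 rw.
  rewrite /Rintegral (law_density w0 law wg mg).
  exact: (small_even r4 w0 rw).
apply: le_trans cov_large _.
have : (1 / 4) ^+ 2 <= `|r| ^+ 2 by rewrite ler_sqr ?nnegrE//; exact: ltW.
rewrite real_normK ?num_real// => h.
have b2 := sqr_ge0 B; have : (1 / 4) ^+ 2 * B ^+ 2 <= r ^+ 2 * B ^+ 2 by apply: ler_wpM2r.
have -> : (1 / 4) ^+ 2 = 1 / 16 :> R by field.
by rewrite -!mulrA; lra.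
Qed.

End one_pair.
End covariance_bounds.

(** * Expectation bounds for functions not known to be measurable *)

Section upper_expectation.
Variable R : realType.
Local Notation gam := (gam R).
Implicit Types (F G : (nat -> R) -> R) (b c : R) (n : nat).

Definition mreal G := forall d (T : measurableType d) (Z : nat -> T -> R),
  (forall k, measurable_fun setT (Z k)) -> measurable_fun setT (fun t => G (fun k => Z k t)).

Lemma mrealE G : mreal G -> mfunctional (fun z => (G z)%:E).
Proof. by move=> mG d T Z mZ; apply/measurable_EFinP; exact: mG. Qed.

(* [F] need not be measurable: it is dominated by a measurable [G] of small expectation. *)
Definition upE n F b := exists G, [/\ mreal G, forall z, 0 <= G z, forall z, F z <= G z &
  (gauss_int n (fun z => (G z)%:E) <= b%:E)%E].

Lemma upE_le n F F' b b' : (forall z, F z <= F' z) -> b' <= b -> upE n F' b' -> upE n F b.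
Proof.
move=> FF bb [G [mG G0 FG h]]; exists G; split => //.
  by move=> z; exact: le_trans (FG z).
by apply: le_trans h _; rewrite lee_fin.
Qed.

(** Additivity of the integral needs measurability, so it is applied to the two majorants on a
    representing probability space. *)
Lemma upE_add n F F' b b' : upE n F b -> upE n F' b' -> upE n (fun z => F z + F' z) (b + b').
Proof.
move=> [G [mG G0 FG h]] [G' [mG' G0' FG' h']].
have mGG : mreal (fun z => G z + G' z).
  by move=> d T Z mZ; apply: measurable_funD; [exact: mG|exact: mG'].
exists (fun z => G z + G' z); split => //.
- by move=> z; rewrite addr_ge0.
- by move=> z; rewrite lerD.
have [d [T [P [Z [mZ rep]]]]] := gauss_reprP R n.
have G0e z : (0 <= (G z)%:E)%E by rewrite lee_fin.
have G0e' z : (0 <= (G' z)%:E)%E by rewrite lee_fin.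
have GG0 z : (0 <= (G z + G' z)%:E)%E by rewrite lee_fin addr_ge0.
rewrite (rep _ GG0 (mrealE mGG)).
rewrite (rep _ G0e (mrealE mG)) in h; rewrite (rep _ G0e' (mrealE mG')) in h'.
under eq_integral do rewrite EFinD.
rewrite ge0_integralD//; first by rewrite EFinD; exact: leeD.
- exact: (mrealE mG mZ).
- exact: (mrealE mG' mZ).
Qed.

Lemma upE_scale n F b c : 0 <= c -> upE n F b -> upE n (fun z => c * F z) (c * b).
Proof.
move=> c0 [G [mG G0 FG h]].
have mGG : mreal (fun z => c * G z).
  by move=> d T Z mZ; apply: measurable_funM => //; exact: mG.
exists (fun z => c * G z); split => //.
- by move=> z; rewrite mulr_ge0.
- by move=> z; rewrite ler_wpM2l.
have [d [T [P [Z [mZ rep]]]]] := gauss_reprP R n.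
have G0e z : (0 <= (G z)%:E)%E by rewrite lee_fin.
have GG0 z : (0 <= (c * G z)%:E)%E by rewrite lee_fin mulr_ge0.
rewrite (rep _ GG0 (mrealE mGG)).
rewrite (rep _ G0e (mrealE mG)) in h.
under eq_integral do rewrite EFinM.
rewrite ge0_integralZl//; first by rewrite EFinM; apply: lee_wpmul2l.
exact: (mrealE mG mZ).
Qed.

Lemma gauss_int_cst n c : 0 <= c -> gauss_int n (fun _ => c%:E) = c%:E.
Proof.
move=> c0; have [d [T [P [Z [mZ rep]]]]] := gauss_reprP R n.
have c0e (z : nat -> R) : (0 <= c%:E)%E by rewrite lee_fin.
have mc : mfunctional (fun _ : nat -> R => c%:E) by move=> d' T' Z' _; exact: measurable_cst.
rewrite (rep _ c0e mc) integral_cst// [X in (_ * X)%E](_ : _ = 1%E) ?mule1//.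
exact: probability_setT.
Qed.

Lemma upE_cst n c : 0 <= c -> upE n (fun _ => c) c.
Proof.
move=> c0; exists (fun _ => c); split => //; by rewrite gauss_int_cst.
Qed.

Lemma upE_sum n (I : Type) (s : seq I) (Q : pred I) (F : I -> (nat -> R) -> R) (b : I -> R) :
  (forall i, Q i -> upE n (F i) (b i)) ->
  upE n (fun z => \sum_(i <- s | Q i) F i z) (\sum_(i <- s | Q i) b i).
Proof.
move=> h; elim: s => [|i s IH].
  by apply: (@upE_le _ _ (fun _ => 0) _ 0); [move=> z| |exact: upE_cst]; rewrite big_nil.
have [Qi|Qi] := boolP (Q i); last first.
  by apply: upE_le IH => [z|]; rewrite big_cons (negbTE Qi).
by apply: upE_le (upE_add (h i Qi) IH) => [z|]; rewrite big_cons Qi.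
Qed.

Lemma upE_gauss_int n F b : (forall z, 0 <= F z) -> upE n F b ->
  (gauss_int n (fun z => (F z)%:E) <= b%:E)%E.
Proof.
move=> F0 [G [mG G0 FG h]]; apply: le_trans h; apply: gauss_int_le => z.
  by rewrite lee_fin.
by rewrite lee_fin.
Qed.

(** Markov's inequality in a measurable form: the indicator of [G < 1] lies below that of the event,
    and its complement lies below [G]. *)
Lemma upE_prob n F b (Q : (nat -> R) -> Prop) : upE n F b -> (forall z, F z < 1 -> Q z) ->
  ((1 - b)%:E <= gauss_int n (fun z => (if `[< Q z >] then 1 else 0)%:E))%E.
Proof.
move=> [G [mG G0 FG h]] FQ.
pose I z : R := if G z < 1 then 1 else 0; pose J z : R := if G z < 1 then 0 else 1.
have mI : mreal I.
  move=> d T Z mZ; apply: measurable_fun_ifT => //.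
  by apply: measurable_fun_ltr => //; exact: mG.
have mJ : mreal J.
  move=> d T Z mZ; apply: measurable_fun_ifT => //.
  by apply: measurable_fun_ltr => //; exact: mG.
have I0 z : (0 <= (I z)%:E)%E by rewrite lee_fin /I; case: ifP.
have J0 z : (0 <= (J z)%:E)%E by rewrite lee_fin /J; case: ifP.
have Jb : (gauss_int n (fun z => (J z)%:E) <= b%:E)%E.
  apply: le_trans h; apply: gauss_int_le => // z; rewrite lee_fin /J.
  by case: ifPn => //; rewrite -leNgt.
apply: (@le_trans _ _ (gauss_int n (fun z => (I z)%:E))); last first.
  apply: gauss_int_le => // z; rewrite lee_fin /I; case: ifPn => [g1|_].
    by rewrite (asboolT (FQ z _))//; exact: le_lt_trans (FG z) g1.
  by case: ifP.
rewrite EFinB leeBlDr//.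
have [d [T [P [Z [mZ rep]]]]] := gauss_reprP R n.
rewrite (rep _ J0 (mrealE mJ)) in Jb; rewrite (rep _ I0 (mrealE mI)).
have e1 : (1%:E = \int[P]_t ((I (fun k => Z k t))%:E + (J (fun k => Z k t))%:E))%E.
  transitivity (\int[P]_t (1%:E : \bar R))%E.
    rewrite integral_cst// [X in (_ * X)%E](_ : _ = 1%E) ?mule1//; exact: probability_setT.
  apply: eq_integral => t _; rewrite /I /J -EFinD.
  by case: ifP => _; rewrite ?addr0 ?add0r.
rewrite e1 ge0_integralD//; first exact: leeD.
- exact: (mrealE mI mZ).
- exact: (mrealE mJ mZ).
Qed.

End upper_expectation.

(** * Second moments of weighted sums over the standardized coordinates *)

Section second_moment.
Variable R : realType.
Local Notation gam := (gam R).
Variables (n : nat) (I : finType) (a : I -> nat -> R).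
Let rho i j := \sum_(k < n) a i k * a j k.
Hypothesis a1 : forall i, rho i i = 1.

Definition xi i (z : nat -> R) : R := lin n (a i) z.

Lemma mreal_lin (u : nat -> R) : mreal (lin n u).
Proof.
move=> d T Z mZ; rewrite /lin.
apply: (@measurable_sum _ _ _ _ _ _ (fun j t => u (nat_of_ord j) * Z (nat_of_ord j) t)) => k.
by apply: measurable_funM => //; exact: mZ.
Qed.

(** The rows have unit length, so in the Cholesky form [p = 1] and [q] is the correlation. *)
Lemma xi_gpair i j d (T : measurableType d) (P : probability T R) Z : gauss_repr n P Z ->
  gpair P (fun t => xi i (fun k => Z k t)) (fun t => xi j (fun k => Z k t)) (rho i j).
Proof.
move=> [mZ rep]; split; first exact: mreal_lin; split; first exact: mreal_lin.
have [p [q [w [[p0 w0 pp pq qw] law]]]] := gauss_pair n (a i) (a j).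
have sq i' : \sum_(k < n) a i' k ^+ 2 = 1.
  by rewrite -(a1 i'); apply: eq_bigr => k _; rewrite expr2.
have p1 : p = 1.
  by apply/eqP; rewrite -(@eqrXn2 _ 2)// expr1n pp sq.
have qr : q = rho i j by rewrite -[q]mul1r -p1 pq.
exists w; split => //; first by rewrite -qr qw sq.
move=> H mH H0; rewrite -qr -p1 -law//.
rewrite (rep (fun z => H (lin n (a i) z, lin n (a j) z)))// => d' T' Z' mZ'.
by apply: measurable_fun_comp2 => //; exact: mreal_lin.
Qed.

(** Expanding the square leaves expectations of products of two terms, so joint laws of more than
    two coordinates never occur. *)
Lemma second_moment_gen (f : R -> R) B (w : I -> R) (c : I -> I -> R) :
  growth B f ->
  (forall i j d (T : measurableType d) (P : probability T R) X Y, gpair P X Y (rho i j) ->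
     `|\int[P]_t (f (X t) * f (Y t))| <= c i j) ->
  upE n (fun z => (\sum_i w i * f (xi i z)) ^+ 2) (\sum_i \sum_j `|w i| * `|w j| * c i j).
Proof.
move=> gf hc; set F := fun z => _.
have mF : mreal F.
  move=> d T Z mZ; apply: measurable_funX.
  apply: (@measurable_sum _ _ _ _ _ _ (fun i t => w i * f (xi i (fun k => Z k t)))) => i.
  by apply: measurable_funM => //; apply: (measurableT_comp gf.1); exact: mreal_lin.
have F0 z : (0 <= (F z)%:E)%E by rewrite lee_fin sqr_ge0.
exists F; split => //.
have [d [T [P [Z rep]]]] := gauss_reprP R n.
rewrite (rep.2 _ F0 (mrealE mF)).
pose X i t := xi i (fun k => Z k t).
have int_ i j : P.-integrable setT (EFin \o (fun t => f (X i t) * f (X j t))).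
  exact: cov_integrable (xi_gpair i j rep) gf.
have -> : (\int[P]_t (F (fun k => Z k t))%:E =
    \int[P]_t \sum_i \sum_j ((w i * w j) * (f (X i t) * f (X j t)))%:E)%E.
  apply: eq_integral => t _; rewrite /F expr2 big_distrlr/= -sumEFin; apply: eq_bigr => i _.
  by rewrite -sumEFin; apply: eq_bigr => j _; rewrite mulrACA.
have intw i j : P.-integrable setT (fun t => ((w i * w j) * (f (X i t) * f (X j t)))%:E).
  exact: integrableZ_EFin.
rewrite integral_sum//; last by move=> i; apply: integrable_sum => // j _.
rewrite -sumEFin; apply: lee_sum => i _.
rewrite integral_sum// -sumEFin; apply: lee_sum => j _.
have -> : (\int[P]_t ((w i * w j) * (f (X i t) * f (X j t)))%:E =
    ((w i * w j) * \int[P]_t (f (X i t) * f (X j t)))%:E)%E.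
  rewrite -RintegralZl// /Rintegral fineK//.
  exact: (integrable_fin_num measurableT (intw i j)).
rewrite lee_fin; apply: le_trans (ler_norm _) _; rewrite !normrM.
by apply: ler_wpM2l; [exact: mulr_ge0|exact: (hc i j _ _ _ _ _ (xi_gpair i j rep))].
Qed.

Lemma second_moment_even (f : R -> R) B (w : I -> R) : growth B f ->
  (forall x, f (- x) = f x) -> (forall i, `|w i| <= 1) ->
  upE n (fun z => (\sum_i w i * (f (xi i z) - \int[gam]_x f x)) ^+ 2)
    (3600 * B ^+ 2 * \sum_i \sum_j rho i j ^+ 2).
Proof.
move=> gf fe w1.
have gc := growth_center gf; have f0 := growth_center0 gf.
have := @second_moment_gen _ _ w (fun i j => 400 * rho i j ^+ 2 * (3 * B) ^+ 2) gc.
have H i j d (T : measurableType d) (P : probability T R) X Y : gpair P X Y (rho i j) ->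
     `|\int[P]_t ((f (X t) - \int[gam]_x f x) * (f (Y t) - \int[gam]_x f x))|
      <= 400 * rho i j ^+ 2 * (3 * B) ^+ 2.
  move=> XY; apply: (cov_even XY gc f0) => x; by rewrite fe.
move=> /(_ H); apply: upE_le => //.
rewrite mulr_sumr; apply: ler_sum => i _; rewrite mulr_sumr; apply: ler_sum => j _.
have r0 := sqr_ge0 (rho i j); have b0 := sqr_ge0 B.
have -> : 400 * rho i j ^+ 2 * (3 * B) ^+ 2 = 3600 * B ^+ 2 * rho i j ^+ 2 by ring.
apply: ler_piMl; last by rewrite mulr_ile1.
by apply: mulr_ge0; [apply: mulr_ge0; [exact: ler0n|exact: b0]|exact: r0].
Qed.

(** Odd functions are centred by symmetry but see the correlation at first order. The weights are
    kept in the bound because their small support is what makes it useful. *)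
Lemma second_moment_odd (f : R -> R) B (w : I -> R) : growth B f ->
  (forall x, f (- x) = - f x) ->
  upE n (fun z => (\sum_i w i * f (xi i z)) ^+ 2)
    (400 * B ^+ 2 * \sum_i \sum_j `|w i| * `|w j| * `|rho i j|).
Proof.
move=> gf fo.
have f0 := gam_odd (growth_integrable gf) fo.
have := @second_moment_gen _ _ w (fun i j => 400 * `|rho i j| * B ^+ 2) gf.
have H i j d (T : measurableType d) (P : probability T R) X Y : gpair P X Y (rho i j) ->
     `|\int[P]_t (f (X t) * f (Y t))| <= 400 * `|rho i j| * B ^+ 2.
  by move=> XY; exact: (cov_gen XY gf f0).
move=> /(_ H); apply: upE_le => //.
rewrite mulr_sumr; apply: ler_sum => i _; rewrite mulr_sumr; apply: ler_sum => j _.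
by rewrite le_eqVlt; apply/orP; left; apply/eqP; ring.
Qed.

Lemma first_moment (f : R -> R) B i : growth B f -> (forall x, 0 <= f x) ->
  upE n (fun z => f (xi i z)) (\int[gam]_x f x).
Proof.
move=> gf f0; exists (fun z => f (xi i z)).
have mF : mreal (fun z => f (xi i z)).
  by move=> d T Z mZ; apply: (measurableT_comp gf.1); exact: mreal_lin.
split => //.
have [d [T [P [Z rep]]]] := gauss_reprP R n.
have F0 z : (0 <= (f (xi i z))%:E)%E by rewrite lee_fin.
rewrite (rep.2 _ F0 (mrealE mF)).
have [_ [_ [w [w0 rw law]]]] := xi_gpair i i rep.
have mfe : measurable_fun [set: R] (EFin \o f) by apply/measurable_EFinP; exact: gf.1.
have f0e x : (0 <= (EFin \o f) x)%E by rewrite lee_fin.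
have -> : (\int[P]_t (f (xi i (fun k => Z k t)))%:E = \int[gam]_x (f x)%:E)%E.
  exact: (law1 law mfe f0e).
by rewrite gam_fin//; exact: growth_integrable gf.
Qed.

End second_moment.

(** * Numerical and tail estimates for the chi-square law with one degree of freedom *)

Section chi2.
Variable R : realType.
Local Notation mu := (@lebesgue_measure R).
Local Notation gam := (gam R).
Implicit Types (x y a b c tau D : R).

(** Equivalent to [49 / 9 <= 2 * pi <= 169 / 25]; Taylor bounds on the cosine place [pi] between
    14/5 and 84/25. *)
Lemma phi0_bounds : 5 / 13 <= phi (0 : R) <= 3 / 7.
Proof.
have p2 : (pi : R) > 14 / 5.
  rewrite ltNge; apply/negP => h.
  have c : 0 < cos (7 / 5 : R).
    have /(@cos_ge_quad R) : 0 <= 7 / 5 :> R by lra.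
    set w := cos _; lra.
  have p := @pi_ge2 R.
  have : cos (7 / 5 : R) <= cos (pi / 2).
    rewrite leNgt ltr_cos ?in_itv/=; [rewrite -leNgt; lra|apply/andP; split; lra|apply/andP; split; lra].
  by rewrite cos_pihalf leNgt c.
have p1 := @pi_lt R.
rewrite phiE expr0n/= mul0r oppr0 expR0 mulr1; apply/andP; split.
- rewrite -[leLHS]invrK lef_pV2 ?posrE ?sqrtr_gt0; try lra.
  rewrite -(@ler_sqr R) ?nnegrE ?sqrtr_ge0; try lra.
  by rewrite sqr_sqrtr; lra.
- rewrite -[leRHS]invrK lef_pV2 ?posrE ?sqrtr_gt0; try lra.
  rewrite -(@ler_sqr R) ?nnegrE ?sqrtr_ge0; try lra.
  by rewrite sqr_sqrtr; lra.
Qed.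

Lemma phi_le0 x : phi x = phi 0 * expR (- (x ^+ 2 / 2)).
Proof. by rewrite !phiE expr0n/= mul0r oppr0 expR0 mulr1. Qed.

Lemma gam_lower (f : R -> R) a b c : measurable_fun setT f -> (forall x, 0 <= f x) -> a <= b ->
  0 <= c -> (forall x, a < x <= b -> c <= phi x * f x) ->
  ((c * (b - a))%:E <= \int[gam]_x (f x)%:E)%E.
Proof.
move=> mf f0 ab c0 h.
have mE : measurable_fun [set: R] (fun x => (f x)%:E) by apply/measurable_EFinP.
have mP : measurable_fun [set: R] (fun x => ((phi x)%:E * (f x)%:E)%E).
  by apply: emeasurable_funM => //; apply/measurable_EFinP; exact: measurable_phi.
rewrite ge0_integral_gam//.
have P0 x : (0 <= (phi x)%:E * (f x)%:E)%E by rewrite mule_ge0// lee_fin ?phi_ge0.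
apply: (@le_trans _ _ (\int[mu]_(x in `]a, b]) ((phi x)%:E * (f x)%:E))%E); last first.
  exact: ge0_subset_integral.
apply: (@le_trans _ _ (\int[mu]_(x in `]a, b]) (cst c%:E) x)%E).
  rewrite integral_cst//= lebesgue_measure_itv/= lte_fin.
  case: ltP => [_|ba]; first by rewrite -EFinB -EFinM.
  have -> : a = b by apply/eqP; rewrite eq_le ab ba.
  by rewrite subrr mulr0 mule0.
apply: ge0_le_integral => //.
- exact: measurable_funTS.
Qed.

Lemma gam_upper (f : R -> R) a b c : measurable_fun setT f -> (forall x, 0 <= f x) -> a <= b ->
  0 <= c -> (forall x, a <= x <= b -> phi x * f x <= c) ->
  (forall x, ~~ (a <= x <= b) -> f x = 0) ->
  (\int[gam]_x (f x)%:E <= (c * (b - a))%:E)%E.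
Proof.
move=> mf f0 ab c0 h hn.
have mE : measurable_fun [set: R] (fun x => (f x)%:E) by apply/measurable_EFinP.
have mP : measurable_fun [set: R] (fun x => ((phi x)%:E * (f x)%:E)%E).
  by apply: emeasurable_funM => //; apply/measurable_EFinP; exact: measurable_phi.
rewrite ge0_integral_gam//.
have -> : (\int[mu]_x ((phi x)%:E * (f x)%:E) =
   \int[mu]_(x in `[a, b]) ((phi x)%:E * (f x)%:E))%E.
  rewrite [RHS]integral_mkcond; apply: eq_integral => x _; rewrite /patch mem_setE in_itv/=.
  by case: ifPn => // /hn ->; rewrite mule0.
apply: (@le_trans _ _ (\int[mu]_(x in `[a, b]) (cst c%:E) x)%E); last first.
  rewrite integral_cst//= lebesgue_measure_itv/= lte_fin.
  case: ltP => [_|ba]; first by rewrite -EFinB -EFinM.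
  have -> : a = b by apply/eqP; rewrite eq_le ab ba.
  by rewrite subrr mulr0 mule0.
apply: ge0_le_integral => //.
- by move=> x _; rewrite mule_ge0// lee_fin ?phi_ge0.
- exact: measurable_funTS.
Qed.

Definition sqind y x : R := if x ^+ 2 <= y then 1 else 0.

Lemma measurable_sqind y : measurable_fun setT (sqind y).
Proof.
apply: measurable_fun_ifT => //; apply: measurable_fun_ler => //; exact: measurable_funX.
Qed.

Lemma growth_sqind y : growth 1 (sqind y).
Proof.
apply: bounded_growth; first exact: measurable_sqind.
by move=> x; rewrite /sqind; case: ifP; rewrite ?normr1 ?normr0.
Qed.

Lemma sqindN y x : sqind y (- x) = sqind y x.
Proof. by rewrite /sqind sqrrN. Qed.

Lemma sqind_ge0 y x : 0 <= sqind y x.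
Proof. by rewrite /sqind; case: ifP. Qed.

Lemma chi2cdfE y : chi2cdf y = \int[gam]_x sqind y x.
Proof.
rewrite /chi2cdf; case: ifPn => y0; last first.
  rewrite -(Rintegral_gam_cst (0 : R)); apply: eq_Rintegral => x _; rewrite /sqind.
  case: ifPn => // h; move: y0; rewrite -ltNge => /(le_lt_trans h).
  by rewrite ltNge sqr_ge0.
rewrite /Rintegral; congr fine.
have mE : measurable_fun [set: R] (fun x => (sqind y x)%:E).
  by apply/measurable_EFinP; exact: measurable_sqind.
rewrite ge0_integral_gam//; last by move=> x; rewrite lee_fin sqind_ge0.
rewrite integral_mkcond; apply: eq_integral => x _; rewrite /patch /sqind.
have -> : (x \in [set z : R | `|z| <= Num.sqrt y]) = (x ^+ 2 <= y).
  apply/idP/idP; rewrite inE/= -[in _ <= y](sqr_sqrtr y0) -real_normK ?num_real//.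
    by rewrite ler_sqr ?nnegrE ?sqrtr_ge0.
  by rewrite ler_sqr ?nnegrE ?sqrtr_ge0.
by case: ifP => _; rewrite ?mule1 ?mule0.
Qed.

Lemma chi2cdf_fin y : (\int[gam]_x (sqind y x)%:E = (chi2cdf y)%:E)%E.
Proof. by rewrite chi2cdfE; apply: gam_fin; exact: growth_integrable (growth_sqind y). Qed.

Lemma sqind_le x y z : x <= y -> sqind x z <= sqind y z.
Proof.
move=> xy; rewrite /sqind; case: ifPn => [h|_]; first by rewrite (le_trans h xy).
by case: ifP.
Qed.

Lemma chi2cdf_le x y : x <= y -> chi2cdf x <= chi2cdf y.
Proof.
move=> xy; rewrite !chi2cdfE; apply: le_Rintegral => //.
- exact: growth_integrable (growth_sqind x).
- exact: growth_integrable (growth_sqind y).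
- by move=> z _; exact: sqind_le.
Qed.

(** A lower slope is what makes the quantile stable under errors in the level. Between the square
    roots the density is at least [phi 2], and the difference of the roots is at least
    [(y - x) / 4]; only the positive half-line is used. *)
Lemma chi2cdf_slope x y : 0 <= x -> x <= y -> y <= 4 ->
  phi 2 / 4 * (y - x) <= chi2cdf y - chi2cdf x.
Proof.
move=> x0 xy y4; have y0 : 0 <= y by exact: le_trans xy.
rewrite !chi2cdfE -RintegralB//; last 2 first.
- exact: growth_integrable (growth_sqind y).
- exact: growth_integrable (growth_sqind x).
pose g z : R := if (Num.sqrt x < z) && (z <= Num.sqrt y) then 1 else 0.
have mg : measurable_fun setT g.
  apply: measurable_fun_ifT => //; apply: measurable_and.
    exact: measurable_fun_ltr.
  exact: measurable_fun_ler.
have gg : growth 1 g.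
  by apply: bounded_growth => // z; rewrite /g; case: ifP; rewrite ?normr1 ?normr0.
apply: (@le_trans _ _ (\int[gam]_z g z)); last first.
  apply: le_Rintegral => //.
  - exact: growth_integrable gg.
  - apply: integrableB_EFin; exact: growth_integrable (growth_sqind _).
  - move=> z _; rewrite /g; case: ifPn => [/andP[h1 h2]|_]; last by rewrite subr_ge0 sqind_le.
    have z0 : 0 <= z by apply: le_trans (ltW h1); exact: sqrtr_ge0.
    rewrite /sqind.
    have -> : z ^+ 2 <= y by rewrite -(sqr_sqrtr y0) ler_sqr ?nnegrE ?sqrtr_ge0.
    have -> : (z ^+ 2 <= x) = false.
      by apply/negbTE; rewrite -ltNge -{1}(sqr_sqrtr x0) ltr_sqr ?nnegrE ?sqrtr_ge0.
    by rewrite subr0.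
have g0 z : 0 <= g z by rewrite /g; case: ifP.
have sy2 : Num.sqrt y <= 2.
  have -> : 2 = Num.sqrt 4 :> R.
    have -> : 4 = 2 ^+ 2 :> R by ring.
    by rewrite sqrtr_sqr ger0_norm.
  exact: ler_wsqrtr.
have sx0 := sqrtr_ge0 x; have sxy : Num.sqrt x <= Num.sqrt y by exact: ler_wsqrtr.
have := @gam_lower g (Num.sqrt x) (Num.sqrt y) (phi 2) mg g0 sxy (phi_ge0 _).
rewrite (gam_fin (growth_integrable gg)) lee_fin => H.
apply: le_trans (H _); last first.
  move=> z zxy; rewrite /g zxy mulr1; case/andP : zxy => z1 z2.
  rewrite (phi_le0 2) (phi_le0 z); apply: ler_wpM2l; first exact: phi_ge0.
  rewrite ler_expR lerN2 ler_pM2r ?invr_gt0//.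
  by rewrite ler_sqr ?nnegrE//; lra.
have -> : y - x = Num.sqrt y ^+ 2 - Num.sqrt x ^+ 2 by rewrite !sqr_sqrtr.
set p := Num.sqrt y in sy2 sxy *; set q := Num.sqrt x in sx0 sxy *.
have ph := @phi_ge0 R 2; set f := phi 2 in ph *.
have -> : f / 4 * (p ^+ 2 - q ^+ 2) = f * ((p - q) * ((p + q) / 4)) by field.
apply: ler_wpM2l => //; rewrite ler_piMr//; lra.
Qed.

(** With the next lemma this brackets the median by two points at ratio 2. The square root of 9/32
    is below 8/15, and the density is at most 3/7. *)
Lemma chi2cdf_932 : chi2cdf (9 / 32 : R) <= 23 / 50.
Proof.
rewrite -lee_fin -chi2cdf_fin.
have sq x : (x ^+ 2 <= 9 / 32) -> - (8 / 15) <= x <= 8 / 15.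
  move=> h; apply/andP; split; rewrite leNgt; apply/negP => h2; nra.
have h54 : - (8 / 15) <= 8 / 15 :> R by lra.
have /andP[_ p0] := phi0_bounds.
apply: le_trans (gam_upper (measurable_sqind _) (sqind_ge0 _) h54 (phi_ge0 0) _ _) _.
- move=> x _; rewrite phi_le0 -mulrA ler_piMr ?phi_ge0//.
  have : expR (- (x ^+ 2 / 2)) <= 1.
    by rewrite -[leRHS]expR0 ler_expR oppr_le0 divr_ge0 ?sqr_ge0.
  by rewrite /sqind; case: ifP => _; rewrite ?mulr1 ?mulr0.
- by move=> x h; rewrite /sqind; case: ifPn => // /sq h2; rewrite h2 in h.
- by rewrite lee_fin; lra.
Qed.

(** A constant lower bound for the density is too coarse here, so the quadratic minorant
    [5 / 13 * (1 - x ^+ 2 / 2)] is integrated exactly. *)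
Lemma chi2cdf_916 : 13 / 25 <= chi2cdf (9 / 16 : R).
Proof.
rewrite -lee_fin -chi2cdf_fin.
have /andP[p0 _] := phi0_bounds.
have mE : measurable_fun [set: R] (fun x => (sqind (9 / 16) x)%:E).
  by apply/measurable_EFinP; exact: measurable_sqind.
rewrite ge0_integral_gam//; last by move=> x; rewrite lee_fin sqind_ge0.
have mP : measurable_fun [set: R] (fun x => ((phi x)%:E * (sqind (9 / 16) x)%:E)%E).
  by apply: emeasurable_funM => //; apply/measurable_EFinP; exact: measurable_phi.
have P0 x : (0 <= (phi x)%:E * (sqind (9 / 16) x)%:E)%E.
  by rewrite mule_ge0// lee_fin ?phi_ge0 ?sqind_ge0.
apply: (@le_trans _ _ (\int[mu]_(x in `[(- (3 / 4))%R, (3 / 4)%R]) ((phi x)%:E * (sqind (9 / 16) x)%:E))%E);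
  last exact: ge0_subset_integral.
pose g x : R := 5 / 13 * (1 - x ^+ 2 / 2).
pose G x : R := 5 / 13 * (x - x ^+ 3 / 6).
have dG x : is_derive x 1 G (g x).
  by rewrite /G /g; apply: is_derive_eq; rewrite /GRing.scale/=; field.
have cg : continuous g.
  move=> x; apply: cvgM; first exact: cvg_cst.
  apply: cvgB; first exact: cvg_cst.
  apply: cvgM; last exact: cvg_cst; exact: sqr_continuous.
have cG : continuous G.
  by move=> x; apply/differentiable_continuous/derivable1_diffP; exact: ex_derive.
apply: (@le_trans _ _ (\int[mu]_(x in `[(- (3 / 4))%R, (3 / 4)%R]) (g x)%:E)%E).
  rewrite (@continuous_FTC2 _ g G).
  - by rewrite -EFinB lee_fin /G; lra.
  - by lra.
  - exact: continuous_subspaceT.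
  - split; first by move=> x _; exact: ex_derive.
    + by apply: cvg_at_right_filter; exact: cG.
    + by apply: cvg_at_left_filter; exact: cG.
  - by move=> x _; rewrite derive1E; exact: derive_val.
apply: ge0_le_integral => //.
- move=> x /=; rewrite in_itv/= lee_fin => /andP[h1 h2]; rewrite mulr_ge0//.
  by rewrite subr_ge0; nra.
- by apply/measurable_EFinP/measurable_funTS; exact: continuous_measurable_fun.
- exact: measurable_funTS.
- move=> x /=; rewrite in_itv/= -EFinM lee_fin /sqind => /andP[h1 h2].
  have -> : x ^+ 2 <= 9 / 16 by nra.
  rewrite mulr1 phi_le0 /g; apply: ler_pM => //; first by rewrite subr_ge0; nra.
  by have := expR_ge1Dx (- (x ^+ 2 / 2)).
Qed.

Section tail.
Variable tau : R.
Hypothesis tau0 : 0 <= tau.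
Let kap := expR (- (tau ^+ 2 / 18)).

(** Part of the Gaussian budget 1/8 is traded for the decay [kap]. Starting at [9 / 10 * tau] covers
    every band of relative width up to 1/10 around [tau]. *)
Lemma sq_tail_bound x : 9 / 10 * tau <= `|x| -> x ^+ 2 <= 40 * kap * expR (x ^+ 2 / 8).
Proof.
move=> h.
have h2 : (9 / 10 * tau) ^+ 2 <= x ^+ 2.
  by rewrite -[leRHS]real_normK ?num_real// ler_sqr ?nnegrE// mulr_ge0.
have h3 : x ^+ 2 / 40 <= expR (x ^+ 2 / 40) by have := expR_ge1Dx (x ^+ 2 / 40); lra.
have h4 : expR (x ^+ 2 / 40) <= kap * expR (x ^+ 2 / 8).
  by rewrite -expRD ler_expR; rewrite exprMn in h2; have := sqr_ge0 tau; lra.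
lra.
Qed.

Definition tailf x : R := if tau <= `|x| then x ^+ 2 else 0.
(** Dominates the change of the thresholded square when the threshold moves from [tau] to [r * tau]
    with [|r - 1| <= D]. *)
Definition bandf D x : R := if `| `|x| - tau | <= D * tau then x ^+ 2 else 0.

Lemma tailfN x : tailf (- x) = tailf x. Proof. by rewrite /tailf normrN sqrrN. Qed.
Lemma bandfN D x : bandf D (- x) = bandf D x. Proof. by rewrite /bandf normrN sqrrN. Qed.
Lemma tailf_ge0 x : 0 <= tailf x. Proof. by rewrite /tailf; case: ifP => // _; exact: sqr_ge0. Qed.
Lemma bandf_ge0 D x : 0 <= bandf D x.
Proof. by rewrite /bandf; case: ifP => // _; exact: sqr_ge0. Qed.

Let kap0 : 0 <= 40 * kap. Proof. by rewrite mulr_ge0 ?expR_ge0. Qed.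

Lemma growth_tailf : growth (40 * kap) tailf.
Proof.
split.
  apply: measurable_fun_ifT => //.
  by apply: measurable_fun_ler => //; exact: measurableT_comp.
move=> x; rewrite ger0_norm ?tailf_ge0// /tailf; case: ifPn => [h|_].
  by apply: sq_tail_bound; apply: le_trans h; move: tau0; lra.
by rewrite mulr_ge0 ?expR_ge0.
Qed.

Let band_lo D x : D <= 1 / 10 -> `| `|x| - tau | <= D * tau -> 9 / 10 * tau <= `|x|.
Proof.
move=> D1; rewrite ler_norml => /andP[h _].
have : D * tau <= 1 / 10 * tau by apply: ler_wpM2r.
by set u := `|x| in h *; lra.
Qed.

Lemma growth_bandf D : D <= 1 / 10 -> growth (40 * kap) (bandf D).
Proof.
move=> D1; split.
  apply: measurable_fun_ifT => //.
  apply: measurable_fun_ler => //; apply: measurableT_comp => //.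
  by apply: measurable_funB => //; exact: measurableT_comp.
move=> x; rewrite ger0_norm ?bandf_ge0// /bandf; case: ifPn => [h|_].
  by apply: sq_tail_bound; exact: band_lo h.
by rewrite mulr_ge0 ?expR_ge0.
Qed.

(** The band has length proportional to [D * tau]. The Gaussian density on it is small enough to pay
    for the square, for the factor [tau] and for [kap], leaving a bound linear in [D]. *)
Lemma bandf_mean D : 0 <= D <= 1 / 10 -> \int[gam]_x bandf D x <= 80 * D * kap.
Proof.
move=> /andP[D0 D1]; have gb := growth_bandf D1.
(* Restricting to one sign makes the band a single interval, as [gam_upper] requires; the other half
   has the same integral by symmetry. *)
pose h x : R := if 0 <= x then bandf D x else 0.
have gh : growth (40 * kap) h.
  split.
    by apply: measurable_fun_ifT => //; [exact: measurable_fun_ler|exact: gb.1].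
  move=> x; rewrite /h; case: ifP => _; first exact: gb.2.
  by rewrite normr0 mulr_ge0 ?expR_ge0.
have gh' : growth (40 * kap) (fun x => h (- x)).
  split; first by apply: (measurableT_comp gh.1); exact: oppr_measurable.
  by move=> x; have := gh.2 (- x); rewrite sqrrN.
have h0 x : 0 <= h x by rewrite /h; case: ifP => // _; exact: bandf_ge0.
apply: (@le_trans _ _ (\int[gam]_x (h x + h (- x)))).
  apply: le_Rintegral => //.
  - exact: growth_integrable gb.
  - apply: integrableD_EFin; [exact: growth_integrable gh|exact: growth_integrable gh'].
  - move=> x _; rewrite /h; case: ifPn => [x0|x0].
      by rewrite lerDl; case: ifP => // _; exact: bandf_ge0.
    have -> : 0 <= - x by rewrite oppr_ge0 ltW// ltNge.
    by rewrite add0r bandfN.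
rewrite RintegralD//; last 2 first.
- exact: growth_integrable gh.
- exact: growth_integrable gh'.
rewrite (Rintegral_gam_opp gh.1).
suff : \int[gam]_x h x <= 40 * D * kap by set I := Rintegral _ _ _; lra.
rewrite -lee_fin -(gam_fin (growth_integrable gh)).
have Dt : 0 <= D * tau by rewrite mulr_ge0.
have ab : tau - D * tau <= tau + D * tau by lra.
(* On the band the decay is at least [expR (- (19 / 40 * (9 / 10 * tau) ^+ 2))], which is split into
   [kap] and [expR (- (tau ^+ 2 / 4))]; the latter absorbs the factor [tau] below. *)
pose c := 20 * expR (- (tau ^+ 2 / 4)) * kap.
have c0 : 0 <= c by rewrite !mulr_ge0 ?expR_ge0.
apply: le_trans (gam_upper gh.1 h0 ab c0 _ _) _.
- move=> x xab; rewrite /h; case: ifPn => [x0|_]; last by rewrite mulr0.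
  rewrite /bandf; case: ifPn => [hb|_]; last by rewrite mulr0.
  have h1 := band_lo D1 hb.
  have h2 : (9 / 10 * tau) ^+ 2 <= x ^+ 2.
    by rewrite -[leRHS]real_normK ?num_real// ler_sqr ?nnegrE// mulr_ge0.
  have h3 : x ^+ 2 <= 40 * expR (x ^+ 2 / 40) by have := expR_ge1Dx (x ^+ 2 / 40); lra.
  have /andP[_ p0] := phi0_bounds.
  have e0 := expR_ge0 (- (x ^+ 2 / 2)).
  apply: (@le_trans _ _ (1 / 2 * expR (- (x ^+ 2 / 2)) * (40 * expR (x ^+ 2 / 40)))).
    rewrite phi_le0; apply: ler_pM => //; rewrite ?mulr_ge0 ?phi_ge0 ?sqr_ge0//.
    by apply: ler_wpM2r => //; lra.
  have -> : 1 / 2 * expR (- (x ^+ 2 / 2)) * (40 * expR (x ^+ 2 / 40)) =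
     20 * (expR (- (x ^+ 2 / 2)) * expR (x ^+ 2 / 40)) by field.
  rewrite /c -mulrA; apply: ler_wpM2l => //.
  by rewrite -!expRD ler_expR; rewrite exprMn in h2; have := sqr_ge0 tau; lra.
- move=> x nx; rewrite /h; case: ifPn => // x0; rewrite /bandf (ger0_norm x0); case: ifPn => //.
  by rewrite ler_norml => /andP[h1 h2]; case/negP : nx; apply/andP; split; lra.
- rewrite lee_fin /c.
  have t1 : tau * expR (- (tau ^+ 2 / 4)) <= 1.
    have := expR_ge1Dx (tau ^+ 2 / 4).
    have e : expR (tau ^+ 2 / 4) * expR (- (tau ^+ 2 / 4)) = 1 by rewrite -expRD subrr expR0.
    have t2 : tau <= 1 + tau ^+ 2 / 4 by have := sqr_ge0 (tau / 2 - 1); rewrite sqrrB exprMn; lra.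
    by move=> h4; rewrite -[leRHS]e; apply: ler_wpM2r; [exact: expR_ge0|exact: le_trans h4].
  have k0 : 0 <= D * kap by rewrite mulr_ge0 ?expR_ge0.
  have : D * kap * (tau * expR (- (tau ^+ 2 / 4))) <= D * kap * 1 by apply: ler_wpM2l.
  set e := expR (- (tau ^+ 2 / 4)).
  have -> : 20 * e * kap * (tau + D * tau - (tau - D * tau)) = 40 * (D * kap * (tau * e)) by ring.
  by lra.
Qed.

End tail.
End chi2.

(** * Empirical c.d.f. and dyadic scale, for a fixed noise vector *)

Section noise_estimators.
Variables (R : realType) (d : nat) (Sig : 'M[R]_d) (theta x : 'I_d -> R) (sigma : R) (s : nat).
Hypotheses (d0 : (0 < d)%N) (Sig0 : forall i, 0 < Sig i i) (sigma0 : 0 < sigma).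
Hypothesis theta_s : (l0norm theta <= s)%N.
Let dR : 0 < d%:R :> R. Proof. by rewrite ltr0n. Qed.

(** The observation as a function of an arbitrary noise vector [x]: the analysis of the estimators
    from here on is deterministic in [x], and probability returns only when [x] is replaced by
    [noise]. *)
Definition Ymodel i := theta i + sigma * (sigi Sig i * x i).
Notation Y := Ymodel.

Lemma sigi_gt0 i : 0 < sigi Sig i. Proof. by rewrite sqrtr_gt0. Qed.

Lemma sigi_sq i : sigi Sig i ^+ 2 = Sig i i.
Proof. by rewrite sqr_sqrtr// ltW. Qed.

Lemma YtilE i : Ytil Sig Y i = theta i / sigi Sig i + sigma * x i.
Proof. by rewrite /Ytil /Y; field; rewrite gt_eqF// sigi_gt0. Qed.

Lemma Ytil_off i : theta i = 0 -> Ytil Sig Y i = sigma * x i.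
Proof. by rewrite YtilE => ->; rewrite mul0r add0r. Qed.

Lemma card_setE (P : pred 'I_d) : #|[set i | P i]|%:R = \sum_i (P i)%:R :> R.
Proof.
rewrite -sum1_card natr_sum big_mkcond/=; apply: eq_bigr => i _.
by rewrite unfold_in/= /in_set asboolb; case: (P i).
Qed.

Lemma FhatE t : Fhat Sig Y t = (\sum_i sqind t (Ytil Sig Y i)) / d%:R.
Proof.
rewrite /Fhat card_setE; congr (_ / _); apply: eq_bigr => i _.
by rewrite /sqind; case: ifP.
Qed.

Lemma support_card : \sum_i (theta i != 0)%:R <= s%:R :> R.
Proof. by rewrite -card_setE ler_nat. Qed.

Definition noise_cdf y : R := (\sum_i sqind y (x i)) / d%:R.

(** Only the indices in the support of [theta] can change an indicator, and there are at most [s] of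
    them. *)
Lemma Fhat_noise_cdf y : `|Fhat Sig Y (sigma ^+ 2 * y) - noise_cdf y| <= s%:R / d%:R.
Proof.
rewrite FhatE -mulrBl normrM [X in _ * X]gtr0_norm ?invr_gt0//.
apply: ler_wpM2r; first by rewrite invr_ge0 ltW.
rewrite -sumrB; apply: le_trans (ler_norm_sum _ _ _) _; apply: le_trans support_card.
apply: ler_sum => i _; have [t0|t0] := eqVneq (theta i) 0.
  by rewrite Ytil_off// /sqind exprMn ler_pM2l ?exprn_gt0// subrr normr0.
by rewrite /sqind; case: ifP; case: ifP => _ _; rewrite ?subrr ?subr0 ?sub0r ?normrN ?normr0 ?normr1.
Qed.

Lemma Fhat_le t t' : t <= t' -> Fhat Sig Y t <= Fhat Sig Y t'.
Proof.
move=> tt; rewrite !FhatE ler_pM2r ?invr_gt0//; apply: ler_sum => i _; exact: sqind_le.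
Qed.

Notation that := (that Sig Y).
Let L := [set l : int | 2^-1 <= Fhat Sig Y ((2 : R) ^ l)].

Let pow_gt0 (l : int) : 0 < (2 : R) ^ l. Proof. by rewrite exprz_gt0. Qed.

Let pow_le (l m : int) : ((2 : R) ^ l <= 2 ^ m) = (l <= m).
Proof. by rewrite ler_eXz2l// ltr1n. Qed.

Let powS (l : int) : (2 : R) ^ (l + 1) = 2 * 2 ^ l.
Proof. by rewrite exprzDr; [rewrite expr1z mulrC|rewrite unitfE pnatr_eq0]. Qed.

(** Provides the power of two whose ratio to [sigma ^+ 2] falls in a prescribed window of ratio
    2. *)
Lemma pow2_exists (t : R) : 0 < t -> exists l : int, t < 2 ^ l <= 2 * t.
Proof.
move=> t0.
have e (l : int) : (2 : R) ^ l = expR (l%:~R * ln 2).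
  have l2 : expR (ln 2) = 2 :> R by rewrite lnK// posrE.
  case: l => n; first by rewrite -exprnP -{1}l2 -expRM_natl.
  by rewrite NegzE -exprnN -{1}l2 -expRM_natl -expRN mulrNz mulNr.
have ln2 : 0 < ln 2 :> R by rewrite ln_gt0// ltr1n.
exists (Num.floor (ln t / ln 2) + 1); rewrite powS.
have /andP[h1 h2] := floor_itv (ln t / ln 2).
have tE : t = expR (ln t) by rewrite lnK.
apply/andP; split.
  by rewrite -powS e {1}tE ltr_expR -ltr_pdivrMr.
by rewrite ler_pM2l// e {2}tE ler_expR -ler_pdivlMr.
Qed.

Let L_ne : exists l, L l.
Proof.
pose M := 1 + \sum_i Ytil Sig Y i ^+ 2.
have M0 : 0 < M by rewrite ltr_pwDl// sumr_ge0// => i _; exact: sqr_ge0.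
have [l /andP[h _]] := pow2_exists M0; exists l; rewrite /L/= FhatE.
have -> : \sum_i sqind (2 ^ l) (Ytil Sig Y i) = d%:R.
  rewrite -[in RHS](card_ord d) -sum1_card natr_sum; apply: eq_bigr => i _; rewrite /sqind ifT//.
  apply: le_trans (ltW h); rewrite /M (bigD1 i)//= addrCA lerDl addr_ge0// sumr_ge0// => j _.
  exact: sqr_ge0.
by rewrite divff ?gt_eqF//; lra.
Qed.

Let B := [set (2 : R) ^ l | l in L].

Let lbB : has_inf B.
Proof.
split; first by have [l Ll] := L_ne; exists (2 ^ l); exists l.
by exists 0 => _ [l _ <-]; exact: ltW.
Qed.

Lemma that_ge0 : 0 <= that.
Proof. by apply: lb_le_inf; [exact: lbB.1|move=> _ [l _ <-]; exact: ltW]. Qed.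

Lemma that_eq l : 2^-1 <= Fhat Sig Y (2 ^ l) -> Fhat Sig Y (2 ^ l / 2) < 2^-1 -> that = 2 ^ l.
Proof.
move=> h1 h2; apply/eqP; rewrite eq_le; apply/andP; split.
  by apply: ge_inf; [exact: lbB.2|exists l].
apply: lb_le_inf; first exact: lbB.1.
move=> _ [m Lm <-]; rewrite leNgt; apply/negP => ml.
have : Fhat Sig Y (2 ^ m) <= Fhat Sig Y (2 ^ l / 2).
  apply: Fhat_le; rewrite ler_pdivlMr// mulrC -powS pow_le.
  by move: ml; rewrite ltNge pow_le -ltNge lezD1.
by move=> /le_lt_trans/(_ h2); rewrite ltNge Lm.
Qed.

(** The infimum can be 0, for instance when at least half of the observations vanish; otherwise the
    discreteness of powers of two makes it a minimum, and half of it fails the defining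
    condition. *)
Lemma that_attained : 0 < that -> exists l, [/\ that = 2 ^ l,
  2^-1 <= Fhat Sig Y that & Fhat Sig Y (that / 2) < 2^-1].
Proof.
move=> t0.
(* Some admissible power lies below twice the infimum, and any smaller admissible power would be at
   most half of it. *)
have [_ [l Ll <-] h] : exists2 b, B b & b < that + that.
  by apply: inf_adherent.
have tE : that = 2 ^ l.
  apply/eqP; rewrite eq_le; apply/andP; split.
    by apply: ge_inf; [exact: lbB.2|exists l].
  apply: lb_le_inf; first exact: lbB.1.
  move=> b Bb; have tb : that <= b by apply: ge_inf; [exact: lbB.2|].
  case: Bb tb => m Lm <- tb; rewrite pow_le leNgt -lezD1; apply/negP.
  by rewrite -pow_le powS => h2; lra.
exists l; split => //; first by rewrite tE.
rewrite ltNge; apply/negP => h2.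
have e : (2 : R) ^ (l - 1) = that / 2.
  by rewrite tE -{2}(subrK 1 l) powS; field.
have : that <= 2 ^ (l - 1).
  apply: ge_inf; first exact: lbB.2.
  by exists (l - 1) => //=; rewrite e.
by rewrite e; lra.
Qed.

End noise_estimators.

(** * The preliminary variance estimator, on every outcome and on the good event *)

Section noise_bounds.
Variables (R : realType) (d : nat) (Sig : 'M[R]_d) (theta x : 'I_d -> R) (sigma : R) (s : nat).
Hypotheses (d0 : (0 < d)%N) (Sig0 : forall i, 0 < Sig i i) (sigma0 : 0 < sigma).
Hypothesis theta_s : (l0norm theta <= s)%N.
Let dR : 0 < d%:R :> R. Proof. by rewrite ltr0n. Qed.
Let Y := Ymodel Sig theta x sigma.
Notation Fh := (Fhat Sig Y).
Notation that := (that Sig Y).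
Notation Fo := (noise_cdf x).
Let FhFo y : `|Fh (sigma ^+ 2 * y) - Fo y| <= s%:R / d%:R.
Proof. exact: Fhat_noise_cdf. Qed.

Let tge0 : 0 <= that. Proof. exact: that_ge0. Qed.
Let tatt : 0 < that -> exists l, [/\ that = 2 ^ l, 2^-1 <= Fh that & Fh (that / 2) < 2^-1].
Proof. exact: that_attained. Qed.

(** The level is at least 1/2 at [that], so the denominator of [sigS2] stays away from 0. *)
Lemma chi2quant_ge (p : R) : 2^-1 <= p -> ((9 / 32)%:E <= chi2quant p)%E.
Proof.
move=> hp; apply: le_ereal_inf_tmp => _ [y [y0 py] <-]; rewrite lee_fin leNgt; apply/negP => h.
have := chi2cdf_le (ltW h); have := @chi2cdf_932 R; lra.
Qed.

(** Holds on every outcome, as the bad event requires. If [that = 0], each branch of [sigS2_at] is 0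
    or [+oo], and [fine] sends both to 0. *)
Lemma sigS2_bounds : 0 <= sigS2 Sig Y <= 4 * that.
Proof.
have t0 := tge0.
move: (t0); rewrite le_eqVlt => /predU1P[e|tp].
  rewrite /sigS2 /sigS2_at -e mulr0; case: ifP => _ /=; last by rewrite lexx.
  by case: chi2quant => [q||] /=; rewrite ?mul0r lexx.
have [l [_ h1 _]] := tatt tp.
rewrite /sigS2 /sigS2_at (_ : 0 < Fh that); last by apply: lt_le_trans h1; lra.
have := chi2quant_ge h1; case: chi2quant => [q||] //=.
  rewrite lee_fin => hq; have q0 : 0 < q by lra.
  apply/andP; split; first by apply: divr_ge0; exact: ltW.
  rewrite ler_pdivrMr//.
  have : that * (9 / 32) <= that * q by rewrite ler_pM2l.
  by lra.
by move=> _; rewrite lexx/= mulr_ge0.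
Qed.

(** Chebyshev's inequality for the empirical measure: fewer than half of the normalized observations
    have square at most [that / 2], so at least a quarter of the [x i ^+ 2] exceed
    [that / (2 * sigma ^+ 2)]. *)
Lemma that_le_mean_sq : s%:R / d%:R <= 1 / 4 :> R ->
  that <= 8 * sigma ^+ 2 * ((\sum_i x i ^+ 2) / d%:R).
Proof.
move=> s4; have s2 : 0 < sigma ^+ 2 by rewrite exprn_gt0.
have S0 : 0 <= (\sum_i x i ^+ 2) / d%:R.
  by rewrite divr_ge0 ?ler0n// sumr_ge0// => i _; exact: sqr_ge0.
have := tge0.
rewrite le_eqVlt => /predU1P[<-|tp]; first by apply: mulr_ge0 => //; apply: mulr_ge0 => //; exact: ltW.
have [l [_ _ h2]] := tatt tp.
pose y := that / (2 * sigma ^+ 2).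
have yp : 0 < y by rewrite divr_gt0// mulr_gt0.
have e : that / 2 = sigma ^+ 2 * y by rewrite /y; field; rewrite gt_eqF.
have := FhFo y; rewrite -e ler_norml => /andP[h3 _].
have h4 : Fo y <= 3 / 4 by lra.
have h5 : y * (1 - Fo y) <= (\sum_i x i ^+ 2) / d%:R.
  rewrite ler_pdivlMr// -mulrA mulrBl mul1r /noise_cdf divfK ?gt_eqF//.
  have -> : d%:R - \sum_i sqind y (x i) = \sum_i (1 - sqind y (x i)) :> R.
    by rewrite sumrB sumr_const card_ord.
  rewrite mulr_sumr; apply: ler_sum => i _; rewrite /sqind; case: ifPn => h.
    by rewrite subrr mulr0 sqr_ge0.
  by rewrite subr0 mulr1 ltW// ltNge.
have : y * (1 / 4) <= y * (1 - Fo y) by rewrite ler_pM2l//; lra.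
have -> : that = 2 * sigma ^+ 2 * y by rewrite /y; field; rewrite gt_eqF.
move=> h6; have h7 : y / 4 <= (\sum_i x i ^+ 2) / d%:R by lra.
have : sigma ^+ 2 * (y / 4) <= sigma ^+ 2 * ((\sum_i x i ^+ 2) / d%:R) by rewrite ler_pM2l.
by lra.
Qed.

Section good_event.
Variable l0 : int.
Let y0 := 2 ^ l0 / sigma ^+ 2.
Hypothesis y0_bounds : 9 / 32 < y0 <= 9 / 16.
Let c0 : R := phi 2 / 4.

Definition dev y : R := Fo y - chi2cdf y.
(** Three points are needed: at [y0 / 2] the level must stay below 1/2, at [2 * y0] it must exceed
    1/2, and at [y0], where either can happen, the quantile must still be accurate. *)
Definition Delta : R := s%:R / d%:R + (`|dev (y0 / 2)| + `|dev y0| + `|dev (2 * y0)|).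

Hypothesis good : Delta <= c0 / 40.

Let c0_gt0 : 0 < c0. Proof. by rewrite divr_gt0// phi_gt0. Qed.

Let c0_le : c0 <= 1 / 9.
Proof.
have /andP[_ h] := phi0_bounds R.
have : phi 2 <= phi (0 : R).
  by rewrite (phi_le0 2) ler_piMr ?phi_ge0// -[leRHS]expR0 ler_expR; lra.
by rewrite /c0; lra.
Qed.

Let s2 : 0 < sigma ^+ 2. Proof. by rewrite exprn_gt0. Qed.
Let pE : 2 ^ l0 = sigma ^+ 2 * y0 :> R. Proof. by rewrite /y0; field; rewrite gt_eqF. Qed.
Let pE1 : 2 ^ (l0 + 1) = sigma ^+ 2 * (2 * y0) :> R.
Proof. by rewrite exprzDr ?unitfE ?pnatr_eq0// expr1z pE; ring. Qed.

Let sd0 : 0 <= s%:R / d%:R :> R. Proof. by rewrite divr_ge0 ?ler0n. Qed.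

Let close y : y \in [:: y0 / 2; y0; 2 * y0] -> `|Fh (sigma ^+ 2 * y) - chi2cdf y| <= Delta.
Proof.
have h y' : `|Fh (sigma ^+ 2 * y') - chi2cdf y'| <= s%:R / d%:R + `|dev y'|.
  have -> : Fh (sigma ^+ 2 * y') - chi2cdf y' = (Fh (sigma ^+ 2 * y') - Fo y') + dev y'.
    by rewrite /dev; ring.
  by apply: le_trans (ler_normD _ _) _; rewrite lerD2r.
rewrite !inE => /or3P[] /eqP ->; apply: le_trans (h _) _; rewrite /Delta lerD2l.
- by rewrite -addrA lerDl addr_ge0.
- by rewrite addrAC lerDr addr_ge0.
- by rewrite lerDr addr_ge0.
Qed.

(** [chi2cdf] is at most 23/50 at [y0 / 2] and at least 13/25 at [2 * y0]; both margins to 1/2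
    exceed the allowed deviation. *)
Lemma that_good : that = sigma ^+ 2 * y0 \/ that = sigma ^+ 2 * (2 * y0).
Proof.
have /andP[yl yu] := y0_bounds; have cl := c0_le; have gd := good.
have lo : Fh (sigma ^+ 2 * (y0 / 2)) < 2^-1.
  have : `|Fh (sigma ^+ 2 * (y0 / 2)) - chi2cdf (y0 / 2)| <= Delta by apply: close; rewrite !inE eqxx.
  rewrite ler_norml => /andP[_ h]; have := @chi2cdf_932 R.
  have : chi2cdf (y0 / 2) <= chi2cdf (9 / 32) by apply: chi2cdf_le; lra.
  by lra.
have hi : 2^-1 <= Fh (sigma ^+ 2 * (2 * y0)).
  have : `|Fh (sigma ^+ 2 * (2 * y0)) - chi2cdf (2 * y0)| <= Delta by apply: close; rewrite !inE eqxx !orbT.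
  rewrite ler_norml => /andP[h _]; have := @chi2cdf_916 R.
  have : chi2cdf (9 / 16) <= chi2cdf (2 * y0) by apply: chi2cdf_le; lra.
  by lra.
have [h|h] := leP 2^-1 (Fh (sigma ^+ 2 * y0)).
  left; rewrite -pE; apply: that_eq => //; rewrite pE//.
  by have -> : sigma ^+ 2 * y0 / 2 = sigma ^+ 2 * (y0 / 2) by field.
right; rewrite -pE1; apply: that_eq => //; rewrite pE1//.
by have -> : sigma ^+ 2 * (2 * y0) / 2 = sigma ^+ 2 * y0 by field.
Qed.

(** The slope bound turns an error [Delta] in the level into an error at most [Delta / c0] in the
    quantile, which is itself at least 1/4; hence the factor 4. *)
Let sigS2_at_good y : y \in [:: y0; 2 * y0] -> that = sigma ^+ 2 * y ->
  `|sigS2 Sig Y / sigma ^+ 2 - 1| <= 4 / c0 * Delta.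
Proof.
move=> yin tE; have /andP[yl yu] := y0_bounds.
have yb : 9 / 32 <= y <= 9 / 8.
  by move: yin; rewrite !inE => /orP[] /eqP ->; apply/andP; split; lra.
have /andP[ylo yhi] := yb.
have hp : `|Fh that - chi2cdf y| <= Delta.
  by rewrite tE; apply: close; move: yin; rewrite !inE => ->; rewrite orbT.
have D0 : 0 <= Delta by exact: le_trans hp.
pose h := Delta / c0.
have h0 : 0 <= h by rewrite divr_ge0// ltW.
have hle : h <= 1 / 40 by rewrite ler_pdivrMr//; move: good; lra.
have ch : c0 * h = Delta by rewrite /h; field; rewrite gt_eqF.
have tp : 0 < that by rewrite tE mulr_gt0//; lra.
have [l [_ h1 _]] := tatt tp.
move: hp; rewrite ler_norml => /andP[p1 p2].
have qlo : ((y - h)%:E <= chi2quant (Fh that))%E.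
  apply: le_ereal_inf_tmp => _ [v [v0 pv] <-]; rewrite lee_fin.
  have [vy|] := leP v y; last by lra.
  have y4 : y <= 4 by lra.
  have := chi2cdf_slope v0 vy y4; rewrite -/c0 => sl.
  have : c0 * (y - v) <= c0 * h by rewrite ch; lra.
  by rewrite ler_pM2l//; lra.
have qhi : (chi2quant (Fh that) <= (y + h)%:E)%E.
  apply: ereal_inf_lbound; exists (y + h) => //; split; first by lra.
  have yy0 : 0 <= y by lra.
  have yh : y <= y + h by lra.
  have yh4 : y + h <= 4 by lra.
  have := chi2cdf_slope yy0 yh yh4; have -> : y + h - y = h by ring.
  by rewrite -/c0 ch => sl; lra.
rewrite /sigS2 /sigS2_at (_ : 0 < Fh that); last by apply: lt_le_trans h1; lra.
move: qlo qhi; case: chi2quant => [q||] //=; rewrite !lee_fin => qlo qhi.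
have q0 : 1 / 4 <= q by lra.
have qn : q != 0 by rewrite gt_eqF//; lra.
have -> : that / q / sigma ^+ 2 - 1 = (y - q) / q.
  by rewrite tE; field; rewrite qn gt_eqF.
rewrite normrM normfV [`|q|]gtr0_norm; last by lra.
rewrite ler_pdivrMr; last by lra.
have : `|y - q| <= h by rewrite ler_norml; apply/andP; split; lra.
have -> : 4 / c0 * Delta = 4 * h by rewrite /h; field; rewrite gt_eqF.
move=> hh; apply: le_trans hh _; nra.
Qed.

Lemma sigS2_good : `|sigS2 Sig Y / sigma ^+ 2 - 1| <= 4 / c0 * Delta.
Proof.
by case: that_good => tE; apply: sigS2_at_good tE; rewrite !inE eqxx ?orbT.
Qed.

(** The 40 in the definition of the good event is chosen for this 1/10, the largest relative width
    the band estimates allow. *)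
Lemma sigS2_good10 : `|sigS2 Sig Y / sigma ^+ 2 - 1| <= 1 / 10.
Proof.
apply: le_trans sigS2_good _.
have -> : 1 / 10 = 4 / c0 * (c0 / 40) by field; rewrite gt_eqF.
by apply: ler_wpM2l => //; rewrite divr_ge0// ltW.
Qed.

End good_event.
End noise_bounds.

(** * Elementary inequalities *)

Section elementary.
Variable R : realType.
Implicit Types (a b c n u v D : R).

Lemma sum_CS (I : finType) (P : pred I) (f g : I -> R) :
  (\sum_(i | P i) f i * g i) ^+ 2 <= (\sum_(i | P i) f i ^+ 2) * (\sum_(i | P i) g i ^+ 2).
Proof.
have h : 0 <= \sum_(i | P i) \sum_(j | P j) (f i * g j - f j * g i) ^+ 2.
  by apply: sumr_ge0 => i _; apply: sumr_ge0 => j _; exact: sqr_ge0.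
have e : \sum_(i | P i) \sum_(j | P j) (f i * g j - f j * g i) ^+ 2 =
   2 * ((\sum_(i | P i) f i ^+ 2) * (\sum_(i | P i) g i ^+ 2)) - 2 * (\sum_(i | P i) f i * g i) ^+ 2.
  transitivity (\sum_(i | P i) \sum_(j | P j)
     (f i ^+ 2 * g j ^+ 2 + g i ^+ 2 * f j ^+ 2 - 2 * ((f i * g i) * (f j * g j)))).
    by apply: eq_bigr => i _; apply: eq_bigr => j _; ring.
  under eq_bigr => i _ do rewrite sumrB big_split/= -!mulr_sumr.
  rewrite sumrB big_split/= -!mulr_suml -mulr_sumr -mulr_suml -expr2.
  by ring.
by move: h; rewrite e; lra.
Qed.

Lemma sqrt_norm_diff a b : (Num.sqrt `|a| - Num.sqrt `|b|) ^+ 2 <= `|a - b|.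
Proof.
wlog ab : a b / `|b| <= `|a|.
  move=> H; have [/H//|/ltW/H] := leP `|b| `|a|.
  by rewrite -opprB sqrrN (distrC a).
have sa : Num.sqrt `|a| ^+ 2 = `|a| by rewrite sqr_sqrtr.
have sb : Num.sqrt `|b| ^+ 2 = `|b| by rewrite sqr_sqrtr.
have qp : Num.sqrt `|b| <= Num.sqrt `|a| by exact: ler_wsqrtr.
have q0 := sqrtr_ge0 `|b|; apply: le_trans (lerB_dist a b).
set p := Num.sqrt `|a| in sa qp *; set q := Num.sqrt `|b| in sb qp q0 *.
rewrite -sa -sb.
have -> : p ^+ 2 - q ^+ 2 = (p - q) ^+ 2 + 2 * (q * (p - q)) by ring.
by rewrite lerDl !mulr_ge0// subr_ge0.
Qed.

Lemma l2_diff (I : finType) (P : pred I) (f g : I -> R) :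
  (Num.sqrt (\sum_(i | P i) f i ^+ 2) - Num.sqrt (\sum_(i | P i) g i ^+ 2)) ^+ 2 <=
  \sum_(i | P i) (f i - g i) ^+ 2.
Proof.
have F0 : 0 <= \sum_(i | P i) f i ^+ 2 by apply: sumr_ge0 => i _; exact: sqr_ge0.
have G0 : 0 <= \sum_(i | P i) g i ^+ 2 by apply: sumr_ge0 => i _; exact: sqr_ge0.
have -> : \sum_(i | P i) (f i - g i) ^+ 2 =
   \sum_(i | P i) f i ^+ 2 + \sum_(i | P i) g i ^+ 2 - 2 * \sum_(i | P i) f i * g i.
  by rewrite mulr_sumr -big_split/= -sumrB; apply: eq_bigr => i _; ring.
have cs := sum_CS P f g.
have : \sum_(i | P i) f i * g i <= Num.sqrt (\sum_(i | P i) f i ^+ 2) * Num.sqrt (\sum_(i | P i) g i ^+ 2).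
  apply: le_trans (ler_norm _) _; rewrite -sqrtrM// -sqrtr_sqr; exact: ler_wsqrtr.
by rewrite sqrrB !sqr_sqrtr//; lra.
Qed.

Lemma ln_near1 D v : `|v - 1| <= D -> D <= 1 / 2 -> `|ln v| <= 2 * D.
Proof.
move=> h D2; have D0 : 0 <= D by exact: le_trans h.
move: h; rewrite ler_norml => /andP[h1 h2].
have v0 : 0 < v by lra.
have ub : ln v <= v - 1.
  by rewrite -ler_expR lnK ?posrE//; have := expR_ge1Dx (v - 1); lra.
have lb : - (2 * D) <= ln v.
  have iv : v^-1 <= 1 + 2 * D.
    rewrite -[leLHS]mul1r ler_pdivrMr//.
    have : (1 + 2 * D) * (1 - D) <= (1 + 2 * D) * v by apply: ler_wpM2l; lra.
    by apply: le_trans; nra.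
  have : ln v^-1 <= v^-1 - 1.
    by rewrite -ler_expR lnK ?posrE ?invr_gt0//; have := expR_ge1Dx (v^-1 - 1); lra.
  by rewrite lnV ?posrE//; lra.
by rewrite ler_norml; apply/andP; split; lra.
Qed.

(** Truncating from above at a level that exceeds the target cannot move an estimate away from the
    target. *)
Lemma min_near a b c : c <= b -> `|Num.min a b - c| <= `|a - c|.
Proof.
move=> cb; rewrite /Num.min; case: ltP => // ba.
by rewrite !ger0_norm ?lerB//; lra.
Qed.

End elementary.

(** * Dense zone: deterministic decomposition of the loss *)

Section dense.
Variables (R : realType) (d : nat) (Sig : 'M[R]_d) (theta x : 'I_d -> R) (sigma : R) (s : nat).
Hypotheses (d0 : (0 < d)%N) (Sig0 : forall i, 0 < Sig i i) (sigma0 : 0 < sigma).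
Hypothesis Sig1 : forall i, Sig i i <= 1.
Hypothesis theta_s : (l0norm theta <= s)%N.
Let dR : 0 < d%:R :> R. Proof. by rewrite ltr0n. Qed.
Let Y := Ymodel Sig theta x sigma.
Let s2 : 0 < sigma ^+ 2. Proof. by rewrite exprn_gt0. Qed.

Lemma sumSig_le : \sum_i Sig i i <= d%:R.
Proof.
rewrite -[d in leRHS](card_ord d) -sum1_card natr_sum; apply: ler_sum => i _; exact: Sig1.
Qed.

Lemma sumSig_ge0 : 0 <= \sum_i Sig i i.
Proof. by apply: sumr_ge0 => i _; exact: ltW. Qed.

Definition Vsum := \sum_i Sig i i * (x i ^+ 2 - 1).
Definition Lsum := \sum_i theta i * (sigi Sig i * x i).
Definition Usum := \sum_i 1 * (x i ^+ 2 - 1).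

Lemma sum_sq_Usum : \sum_i x i ^+ 2 = d%:R + Usum.
Proof.
have -> : Usum = \sum_i x i ^+ 2 - \sum_(i < d) 1.
  by rewrite -sumrB; apply: eq_bigr => i _; rewrite mul1r.
by rewrite sumr_const card_ord; ring.
Qed.

(** [Q] is the squared norm [N] plus a term [A] linear in [theta] plus a remainder [B]. The
    remainder enters through [|B|]; the linear term is compared before taking roots, which replaces
    [|A|] by [A ^+ 2 / N] and removes the dependence on the size of [theta]. *)
Lemma dense_err : ~~ (s%:R <= frob Sig) ->
  (Nstar Sig s Y - l2norm theta) ^+ 2 <=
  8 * sigma ^+ 2 * (Lsum ^+ 2 / (\sum_i theta i ^+ 2)) + 2 * sigma ^+ 2 * `|Vsum|
   + 2 * (d%:R * `|sigma ^+ 2 - sigD2 Sig s Y|).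
Proof.
move=> ns; rewrite /Nstar /Qstar (negbTE ns).
set Q := \sum_(i < d) _; set N := \sum_i theta i ^+ 2.
have N0 : 0 <= N by apply: sumr_ge0 => i _; exact: sqr_ge0.
pose A := 2 * sigma * Lsum.
pose B := sigma ^+ 2 * Vsum + (sigma ^+ 2 - sigD2 Sig s Y) * \sum_i Sig i i.
have QE : Q = N + A + B.
  rewrite /Q /A /B /N /Lsum /Vsum !mulr_sumr -!big_split/=; apply: eq_bigr => i _.
  rewrite /Y /Ymodel -(sigi_sq Sig0); ring.
have nE : l2norm theta = Num.sqrt `|N| by rewrite ger0_norm.
have h1 : (Num.sqrt `|Q| - Num.sqrt `|N + A|) ^+ 2 <= `|B|.
  by apply: le_trans (sqrt_norm_diff _ _) _; rewrite QE (addrC (N + A)) addrK.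
have h2 : (Num.sqrt `|N + A| - Num.sqrt `|N|) ^+ 2 <= 4 * sigma ^+ 2 * (Lsum ^+ 2 / N).
  (* For [theta = 0] the quotient [Lsum ^+ 2 / N] is 0 by the convention on division, and the linear
     term vanishes as well. *)
  have [N00|Nn] := eqVneq N 0.
    have L0 : Lsum = 0.
      rewrite /Lsum big1// => i _.
      have /psumr_eq0P : \sum_i theta i ^+ 2 = 0 by exact: N00.
      move=> /(_ (fun i _ => sqr_ge0 _) i isT) /eqP; rewrite sqrf_eq0 => /eqP ->.
      by rewrite mul0r.
    by rewrite /A L0 mulr0 addr0 subrr !expr0n/= mul0r mulr0.
  have Np : 0 < N by rewrite lt_neqAle eq_sym Nn N0.
  have AN : A ^+ 2 / N = 4 * sigma ^+ 2 * (Lsum ^+ 2 / N) by rewrite /A; field.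
  rewrite -AN ler_pdivlMr//.
  have n2 : Num.sqrt `|N| ^+ 2 = N by rewrite sqr_sqrtr// ger0_norm.
  rewrite -[X in _ * X <= _]n2.
  have m2 : Num.sqrt `|N + A| ^+ 2 = `|N + A| by rewrite sqr_sqrtr.
  have h : `| Num.sqrt `|N + A| ^+ 2 - Num.sqrt `|N| ^+ 2 | <= `|A|.
    rewrite m2 n2 -[X in `|_ - X|](ger0_norm N0); apply: le_trans (ler_dist_dist _ _) _.
    by rewrite addrC addKr.
  set p := Num.sqrt `|N + A| in h *; set q := Num.sqrt `|N| in h *.
  have p0 : 0 <= p by exact: sqrtr_ge0.
  have q0 : 0 <= q by exact: sqrtr_ge0.
  rewrite -exprMn -real_normK ?num_real// -[leRHS]real_normK ?num_real// ler_sqr ?nnegrE//.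
  apply: le_trans h; rewrite normrM (_ : p ^+ 2 - q ^+ 2 = (p - q) * (p + q)); last by ring.
  rewrite normrM; apply: ler_wpM2l => //.
  by rewrite !ger0_norm ?addr_ge0// lerDr.
have h3 : `|B| <= sigma ^+ 2 * `|Vsum| + d%:R * `|sigma ^+ 2 - sigD2 Sig s Y|.
  apply: le_trans (ler_normD _ _) _; rewrite normrM (gtr0_norm s2) lerD2l normrM mulrC.
  by apply: ler_wpM2r => //; rewrite ger0_norm ?sumSig_ge0// sumSig_le.
rewrite nE; move: h1 h2 h3.
set p := Num.sqrt `|Q|; set q := Num.sqrt `|N + A|; set r := Num.sqrt `|N|.
set b := `|B|; set l := Lsum ^+ 2 / N; set v := `|Vsum|; set e := `|_ - _| => h1 h2 h3.
have : (p - r) ^+ 2 <= 2 * (p - q) ^+ 2 + 2 * (q - r) ^+ 2.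
  by have := sqr_ge0 ((p - q) - (q - r)); nra.
by lra.
Qed.

End dense.

(** * Variance estimator from the empirical characteristic function *)

Section sigD.
Variables (R : realType) (d : nat) (Sig : 'M[R]_d) (theta x : 'I_d -> R) (sigma : R) (s : nat).
Hypotheses (d0 : (0 < d)%N) (Sig0 : forall i, 0 < Sig i i) (sigma0 : 0 < sigma).
Hypothesis theta_s : (l0norm theta <= s)%N.
Let dR : 0 < d%:R :> R. Proof. by rewrite ltr0n. Qed.
Let Y := Ymodel Sig theta x sigma.
Let s2 : 0 < sigma ^+ 2. Proof. by rewrite exprn_gt0. Qed.
Notation that := (that Sig Y).
Notation lam := (lam Sig s).

Lemma lam_ge : 1 / 6 <= lam.
Proof. by rewrite /Defs.lam ler_pM2r ?invr_gt0// le_max lexx. Qed.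

Let lam0 : 0 < lam. Proof. by have := lam_ge; lra. Qed.

Let tge0 : 0 <= that. Proof. exact: that_ge0. Qed.

Let tl0 : 0 <= 2 * that / lam.
Proof. by apply: divr_ge0; [apply: mulr_ge0 => //; exact: tge0|exact/ltW/lam0]. Qed.

Lemma phihat_le1 u : `|phihat Sig Y u| <= 1.
Proof.
rewrite /phihat normrM normfV [`|d%:R|]gtr0_norm// ler_pdivrMl// mulr1.
apply: le_trans (ler_norm_sum _ _ _) _.
rewrite -[d in leRHS](card_ord d) -sum1_card natr_sum; apply: ler_sum => i _; exact: cos_max.
Qed.

Lemma sigD2_bounds : 0 <= sigD2 Sig s Y <= 2 * sigS2 Sig Y.
Proof.
have /andP[S0 _] : 0 <= sigS2 Sig Y <= 4 * that by apply: sigS2_bounds.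
rewrite /sigD2; case: ifPn => [_|_]; first by rewrite mulr_ge0//=.
apply/andP; split; last by rewrite ge_min lexx orbT.
rewrite le_min; apply/andP; split; last by rewrite mulr_ge0.
rewrite /sigD2til mulNr -mulrN; apply: mulr_ge0.
  exact: tl0.
by rewrite oppr_ge0 ln_le0// phihat_le1.
Qed.

Definition av y := Num.sqrt (lam / y).
Definition bshift y i := av y / sigma * (theta i / sigi Sig i).
(** The cosine of a shifted noise term splits into an even function of [x i], centred here by the
    Gaussian characteristic function, and an odd one. The odd sum [Nod] only receives contributions
    from the support of [theta]. *)
Definition Nev y := \sum_i cos (bshift y i) * (cos (av y * x i) - expR (- (av y ^+ 2 / 2))).
Definition Nod y := \sum_i sin (bshift y i) * sin (av y * x i).
Definition nu y := (`|Nev y| + `|Nod y|) / (d%:R * expR (- (av y ^+ 2 / 2))).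

Lemma nu_ge0 y : 0 <= nu y.
Proof. by rewrite divr_ge0 ?addr_ge0// mulr_ge0 ?expR_ge0 ?ler0n. Qed.

(** After division by the Gaussian value, the bias comes from the cosines of the shifts, each off by
    at most 2 and only on the support; the rest is the relative noise [nu]. *)
Lemma phihat_near y : 0 < y ->
  `|phihat Sig Y (Num.sqrt (lam / (sigma ^+ 2 * y))) / expR (- (av y ^+ 2 / 2)) - 1|
    <= 2 * (s%:R / d%:R) + nu y.
Proof.
move=> y0; have l0 := lam0; set f := expR _; have f0 : 0 < f by exact: expR_gt0.
have uE : Num.sqrt (lam / (sigma ^+ 2 * y)) = av y / sigma.
  have -> : lam / (sigma ^+ 2 * y) = lam / y * (sigma ^+ 2)^-1 by field; rewrite !gt_eqF.
  rewrite sqrtrM; last by rewrite divr_ge0// ltW.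
  by rewrite sqrtrV ?ltW// sqrtr_sqr gtr0_norm.
rewrite uE /phihat.
have e : \sum_i cos (av y / sigma * Ytil Sig Y i) =
    d%:R * f + f * \sum_i (cos (bshift y i) - 1) + (Nev y - Nod y).
  have -> : d%:R * f = \sum_(i < d) f by rewrite sumr_const card_ord mulr_natl.
  rewrite mulr_sumr /Nev /Nod -sumrB -!big_split/=; apply: eq_bigr => i _.
  rewrite (YtilE _ _ _ Sig0) mulrDr -/(bshift y i).
  have -> : av y / sigma * (sigma * x i) = av y * x i by field; rewrite gt_eqF.
  by rewrite cosD -/f; ring.
have -> : d%:R^-1 * (\sum_i cos (av y / sigma * Ytil Sig Y i)) / f - 1 =
   d%:R^-1 * (\sum_i (cos (bshift y i) - 1)) + (Nev y - Nod y) / (d%:R * f).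
  by rewrite e; field; rewrite !gt_eqF.
apply: le_trans (ler_normD _ _) _; apply: lerD.
  rewrite normrM gtr0_norm ?invr_gt0// mulrC mulrA ler_pM2r ?invr_gt0//.
  apply: le_trans (ler_norm_sum _ _ _) _.
  apply: le_trans (_ : \sum_i 2 * (theta i != 0)%:R <= _); last first.
    by rewrite -mulr_sumr ler_pM2l//; exact: support_card.
  apply: ler_sum => i _; have [t0|t0] := eqVneq (theta i) 0.
    by rewrite /bshift t0 mul0r mulr0 cos0 subrr normr0 mulr0.
  rewrite mulr1 ler_norml; have := cos_le1 (bshift y i); have := cos_geN1 (bshift y i).
  by move=> ? ?; apply/andP; split; lra.
rewrite /nu -/f normrM normfV [`|d%:R * f|]gtr0_norm ?mulr_gt0//.
rewrite ler_pM2r ?invr_gt0 ?mulr_gt0//; exact: ler_normB.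
Qed.

(** If [nu] is small the logarithm is Lipschitz near 1, and the prefactor [2 * that / lam] gives
    [5 / lam] since [y <= 9 / 8]. Truncation by [2 * sigS2] does no harm because this exceeds
    [sigma ^+ 2]. *)
Lemma sigD2_good y : 0 < y -> y <= 9 / 8 -> that = sigma ^+ 2 * y ->
  s%:R / d%:R <= 1 / 8 :> R -> `|sigS2 Sig Y / sigma ^+ 2 - 1| <= 1 / 10 ->
  `|sigma ^+ 2 - sigD2 Sig s Y| <=
    sigma ^+ 2 * (5 / lam * (2 * (s%:R / d%:R) + nu y) + 52 * nu y ^+ 2).
Proof.
move=> y0 y1 tE sd sS; have l0 := lam0.
have /andP[D0 D1] := sigD2_bounds.
have S1 : 9 / 10 * sigma ^+ 2 <= sigS2 Sig Y <= 11 / 10 * sigma ^+ 2.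
  move: sS; rewrite ler_norml => /andP[? ?].
  have -> : sigS2 Sig Y = sigS2 Sig Y / sigma ^+ 2 * sigma ^+ 2 by rewrite divfK// gt_eqF.
  by rewrite !ler_pM2r//; apply/andP; split; lra.
have /andP[S1l S1u] := S1.
have n0 := nu_ge0 y; have sd0 : 0 <= s%:R / d%:R :> R by rewrite divr_ge0 ?ler0n.
have il0 : 0 <= 5 / lam by rewrite divr_ge0// ltW.
have n20 := sqr_ge0 (nu y).
(* For large [nu] the logarithm is uncontrolled, but truncation bounds the error by
   [16 / 5 * sigma ^+ 2], which [52 * nu ^+ 2] exceeds once [nu > 1 / 4]. *)
have [nl|nl] := leP (nu y) (1 / 4); last first.
  have : `|sigma ^+ 2 - sigD2 Sig s Y| <= sigma ^+ 2 * (16 / 5).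
    by rewrite ler_norml; apply/andP; split; lra.
  move=> h; apply: le_trans h _; rewrite ler_pM2l//.
  have : 0 <= 5 / lam * (2 * (s%:R / d%:R) + nu y) by rewrite mulr_ge0// addr_ge0// mulr_ge0.
  have : 1 / 16 <= nu y ^+ 2 by nra.
  by lra.
have near := phihat_near y0; rewrite -tE in near.
set ph := phihat _ _ _ in near; set f := expR _ in near.
have f0 : 0 < f by exact: expR_gt0.
pose D := 2 * (s%:R / d%:R) + nu y; rewrite -/D in near *.
have Dl : D <= 1 / 2 by rewrite /D; lra.
have lnb := ln_near1 near Dl.
have vp : 0 < ph / f by move: near; rewrite ler_norml => /andP[? ?]; lra.
have php : 0 < ph by move: vp; rewrite pmulr_lgt0 ?invr_gt0.
have til : `|sigD2til Sig s Y - sigma ^+ 2| <= sigma ^+ 2 * (5 / lam * D).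
  have -> : sigD2til Sig s Y - sigma ^+ 2 = - (2 * that / lam) * ln (ph / f).
    rewrite /sigD2til -/ph gtr0_norm// ln_div ?posrE// expRK mulrBr.
    congr (_ - _); rewrite tE /av sqr_sqrtr; last by rewrite divr_ge0// ltW.
    by field; rewrite !gt_eqF.
  rewrite normrM normrN (ger0_norm tl0).
  apply: le_trans (ler_wpM2l tl0 lnb) _.
  have D00 : 0 <= D by exact: le_trans (normr_ge0 _) near.
  have -> : 2 * that / lam * (2 * D) = sigma ^+ 2 * (4 * y / lam * D).
    by rewrite tE; field; rewrite gt_eqF.
  rewrite ler_pM2l//; apply: ler_wpM2r => //; rewrite ler_pM2r ?invr_gt0//; lra.
rewrite distrC /sigD2 -/ph gt_eqF//.
apply: le_trans (min_near _ _) _; first by lra.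
apply: le_trans til _; rewrite ler_pM2l// lerDl; lra.
Qed.

(** The a priori bounds through [that] and the mean square of the noise; nothing is assumed about
    the empirical c.d.f. *)
Lemma sigD2_bad : s%:R / d%:R <= 1 / 8 :> R ->
  `|sigma ^+ 2 - sigD2 Sig s Y| <= sigma ^+ 2 * (65 + 64 * (`|Usum x| / d%:R)).
Proof.
move=> sd; have /andP[D0 D1] := sigD2_bounds.
have /andP[_ S1] : 0 <= sigS2 Sig Y <= 4 * that by apply: sigS2_bounds.
have t1 : that <= 8 * sigma ^+ 2 * ((\sum_i x i ^+ 2) / d%:R).
  by apply: (that_le_mean_sq x d0 Sig0 sigma0 theta_s); lra.
have e : (d%:R + Usum x) / d%:R = 1 + Usum x / d%:R by field; rewrite gt_eqF.
rewrite sum_sq_Usum e in t1.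
have h : Usum x / d%:R <= `|Usum x| / d%:R by rewrite ler_pM2r ?invr_gt0// ler_norm.
have h0 : 0 <= `|Usum x| / d%:R by rewrite divr_ge0 ?ler0n.
have : sigma ^+ 2 * (Usum x / d%:R) <= sigma ^+ 2 * (`|Usum x| / d%:R) by rewrite ler_pM2l.
have : 0 <= sigma ^+ 2 * (`|Usum x| / d%:R) by rewrite mulr_ge0// ltW.
by move=> g1 g2; have := s2; rewrite ler_norml => ?; apply/andP; split; lra.
Qed.

End sigD.

(** * Sparse zone: deterministic decomposition of the loss *)

Section sparse.
Variables (R : realType) (d : nat) (Sig : 'M[R]_d) (theta x : 'I_d -> R) (sigma : R) (s : nat).
Hypotheses (d0 : (0 < d)%N) (Sig0 : forall i, 0 < Sig i i) (sigma0 : 0 < sigma).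
Hypothesis Sig1 : forall i, Sig i i <= 1.
Hypothesis theta_s : (l0norm theta <= s)%N.
Let dR : 0 < d%:R :> R. Proof. by rewrite ltr0n. Qed.
Let Y := Ymodel Sig theta x sigma.
Let s2 : 0 < sigma ^+ 2. Proof. by rewrite exprn_gt0. Qed.
Notation that := (that Sig Y).
Notation tau := (tau Sig s).
Notation alpha := (alpha_s Sig s).
Notation sigS := (sigS Sig Y).
Notation sigS2 := (sigS2 Sig Y).

Lemma tau_ge0 : 0 <= tau.
Proof. by rewrite /Defs.tau mulr_ge0// sqrtr_ge0. Qed.

Lemma alpha_sE : alpha = \int[gam R]_z tailf tau z.
Proof.
rewrite /alpha_s /Rintegral; congr fine.
have mE : measurable_fun [set: R] (fun z => (tailf tau z)%:E).
  by apply/measurable_EFinP; exact: (growth_tailf tau_ge0).1.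
rewrite ge0_integral_gam//; last by move=> z; rewrite lee_fin tailf_ge0.
apply: eq_integral => z _; rewrite -EFinM /tailf -/(phi z); congr EFin.
by case: ifP => _; rewrite ?mulr1 ?mulr0.
Qed.

Let kap := expR (- (tau ^+ 2 / 18)).

Lemma alpha_ge0 : 0 <= alpha.
Proof. by rewrite alpha_sE; apply: Rintegral_ge0 => z _; exact: tailf_ge0. Qed.

Lemma alpha_le : alpha <= 80 * kap.
Proof.
have := growth_mean (growth_tailf tau_ge0); rewrite -alpha_sE ger0_norm ?alpha_ge0// -/kap.
by lra.
Qed.

Let kap1 : kap <= 1.
Proof. by rewrite -[leRHS]expR0 ler_expR oppr_le0 divr_ge0 ?sqr_ge0. Qed.

Let S0 : 0 <= sigS2 <= 4 * that. Proof. exact: sigS2_bounds. Qed.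

Definition thr i : R := if sigS * sigi Sig i * tau < `|Y i| then Y i else 0.
Definition Wsum := \sum_(i | theta i == 0) thr i ^+ 2 - sigS2 * alpha * \sum_i Sig i i.

(** On the support the thresholded vector differs from [theta] by noise and by at most one threshold
    per coordinate, so its norm is close to that of [theta]. The off-support energy minus its
    correction is [Wsum], which enters through its absolute value. *)
Lemma sparse_err : s%:R <= frob Sig ->
  (Nstar Sig s Y - l2norm theta) ^+ 2 <=
  2 * `|Wsum| + 4 * (sigma ^+ 2 * \sum_(i | theta i != 0) x i ^+ 2) + 4 * (sigS2 * tau ^+ 2 * s%:R).
Proof.
move=> sF; rewrite /Nstar /Qstar sF.
set Q := \sum_(i < d) _ - _.
pose v2 := \sum_(i | theta i != 0) thr i ^+ 2.
have v20 : 0 <= v2 by apply: sumr_ge0 => i _; exact: sqr_ge0.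
have QE : Q = v2 + Wsum.
  rewrite /Q /Wsum /v2 addrA; congr (_ - _); rewrite (bigID (fun i => theta i != 0))/=.
  congr (_ + _); first by apply: eq_bigr => i _; rewrite /thr; case: ifP => // _; rewrite expr0n.
  by apply: eq_big => [i|i _]; rewrite ?negbK// /thr; case: ifP => // _; rewrite expr0n.
have nE : l2norm theta = Num.sqrt (\sum_(i | theta i != 0) theta i ^+ 2).
  rewrite /l2norm (bigID (fun i => theta i != 0))/= [X in _ + X]big1 ?addr0// => i.
  by rewrite negbK => /eqP ->; rewrite expr0n.
have h1 : (Num.sqrt `|Q| - Num.sqrt v2) ^+ 2 <= `|Wsum|.
  rewrite -{1}(ger0_norm v20); apply: le_trans (sqrt_norm_diff _ _) _.
  by rewrite QE addrC addKr.
have h2 : (Num.sqrt v2 - l2norm theta) ^+ 2 <=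
   2 * (sigma ^+ 2 * \sum_(i | theta i != 0) x i ^+ 2) + 2 * (sigS2 * tau ^+ 2 * s%:R).
  rewrite nE; apply: le_trans (l2_diff _ _ _) _.
  have /andP[SS0 _] := S0.
  have ST : 0 <= sigS2 * tau ^+ 2 by rewrite mulr_ge0 ?sqr_ge0.
  apply: (@le_trans _ _ (\sum_(i | theta i != 0) (2 * (sigma ^+ 2 * x i ^+ 2) + 2 * (sigS2 * tau ^+ 2)))).
    apply: ler_sum => i ti.
    have YE : Y i - theta i = sigma * (sigi Sig i * x i) by rewrite /Y /Ymodel addrC addKr.
    have e1 : (Y i - theta i) ^+ 2 <= sigma ^+ 2 * x i ^+ 2.
      rewrite YE !exprMn (sigi_sq Sig0) ler_pM2l// ler_piMl ?sqr_ge0//; exact: Sig1.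
    have e2 : (Y i - thr i) ^+ 2 <= sigS2 * tau ^+ 2.
      rewrite /thr; case: ifPn => [_|]; first by rewrite subrr expr0n.
      rewrite -leNgt subr0 => hY; rewrite -real_normK ?num_real//.
      apply: (@le_trans _ _ ((sigS * sigi Sig i * tau) ^+ 2)).
        by rewrite ler_sqr ?nnegrE//; exact: le_trans hY.
      have -> : (sigS * sigi Sig i * tau) ^+ 2 = sigS ^+ 2 * sigi Sig i ^+ 2 * tau ^+ 2 by ring.
      rewrite (sigi_sq Sig0) sqr_sqrtr//; apply: ler_wpM2r; first exact: sqr_ge0.
      by rewrite ler_piMr//; exact: Sig1.
    have := sqr_ge0 ((Y i - theta i) + (Y i - thr i)).
    have -> : thr i - theta i = (Y i - theta i) - (Y i - thr i) by ring.
    set p := Y i - theta i in e1 *; set q := Y i - thr i in e2 * => pq.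
    have -> : (p - q) ^+ 2 = 2 * p ^+ 2 + 2 * q ^+ 2 - (p + q) ^+ 2 by ring.
    by lra.
  rewrite big_split/=; apply: lerD; first by rewrite -!mulr_sumr.
  rewrite sumr_const -[X in X <= _]mulr_natr -[X in X <= _]mulrA ler_pM2l//.
  apply: ler_wpM2l => //.
  apply: le_trans (_ : \sum_i (theta i != 0)%:R <= _); last exact: support_card.
  by rewrite -sum1_card natr_sum big_mkcond/=; apply: ler_sum => i _; rewrite unfold_in; case: ifP.
move: h1 h2; set p := Num.sqrt `|Q|; set q := Num.sqrt v2; set r := l2norm theta => h1 h2.
have : (p - r) ^+ 2 <= 2 * (p - q) ^+ 2 + 2 * (q - r) ^+ 2.
  by have := sqr_ge0 ((p - q) - (q - r)); nra.
by lra.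
Qed.

Lemma thr_off i : theta i = 0 ->
  thr i ^+ 2 = sigma ^+ 2 * (Sig i i * (if sigS / sigma * tau < `|x i| then x i ^+ 2 else 0)).
Proof.
move=> t0; have YE : Y i = sigma * (sigi Sig i * x i) by rewrite /Y /Ymodel t0 add0r.
have g0 : 0 < sigi Sig i by rewrite sqrtr_gt0.
rewrite /thr.
have -> : (sigS * sigi Sig i * tau < `|Y i|) = (sigS / sigma * tau < `|x i|).
  rewrite YE !normrM (gtr0_norm sigma0) (gtr0_norm g0).
  have -> : sigS * sigi Sig i * tau = (sigma * sigi Sig i) * (sigS / sigma * tau).
    by field; rewrite gt_eqF.
  by rewrite [X in _ < X]mulrA ltr_pM2l// mulr_gt0.
case: ifP => _; last by rewrite expr0n !mulr0.
by rewrite YE !exprMn (sigi_sq Sig0).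
Qed.

(** The off-support fluctuation at the deterministic threshold [tau]: the estimated threshold would
    prevent any moment computation. *)
Definition Gsum := \sum_i (Sig i i * (theta i == 0)%:R) * (tailf tau (x i) - alpha).
Definition Msum D := \sum_i Sig i i * bandf tau D (x i).

Lemma Msum_le D D' : D <= D' -> Msum D <= Msum D'.
Proof.
move=> DD; apply: ler_sum => i _; rewrite ler_pM2l// /bandf; case: ifPn => [h|_].
  by rewrite (le_trans h)// ler_wpM2r// tau_ge0.
by case: ifP => // _; exact: sqr_ge0.
Qed.

(** Replacing the random threshold by [tau] changes a summand only inside the band. What remains is
    the error of [sigS2] in the correction term and the part of the correction that belongs to the
    support. *)
Lemma Wsum_good D : `|sigS2 / sigma ^+ 2 - 1| <= D ->
  `|Wsum| <= sigma ^+ 2 * (`|Gsum| + Msum D + alpha * (D * d%:R + s%:R)).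
Proof.
move=> hD; have /andP[SS0 _] := S0.
pose r := sigS / sigma.
have r0 : 0 <= r by rewrite divr_ge0 ?sqrtr_ge0// ltW.
have r2 : r ^+ 2 = sigS2 / sigma ^+ 2 by rewrite /r expr_div_n sqr_sqrtr.
(* The control is on [r ^+ 2]; since [r + 1 >= 1], it passes to [r] with no loss. *)
have rD : `|r - 1| <= D.
  apply: le_trans hD; rewrite -r2 (_ : r ^+ 2 - 1 = (r - 1) * (r + 1)); last by ring.
  by rewrite normrM ler_peMr// ger0_norm ?addr_ge0// lerDr.
have al0 := alpha_ge0.
pose E i := if r * tau < `|x i| then x i ^+ 2 else 0.
have band i : `|E i - tailf tau (x i)| <= bandf tau D (x i).
  rewrite /E /tailf /bandf; have x20 := sqr_ge0 (x i).
  have key : `|(r - 1) * tau| <= D * tau.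
    by rewrite normrM (ger0_norm tau_ge0); apply: ler_wpM2r => //; exact: tau_ge0.
  move: key; rewrite ler_norml => /andP[k1 k2].
  case: ifPn => [h1|h1]; case: ifPn => [h2|h2]; rewrite ?subrr ?normr0.
  - by case: ifP.
  - rewrite subr0 ger0_norm//; rewrite ifT// ler_norml; rewrite -ltNge in h2.
    by apply/andP; split; lra.
  - rewrite sub0r normrN ger0_norm//; rewrite ifT// ler_norml; rewrite -leNgt in h1.
    by apply/andP; split; lra.
  - by case: ifP.
have WE : Wsum = sigma ^+ 2 * (Gsum + \sum_i (Sig i i * (theta i == 0)%:R) * (E i - tailf tau (x i))
    + alpha * ((1 - r ^+ 2) * \sum_i Sig i i - \sum_i Sig i i * (theta i != 0)%:R)).
  rewrite /Wsum.
  have -> : sigS2 = sigma ^+ 2 * r ^+ 2 by rewrite r2 mulrCA divff ?mulr1// gt_eqF.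
  have -> : \sum_(i | theta i == 0) thr i ^+ 2 =
     sigma ^+ 2 * \sum_i Sig i i * (theta i == 0)%:R * E i.
    rewrite big_mkcond mulr_sumr; apply: eq_bigr => i _; case: eqP => t0.
      by rewrite thr_off// mulr1.
    by rewrite mulr0 mul0r mulr0.
  have e1 : Gsum + \sum_i (Sig i i * (theta i == 0)%:R) * (E i - tailf tau (x i)) =
      \sum_i Sig i i * (theta i == 0)%:R * E i - alpha * \sum_i Sig i i * (theta i == 0)%:R.
    rewrite /Gsum -big_split/= mulr_sumr -sumrB; apply: eq_bigr => i _; by ring.
  have e2 : \sum_i Sig i i * (theta i == 0)%:R =
      \sum_i Sig i i - \sum_i Sig i i * (theta i != 0)%:R.
    by rewrite -sumrB; apply: eq_bigr => i _; case: eqP => _ /=; ring.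
  rewrite e1 e2; ring.
rewrite WE normrM (gtr0_norm s2) ler_pM2l//.
apply: le_trans (ler_normD _ _) _; apply: lerD.
  apply: le_trans (ler_normD _ _) _; rewrite lerD2l.
  apply: le_trans (ler_norm_sum _ _ _) _; apply: ler_sum => i _.
  rewrite normrM; apply: ler_pM => //.
  by have := Sig0 i; case: eqP => _; rewrite ?mulr1 ?mulr0 ?normr0 => ?; rewrite ?gtr0_norm// ltW.
rewrite normrM (ger0_norm al0); apply: ler_wpM2l => //.
apply: le_trans (ler_normB _ _) _; apply: lerD.
  rewrite normrM; apply: ler_pM => //; first by rewrite distrC r2.
  by rewrite ger0_norm ?sumSig_ge0//; exact: sumSig_le.
rewrite ger0_norm; last by apply: sumr_ge0 => i _; rewrite mulr_ge0// ltW.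
have sc : \sum_i (theta i != 0)%:R <= s%:R :> R by exact: support_card.
apply: le_trans sc; apply: ler_sum => i _.
by rewrite ler_piMl//; exact: Sig1.
Qed.

Lemma sparse_good D : s%:R <= frob Sig -> `|sigS2 / sigma ^+ 2 - 1| <= D -> D <= 1 / 10 ->
  (Nstar Sig s Y - l2norm theta) ^+ 2 <= sigma ^+ 2 *
   (2 * `|Gsum| + 2 * Msum D + 2 * (alpha * (D * d%:R + s%:R))
    + 4 * (\sum_(i | theta i != 0) x i ^+ 2) + 5 * (tau ^+ 2 * s%:R)).
Proof.
move=> sF hD D1; apply: le_trans (sparse_err sF) _.
have := Wsum_good hD; set W := `|Wsum|; set G := `|Gsum|; set M := Msum D.
set X := \sum_(i | _) _; set a := alpha * _ => hW.
have S1 : sigS2 <= 11 / 10 * sigma ^+ 2.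
  have -> : sigS2 = sigS2 / sigma ^+ 2 * sigma ^+ 2 by rewrite divfK// gt_eqF.
  by rewrite ler_pM2r//; move: hD; rewrite ler_norml => /andP[_ ?]; lra.
have t0 : 0 <= tau ^+ 2 * s%:R by rewrite mulr_ge0 ?sqr_ge0 ?ler0n.
have : sigS2 * (tau ^+ 2 * s%:R) <= 11 / 10 * sigma ^+ 2 * (tau ^+ 2 * s%:R) by apply: ler_wpM2r.
have : 0 <= sigma ^+ 2 * (tau ^+ 2 * s%:R) by rewrite mulr_ge0// ltW.
rewrite -[sigS2 * tau ^+ 2 * s%:R]mulrA; set t := tau ^+ 2 * s%:R; lra.
Qed.

(** Valid on every outcome: all terms are bounded by the total energy of the noise, with the
    threshold contributing a factor [tau ^+ 2]. *)
Lemma sparse_bad : s%:R <= frob Sig -> s%:R / d%:R <= 1 / 8 :> R ->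
  (Nstar Sig s Y - l2norm theta) ^+ 2 <=
    sigma ^+ 2 * (6000 * (1 + tau ^+ 2) * (d%:R + `|Usum x|)).
Proof.
move=> sF sd; apply: le_trans (sparse_err sF) _.
have /andP[SS0 SS1] := S0; have al0 := alpha_ge0.
have al1 : alpha <= 80 by have := alpha_le; have := kap1; lra.
pose u := d%:R + `|Usum x|.
have u0 : 0 <= u by rewrite addr_ge0 ?ler0n.
have X1 : \sum_i x i ^+ 2 <= u by rewrite sum_sq_Usum lerD2l ler_norm.
have t1 : that <= 8 * sigma ^+ 2 * ((\sum_i x i ^+ 2) / d%:R).
  by apply: (that_le_mean_sq x d0 Sig0 sigma0 theta_s); lra.
have S2 : sigS2 * d%:R <= 32 * (sigma ^+ 2 * u).
  have : sigS2 <= 32 * (sigma ^+ 2 * ((\sum_i x i ^+ 2) / d%:R)) by lra.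
  rewrite -(ler_pM2r dR) => h; apply: le_trans h _.
  have -> : 32 * (sigma ^+ 2 * ((\sum_i x i ^+ 2) / d%:R)) * d%:R = 32 * (sigma ^+ 2 * (\sum_i x i ^+ 2)).
    by field; rewrite gt_eqF.
  by rewrite !ler_pM2l.
have sdle : s%:R <= d%:R :> R.
  by move: sd; rewrite ler_pdivrMr// => h; have := dR; lra.
have W1 : `|Wsum| <= sigma ^+ 2 * u + 80 * (32 * (sigma ^+ 2 * u)).
  apply: le_trans (ler_normB _ _) _; apply: lerD.
    rewrite ger0_norm; last by apply: sumr_ge0 => i _; exact: sqr_ge0.
    apply: (@le_trans _ _ (sigma ^+ 2 * \sum_i x i ^+ 2)); last by rewrite ler_pM2l.
    rewrite mulr_sumr [leLHS]big_mkcond/=; apply: ler_sum => i _; case: eqP => t0.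
      rewrite thr_off// ler_pM2l//; apply: (@le_trans _ _ (Sig i i * x i ^+ 2)).
        by rewrite ler_pM2l//; case: ifP => // _; exact: sqr_ge0.
      by rewrite ler_piMl ?sqr_ge0//; exact: Sig1.
    by rewrite mulr_ge0 ?sqr_ge0// ltW.
  rewrite ger0_norm; last by rewrite !mulr_ge0// sumSig_ge0.
  rewrite (mulrC sigS2) -mulrA; apply: ler_pM => //.
    by rewrite mulr_ge0// sumSig_ge0.
  by apply: le_trans S2; apply: ler_wpM2l => //; exact: sumSig_le.
have X2 : \sum_(i | theta i != 0) x i ^+ 2 <= u.
  apply: le_trans X1; rewrite big_mkcond/=; apply: ler_sum => i _.
  by case: ifP => // _; exact: sqr_ge0.
have X3 : sigma ^+ 2 * (\sum_(i | theta i != 0) x i ^+ 2) <= sigma ^+ 2 * u by rewrite ler_pM2l.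
have T2 := sqr_ge0 tau.
have S3 : sigS2 * tau ^+ 2 * s%:R <= tau ^+ 2 * (32 * (sigma ^+ 2 * u)).
  rewrite (mulrC sigS2) -mulrA; apply: ler_wpM2l => //; apply: le_trans S2.
  exact: ler_wpM2l.
have su : 0 <= sigma ^+ 2 * u by rewrite mulr_ge0// ltW.
have tsu : 0 <= tau ^+ 2 * (sigma ^+ 2 * u) by rewrite mulr_ge0.
rewrite -/u (_ : sigma ^+ 2 * (6000 * (1 + tau ^+ 2) * u) =
  6000 * (sigma ^+ 2 * u) + 6000 * (tau ^+ 2 * (sigma ^+ 2 * u))); last by ring.
have S3' : sigS2 * tau ^+ 2 * s%:R <= 32 * (tau ^+ 2 * (sigma ^+ 2 * u)).
  by apply: le_trans S3 _; rewrite mulrCA.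
move: W1 X3 S3' su tsu.
set W := `|Wsum|; set X := sigma ^+ 2 * \sum_(i | _) _; set Z := sigS2 * _ * _.
set q := tau ^+ 2 * (sigma ^+ 2 * u); set p := sigma ^+ 2 * u => W1 X3 Z3 p0 q0.
by lra.
Qed.

End sparse.

Section linear_moment.
Variable R : realType.

Lemma second_moment_lin n (u : nat -> R) :
  upE n (fun z => lin n u z ^+ 2) (\sum_(k < n) u k ^+ 2).
Proof.
have mF : mreal (fun z : nat -> R => lin n u z ^+ 2).
  by move=> d T Z mZ; apply: measurable_funX; exact: mreal_lin.
exists (fun z => lin n u z ^+ 2); split => //; first by move=> z; exact: sqr_ge0.
have [p [q [w [[p0 w0 pp pq qw] law]]]] := gauss_pair n u u.
have mH : measurable_fun [set: R * R] (fun v : R * R => (v.1 ^+ 2)%:E).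
  apply/measurable_EFinP; apply: measurable_funX; exact: measurable_fst.
have H0 (v : R * R) : (0 <= (v.1 ^+ 2)%:E)%E by rewrite lee_fin sqr_ge0.
have -> : gauss_int n (fun z => (lin n u z ^+ 2)%:E) = pair_law p q w (fun v => (v.1 ^+ 2)%:E).
  exact: (law _ mH H0).
have -> : pair_law p q w (fun v => (v.1 ^+ 2)%:E) = (\int[gam R]_x (p ^+ 2 * x ^+ 2)%:E)%E.
  by apply: eq_integral => x _; rewrite -exprMn; exact: (gam_cst ((p * x) ^+ 2)%:E).
have g2 := growth_integrable (growth_sq R).
rewrite (gam_fin (f := fun x => p ^+ 2 * x ^+ 2)); last exact: integrableZ_EFin.
by rewrite RintegralZl// gam_sq mulr1 -pp.
Qed.

End linear_moment.

(** * The Gaussian model: moments of every random sum occurring above *)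

Section model.
Variables (R : realType) (d : nat) (A : 'M[R]_d) (theta : 'I_d -> R) (sigma cstar : R) (s : nat).
Let Sig := A *m A^T.
Hypotheses (d0 : (0 < d)%N) (s0 : (0 < s)%N) (cs0 : 0 < cstar) (sigma0 : 0 < sigma).
Hypotheses (Sig1 : forall i, Sig i i <= 1) (Sigc : forall i, cstar <= Sig i i).
Hypothesis theta_s : (l0norm theta <= s)%N.
Let dR : 0 < d%:R :> R. Proof. by rewrite ltr0n. Qed.
Let Sig0 i : 0 < Sig i i. Proof. exact: lt_le_trans (Sigc i). Qed.
Let sg0 i : 0 < sigi Sig i. Proof. by rewrite sqrtr_gt0. Qed.
Let sg2 i : sigi Sig i ^+ 2 = Sig i i. Proof. by rewrite sqr_sqrtr// ltW. Qed.
(** Rows of [A] normalized to unit length and extended by zero to all naturals, since [gauss_int]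
    works with sequences. *)
Definition arow (i : 'I_d) (k : nat) : R :=
  if insub k is Some j then A i j / sigi Sig i else 0.

Lemma arowE i (j : 'I_d) : arow i j = A i j / sigi Sig i.
Proof. by rewrite /arow valK. Qed.

Definition noise z (i : 'I_d) : R := xi d arow i z.

Lemma YobsE z : Yobs theta sigma A z = Ymodel Sig theta (noise z) sigma.
Proof.
apply/funext => i; rewrite /Yobs /Ymodel /noise /xi /lin; congr (_ + _ * _).
rewrite mulr_sumr; apply: eq_bigr => j _; rewrite arowE.
by field; rewrite gt_eqF.
Qed.

Let rho i j := \sum_(k < d) arow i k * arow j k.

Lemma rhoE i j : rho i j = Sigtil Sig i j.
Proof.
rewrite /rho /Sigtil !mxE mulr_suml; apply: eq_bigr => k _; rewrite !arowE mxE.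
by field; rewrite !gt_eqF.
Qed.

Lemma rho1 i : rho i i = 1.
Proof. by rewrite rhoE mxE -expr2 sg2 divff// gt_eqF. Qed.

Notation T := (frob (Sigtil Sig)).
Notation Fr := (frob Sig).

Lemma frob_sq (M : 'M[R]_d) : frob M ^+ 2 = \sum_i \sum_j M i j ^+ 2.
Proof. by rewrite sqr_sqrtr//; apply: sumr_ge0 => i _; apply: sumr_ge0 => j _; exact: sqr_ge0. Qed.

Lemma sum_rho_sq : \sum_i \sum_j rho i j ^+ 2 = T ^+ 2.
Proof. by rewrite frob_sq; apply: eq_bigr => i _; apply: eq_bigr => j _; rewrite rhoE. Qed.

Lemma frob_ge0 (M : 'M[R]_d) : 0 <= frob M. Proof. exact: sqrtr_ge0. Qed.

Lemma frob_Sigtil_ge1 : 1 <= T.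
Proof.
rewrite -(@ler_sqr R) ?nnegrE ?frob_ge0// expr1n -sum_rho_sq.
pose i0 := Ordinal d0.
rewrite (bigD1 i0)//= (bigD1 i0)//= rho1 expr1n -addrA lerDl addr_ge0//.
  by apply: sumr_ge0 => j _; exact: sqr_ge0.
by apply: sumr_ge0 => i _; apply: sumr_ge0 => j _; exact: sqr_ge0.
Qed.

Lemma frob_Sigtil_le_d : T <= d%:R.
Proof.
rewrite -(@ler_sqr R) ?nnegrE ?frob_ge0 ?ler0n// -sum_rho_sq.
have : \sum_i \sum_j rho i j ^+ 2 <= \sum_(i < d) \sum_(j < d) (1 : R).
  apply: ler_sum => i _; apply: ler_sum => j _.
  apply: le_trans (sum_CS predT (fun k : 'I_d => arow i k) (fun k : 'I_d => arow j k)) _.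
  have e i' : \sum_(k < d) arow i' k ^+ 2 = 1.
    by rewrite -(rho1 i'); apply: eq_bigr => k _; rewrite expr2.
  by rewrite !e mulr1.
have -> : \sum_(i < d) \sum_(j < d) (1 : R) = d%:R ^+ 2.
  by rewrite sumr_const card_ord sumr_const card_ord -[LHS]mulr_natr expr2.
by [].
Qed.

Lemma cstar_le1 : cstar <= 1.
Proof. exact: le_trans (Sigc (Ordinal d0)) (Sig1 _). Qed.

Let Sigtil_abs i j : Sig i j ^+ 2 = Sigtil Sig i j ^+ 2 * (Sig i i * Sig j j).
Proof.
have -> : Sigtil Sig i j = Sig i j / (sigi Sig i * sigi Sig j) by rewrite mxE.
by rewrite -(sg2 i) -(sg2 j); field; rewrite !gt_eqF.
Qed.

Lemma frob_Sigtil_le : cstar * T <= Fr.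
Proof.
have cT0 : 0 <= cstar * T by apply: mulr_ge0; [exact: ltW|exact: frob_ge0].
rewrite -(@ler_sqr R) ?nnegrE ?frob_ge0//.
have -> : (cstar * T) ^+ 2 = \sum_i \sum_j cstar ^+ 2 * Sigtil Sig i j ^+ 2.
  have -> : (cstar * T) ^+ 2 = cstar ^+ 2 * T ^+ 2 by ring.
  by rewrite frob_sq mulr_sumr; apply: eq_bigr => i _; rewrite mulr_sumr.
rewrite frob_sq; apply: ler_sum => i _; apply: ler_sum => j _.
rewrite [leRHS]Sigtil_abs mulrC; apply: ler_wpM2l; first exact: sqr_ge0.
by rewrite expr2; apply: ler_pM => //; exact: ltW.
Qed.

Lemma frob_Sig_gt0 : 0 < Fr.
Proof.
apply: lt_le_trans frob_Sigtil_le; rewrite mulr_gt0//; apply: lt_le_trans frob_Sigtil_ge1; exact: ltr01.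
Qed.

Let even_moment (f : R -> R) B (w : 'I_d -> R) : growth B f ->
  (forall x, f (- x) = f x) -> (forall i, `|w i| <= 1) ->
  upE d (fun z => (\sum_i w i * (f (noise z i) - \int[gam R]_x f x)) ^+ 2) (3600 * B ^+ 2 * T ^+ 2).
Proof. by move=> gf fe w1; rewrite -sum_rho_sq; exact: (second_moment_even rho1 gf fe w1). Qed.

Lemma mom_Usum : upE d (fun z => Usum (noise z) ^+ 2) (3600 * 8 ^+ 2 * T ^+ 2).
Proof.
have := @even_moment (fun x => x ^+ 2) 8 (fun _ => 1) (growth_sq R).
rewrite gam_sq; apply => [x|i]; first by rewrite sqrrN.
by rewrite normr1.
Qed.

Let Sig_abs1 i : `|Sig i i| <= 1. Proof. by rewrite gtr0_norm. Qed.

Lemma mom_Vsum : upE d (fun z => Vsum Sig (noise z) ^+ 2) (3600 * 8 ^+ 2 * T ^+ 2).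
Proof.
have := @even_moment (fun x => x ^+ 2) 8 (fun i => Sig i i) (growth_sq R).
rewrite gam_sq; apply => [x|i]; first by rewrite sqrrN.
exact: Sig_abs1.
Qed.

Lemma mom_dev y : upE d (fun z => dev (noise z) y ^+ 2) (3600 * (T ^+ 2 / d%:R ^+ 2)).
Proof.
have H : upE d (fun z => (\sum_i 1 * (sqind y (noise z i) - \int[gam R]_x sqind y x)) ^+ 2)
    (3600 * 1 ^+ 2 * T ^+ 2).
  apply: even_moment; [exact: growth_sqind|by move=> x; exact: sqindN|].
  by move=> i; rewrite normr1.
have c0 : 0 <= (d%:R ^+ 2)^-1 :> R by rewrite invr_ge0 sqr_ge0.
apply: upE_le (upE_scale c0 H) => [z|]; last first.
  by rewrite le_eqVlt; apply/orP; left; apply/eqP; field; rewrite gt_eqF.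
rewrite /dev /noise_cdf -exprVn -exprMn le_eqVlt; apply/orP; left; apply/eqP; congr (_ ^+ 2).
rewrite -chi2cdfE; under [in RHS]eq_bigr do rewrite mul1r.
rewrite sumrB sumr_const card_ord -mulr_natl; by field; rewrite gt_eqF.
Qed.

(** The variance is the quadratic form of [Sig] at [theta], at most [frob Sig] times the squared
    norm by Cauchy-Schwarz over pairs of indices. No normalization of the form is used, so the exact
    second moment of a linear form applies. *)
Lemma mom_Lsum : upE d (fun z => Lsum Sig theta (noise z) ^+ 2 / \sum_i theta i ^+ 2) Fr.
Proof.
pose u (k : nat) : R := if insub k is Some j then \sum_i theta i * A i j else 0.
have uE (j : 'I_d) : u j = \sum_i theta i * A i j by rewrite /u valK.
set N := \sum_i _; have N0 : 0 <= N by apply: sumr_ge0 => i _; exact: sqr_ge0.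
have Nv : 0 <= N^-1 by rewrite invr_ge0.
apply: upE_le (upE_scale Nv (second_moment_lin d u)) => [z|].
  rewrite [leLHS]mulrC; apply: ler_wpM2l => //.
  rewrite le_eqVlt; apply/orP; left; apply/eqP; congr (_ ^+ 2).
  rewrite /Lsum /lin /noise /xi /lin.
  transitivity (\sum_i \sum_(k < d) theta i * A i k * z k).
    apply: eq_bigr => i _; rewrite !mulr_sumr; apply: eq_bigr => k _; rewrite arowE.
    by field; rewrite gt_eqF.
  by rewrite exchange_big; apply: eq_bigr => k _; rewrite uE mulr_suml.
have -> : \sum_(k < d) u k ^+ 2 = \sum_i \sum_j (theta i * theta j) * Sig i j.
  transitivity (\sum_(k < d) \sum_i \sum_j (theta i * theta j) * (A i k * A j k)).
    apply: eq_bigr => k _; rewrite uE expr2 mulr_suml; apply: eq_bigr => i _.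
    by rewrite mulr_sumr; apply: eq_bigr => j _; ring.
  rewrite exchange_big; apply: eq_bigr => i _; rewrite exchange_big; apply: eq_bigr => j _.
  by rewrite -mulr_sumr; congr (_ * _); rewrite mxE; apply: eq_bigr => k _; rewrite mxE.
have h : \sum_i \sum_j (theta i * theta j) * Sig i j <= N * Fr.
  rewrite !pair_big/=.
  have cs := sum_CS predT (fun p : 'I_d * 'I_d => theta p.1 * theta p.2) (fun p => Sig p.1 p.2).
  have e1 : \sum_(p : 'I_d * 'I_d) (theta p.1 * theta p.2) ^+ 2 = N ^+ 2.
    rewrite -(pair_big predT predT (fun i j => (theta i * theta j) ^+ 2))/=.
    rewrite /N expr2 mulr_suml; apply: eq_bigr => i _; rewrite mulr_sumr.
    by apply: eq_bigr => j _; rewrite exprMn.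
  have e2 : \sum_(p : 'I_d * 'I_d) Sig p.1 p.2 ^+ 2 = Fr ^+ 2.
    by rewrite frob_sq -(pair_big predT predT (fun i j => Sig i j ^+ 2)).
  rewrite e1 e2 -exprMn in cs.
  apply: le_trans (ler_norm _) _.
  by rewrite -(@ler_sqr R) ?nnegrE ?mulr_ge0 ?frob_ge0// real_normK ?num_real.
apply: le_trans (ler_wpM2l Nv h) _.
have [->|Nn] := eqVneq N 0; first by rewrite mul0r mulr0 frob_ge0.
by rewrite mulrA mulVf// mul1r.
Qed.

Lemma mom_Xsupp : upE d (fun z => \sum_(i | theta i != 0) noise z i ^+ 2) s%:R.
Proof.
apply: upE_le (@upE_sum R d _ (index_enum 'I_d) (fun i => theta i != 0)
   (fun i z => noise z i ^+ 2) (fun _ => 1) _) => //.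
- rewrite sumr_const.
  apply: le_trans (_ : \sum_i (theta i != 0)%:R <= _); last exact: support_card.
  by rewrite -sum1_card natr_sum big_mkcond/=; apply: ler_sum => i _; rewrite unfold_in; case: ifP.
- move=> i _; rewrite -(gam_sq R).
  by apply: (first_moment rho1 i (growth_sq R)) => x; exact: sqr_ge0.
Qed.

Lemma mom_Nev y : upE d (fun z => Nev Sig theta (noise z) sigma s y ^+ 2) (3600 * T ^+ 2).
Proof.
have := @even_moment _ 1 (fun i => cos (bshift Sig theta sigma s y i)) (growth_cos (av Sig s y)).
rewrite gam_cos expr1n mulr1; apply => [x|i]; last exact: cos_max.
by rewrite mulrN cosN.
Qed.

(** Only [|rho|] is available for odd functions, but at most [s ^+ 2] pairs carry a nonzero weight;
    Cauchy-Schwarz over these pairs gives [s * T]. *)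
Lemma mom_Nod y : upE d (fun z => Nod Sig theta (noise z) sigma s y ^+ 2) (400 * (s%:R * T)).
Proof.
pose w i := sin (bshift Sig theta sigma s y i).
have := @second_moment_odd R d _ arow rho1 _ 1 w (growth_sin (av Sig s y)).
rewrite expr1n mulr1 => /(_ (fun x => etrans (congr1 _ (mulrN _ _)) (sinN _))).
apply: upE_le => [z|]; first exact: lexx.
apply: ler_wpM2l; first exact: ler0n.
have w1 i : `|w i| <= (theta i != 0)%:R.
  have [t0|_] := eqVneq (theta i) 0; last exact: sin_max.
  by rewrite /w /bshift t0 mul0r mulr0 sin0 normr0.
rewrite !pair_big/=.
have cs := sum_CS predT (fun p : 'I_d * 'I_d => `|w p.1| * `|w p.2|) (fun p => `|rho p.1 p.2|).
have e2 : \sum_(p : 'I_d * 'I_d) `|rho p.1 p.2| ^+ 2 = T ^+ 2.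
  rewrite -sum_rho_sq -(pair_big predT predT (fun i j => `|rho i j| ^+ 2))/=.
  by apply: eq_bigr => i _; apply: eq_bigr => j _; rewrite real_normK ?num_real.
have sc : \sum_i (theta i != 0)%:R <= s%:R :> R by exact: support_card.
have e1 : \sum_(p : 'I_d * 'I_d) (`|w p.1| * `|w p.2|) ^+ 2 <= s%:R ^+ 2.
  rewrite -(pair_big predT predT (fun i j => (`|w i| * `|w j|) ^+ 2))/=.
  apply: (@le_trans _ _ ((\sum_i (theta i != 0)%:R) ^+ 2)); last first.
    by rewrite ler_sqr ?nnegrE ?ler0n// sumr_ge0.
  rewrite expr2 mulr_suml; apply: ler_sum => i _; rewrite mulr_sumr; apply: ler_sum => j _.
  rewrite exprMn; apply: ler_pM; rewrite ?sqr_ge0//.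
    by apply: le_trans (w1 i); rewrite expr2 ler_piMr//; exact: sin_max.
  by apply: le_trans (w1 j); rewrite expr2 ler_piMr//; exact: sin_max.
rewrite e2 in cs.
rewrite -(@ler_sqr R) ?nnegrE ?mulr_ge0 ?frob_ge0 ?ler0n//; last first.
  by apply: sumr_ge0 => p _; rewrite !mulr_ge0.
by apply: le_trans cs _; rewrite exprMn; apply: ler_wpM2r => //; exact: sqr_ge0.
Qed.

Let kap := expR (- (tau Sig s ^+ 2 / 18)).

(** The growth constant of the tail function already contains [kap], so the standard deviation is of
    order [kap * T]. *)
Lemma mom_Gsum : upE d (fun z => Gsum Sig theta (noise z) s ^+ 2) (3600 * (40 * kap) ^+ 2 * T ^+ 2).
Proof.
rewrite /Gsum alpha_sE; apply: even_moment.
- exact: growth_tailf (tau_ge0 _ _).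
- by move=> x; exact: tailfN.
- move=> i; rewrite normrM; case: eqP => _; rewrite ?normr1 ?normr0 ?mulr1 ?mulr0//.
Qed.

Definition Mc D z := \sum_i Sig i i * (bandf (tau Sig s) D (noise z i) - \int[gam R]_x bandf (tau Sig s) D x).

Lemma mom_Mc D : D <= 1 / 10 -> upE d (fun z => Mc D z ^+ 2) (3600 * (40 * kap) ^+ 2 * T ^+ 2).
Proof.
move=> D1; apply: even_moment.
- exact: (growth_bandf (tau_ge0 Sig s) D1).
- by move=> x; exact: bandfN.
- by move=> i; exact: Sig_abs1.
Qed.

(** The factor [D] sits in the mean only; the bound on the fluctuation [Mc] does not shrink with
    [D], which is why the summation over widths needs weights. *)
Lemma Msum_Mc D z : 0 <= D <= 1 / 10 ->
  Msum Sig (noise z) s D <= `|Mc D z| + 80 * D * kap * d%:R.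
Proof.
move=> D1; have m := bandf_mean (tau_ge0 Sig s) D1; rewrite -/kap in m.
have m0 : 0 <= \int[gam R]_x bandf (tau Sig s) D x.
  by apply: Rintegral_ge0 => x _; exact: bandf_ge0.
have -> : Msum Sig (noise z) s D = Mc D z + (\int[gam R]_x bandf (tau Sig s) D x) * \sum_i Sig i i.
  by rewrite /Msum /Mc mulr_sumr -big_split/=; apply: eq_bigr => i _; ring.
apply: lerD; first exact: ler_norm.
apply: ler_pM => //; first by apply: sumr_ge0 => i _; exact: ltW.
exact: sumSig_le.
Qed.

End model.

Lemma sqr_sum4_le (R : realType) (p a b c : R) :
  (p + (a + b + c)) ^+ 2 <= 2 * p ^+ 2 + 6 * (a ^+ 2 + b ^+ 2 + c ^+ 2).
Proof.
rewrite -subr_ge0.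
have -> : 2 * p ^+ 2 + 6 * (a ^+ 2 + b ^+ 2 + c ^+ 2) - (p + (a + b + c)) ^+ 2 =
  (p - (a + b + c)) ^+ 2 + 2 * ((a - b) ^+ 2 + (b - c) ^+ 2 + (a - c) ^+ 2) by ring.
by rewrite addr_ge0 ?sqr_ge0// mulr_ge0// !addr_ge0 ?sqr_ge0.
Qed.

Section moment_constants.
Variable R : realType.

Definition cU : R := 3600 * 8 ^+ 2.
Definition cbad : R := 12 / (phi 2 / 4 / 40) ^+ 2 * 10800.

Lemma cU_ge0 : 0 <= cU.
Proof. exact: mulr_ge0 (ler0n _ _) (sqr_ge0 _). Qed.

Lemma cbad_ge0 : 0 <= cbad.
Proof. exact: mulr_ge0 (divr_ge0 (ler0n _ _) (sqr_ge0 _)) (ler0n _ _). Qed.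

End moment_constants.

(** * A quadratic majorant for the indicator of the bad event *)

Section bad_event.
Variables (R : realType) (d : nat) (A : 'M[R]_d) (sigma cstar : R) (s : nat) (l0 : int).
Let Sig := A *m A^T.
Hypotheses (d0 : (0 < d)%N) (cs0 : 0 < cstar) (Sigc : forall i, cstar <= Sig i i).
Let dR : 0 < d%:R :> R. Proof. by rewrite ltr0n. Qed.
Let y0 : R := 2 ^ l0 / sigma ^+ 2.
Let T := frob (Sigtil Sig).
Let dl1 : R := phi 2 / 4 / 40.

Lemma dl1_gt0 : 0 < dl1. Proof. by rewrite !divr_gt0// phi_gt0. Qed.

Definition devsq (x : 'I_d -> R) := dev x (y0 / 2) ^+ 2 + dev x y0 ^+ 2 + dev x (2 * y0) ^+ 2.
Definition badq (x : 'I_d -> R) := 12 / dl1 ^+ 2 * devsq x.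

Lemma devsq_ge0 x : 0 <= devsq x. Proof. by rewrite !addr_ge0 ?sqr_ge0. Qed.

Lemma badq_ge0 x : 0 <= badq x.
Proof. by apply: mulr_ge0 (devsq_ge0 x); apply: divr_ge0 (sqr_ge0 _). Qed.

Lemma Delta_sq x : Delta x sigma s l0 ^+ 2 <= 2 * (s%:R / d%:R) ^+ 2 + 6 * devsq x.
Proof.
have h := sqr_sum4_le (s%:R / d%:R) `|dev x (y0 / 2)| `|dev x y0| `|dev x (2 * y0)|.
by rewrite !(real_normK (num_real _)) in h; exact: h.
Qed.

(** At most half of [dl1] can come from [s / d], so the deviations account for at least half of
    [dl1 ^+ 2] in the bound on [Delta ^+ 2]; the factor 12 normalizes this to 1. *)
Lemma badq_ge1 x : s%:R / d%:R <= dl1 / 2 -> dl1 < Delta x sigma s l0 -> 1 <= badq x.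
Proof.
move=> sd hD; have p0 := dl1_gt0.
rewrite /badq mulrAC ler_pdivlMr ?exprn_gt0// mul1r.
have s0 : 0 <= s%:R / d%:R :> R by rewrite divr_ge0 ?ler0n.
have h := Delta_sq x.
have h1 : (s%:R / d%:R) ^+ 2 <= (dl1 / 2) ^+ 2.
  by rewrite ler_sqr ?nnegrE//; lra.
have h2 : dl1 ^+ 2 <= Delta x sigma s l0 ^+ 2.
  by rewrite ler_sqr ?nnegrE ?ltW//; exact: lt_trans hD.
have e : (dl1 / 2) ^+ 2 = dl1 ^+ 2 / 4 by field.
rewrite e in h1; move: h h1 h2; set q := dl1 ^+ 2; set r := (_ / _) ^+ 2; lra.
Qed.

Lemma mom_devsq : upE d (fun z => devsq (noise A z)) (10800 * (T ^+ 2 / d%:R ^+ 2)).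
Proof.
have h y := mom_dev d0 cs0 Sigc y.
apply: upE_le (upE_add (upE_add (h (y0 / 2)) (h y0)) (h (2 * y0))) => // .
by rewrite -/T -!mulrDl; apply: ler_wpM2r; [rewrite divr_ge0 ?sqr_ge0|lra].
Qed.

Lemma mom_badq : upE d (fun z => badq (noise A z)) (cbad R * (T ^+ 2 / d%:R ^+ 2)).
Proof.
have -> : cbad R * (T ^+ 2 / d%:R ^+ 2) =
  12 / dl1 ^+ 2 * (10800 * (T ^+ 2 / d%:R ^+ 2)) by rewrite /cbad /dl1; ring.
by apply: upE_scale mom_devsq; apply: divr_ge0 (sqr_ge0 _).
Qed.

End bad_event.

Lemma expR1_le4 (R : realType) : expR 1 <= 4 :> R.
Proof.
have h : expR (-1) >= 1 / 4 :> R.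
  have -> : -1 = -(1 / 2) * 2%:R :> R by field.
  rewrite expRM_natr; have h := expR_ge1Dx (-(1/2) : R).
  apply: le_trans (lerXn2r 2 _ _ h); rewrite ?nnegrE ?expR_ge0//; last by lra.
  by rewrite expr2; lra.
have e : expR 1 * expR (-1) = 1 :> R by rewrite -expRD subrr expR0.
have p := expR_gt0 (1 : R); nra.
Qed.

(** * Dense zone: comparison of the error terms with the rate *)

Section dense_rate.
Variables (R : realType) (d : nat) (A : 'M[R]_d) (cstar : R) (s : nat).
Let Sig := A *m A^T.
Hypotheses (d0 : (0 < d)%N) (s0 : (0 < s)%N) (cs0 : 0 < cstar).
Hypotheses (Sig1 : forall i, Sig i i <= 1) (Sigc : forall i, cstar <= Sig i i).
Hypothesis sF : frob Sig < s%:R.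
Let T := frob (Sigtil Sig).
Let Fr := frob Sig.
Let sR : 0 < s%:R :> R. Proof. by rewrite ltr0n. Qed.
Let T1 : 1 <= T. Proof. exact: frob_Sigtil_ge1 cs0 Sigc. Qed.
Let F0 : 0 < Fr. Proof. exact: frob_Sig_gt0 d0 cs0 Sigc. Qed.
Let cT : cstar * T <= Fr. Proof. exact: frob_Sigtil_le cs0 Sigc. Qed.
Let c1 : cstar <= 1. Proof. exact: cstar_le1 d0 Sig1 Sigc. Qed.
Let l := lam Sig s.
Let l6 : 1 / 6 <= l. Proof. exact: lam_ge. Qed.

Let T_le : T <= s%:R / cstar.
Proof. by rewrite ler_pdivlMr// mulrC; apply: le_trans cT (ltW sF). Qed.

Let ns : (s%:R <= frob Sig) = false. Proof. by rewrite leNgt sF. Qed.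

(** When the logarithm is the maximum in [lam], the left side is exactly [s]. Otherwise the
    exponential is [expR 1] and [T <= s / cstar] is used. *)
Lemma T_exp_lam : T * expR (6 * l) <= 4 / cstar * s%:R.
Proof.
have T0 : 0 < T by have := T1; lra.
have -> : 6 * l = Num.max 1 (ln (s%:R / T)) by rewrite /l /lam -/T; field.
have ic : 1 <= cstar^-1 by rewrite invf_ge1.
rewrite /Num.max; case: ifP => _.
  rewrite lnK ?posrE ?divr_gt0// mulrCA divff ?gt_eqF// mulr1 ler_peMl ?ler0n//; lra.
have e4 := expR1_le4 R; have tl := T_le.
have -> : 4 / cstar * s%:R = s%:R / cstar * 4 by ring.
by apply: ler_pM => //; exact: ltW.
Qed.

(** Both branches of the maximum give it: [frob Sig < s] for the constant, and [ln u <= u] for the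
    logarithm. *)
Lemma psi_ge_Fr : Fr <= psistar s Sig.
Proof.
rewrite /psistar ns ler_pdivlMr; last by rewrite lt_max ltr01.
rewrite (maxr_pMr _ _ (ltW F0)) ge_max mulr1 (ltW sF)/=.
have h := ltW (ln_sublinear (divr_gt0 sR F0)).
apply: le_trans (ler_wpM2l (ltW F0) h) _.
by rewrite mulrCA divff ?gt_eqF// mulr1.
Qed.

Lemma psi_ge_T : T <= psistar s Sig / cstar.
Proof.
rewrite ler_pdivlMr// mulrC; exact: le_trans cT psi_ge_Fr.
Qed.

(** [lam] is built on [frob (Sigtil Sig)], the rate on [frob Sig]; passing from one to the other
    costs at most [ln cstar^-1] inside the maximum. *)
Lemma psi_ge_lam : s%:R / l <= 6 * (1 + ln cstar^-1) * psistar s Sig.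
Proof.
have T0 : 0 < T by have := T1; lra.
have l0 : 0 < l by have := l6; lra.
have lc : 0 <= ln cstar^-1 by rewrite ln_ge0// invf_ge1.
rewrite /psistar ns; set m := Num.max _ _.
have m0 : 0 < m by rewrite lt_max ltr01.
have hm : m <= 6 * (1 + ln cstar^-1) * l.
  have -> : 6 * (1 + ln cstar^-1) * l = 6 * l * (1 + ln cstar^-1) by ring.
  have e : 6 * l = Num.max 1 (ln (s%:R / T)) by rewrite /l /lam -/T; field.
  have l1 : 1 <= 6 * l by rewrite e le_max lexx.
  have l2 : ln (s%:R / T) <= 6 * l by rewrite e le_max lexx orbT.
  have : ln (s%:R / Fr) <= ln (s%:R / T) + ln cstar^-1.
    rewrite -lnM ?posrE ?divr_gt0 ?invr_gt0//.
    rewrite ler_ln ?posrE ?divr_gt0 ?mulr_gt0 ?divr_gt0 ?invr_gt0//.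
    rewrite -mulrA -invfM ler_pM2l// lef_pV2 ?posrE ?mulr_gt0//.
    by rewrite mulrC; exact: cT.
  rewrite /m => h; rewrite ge_max; apply/andP; split; nra.
rewrite mulrA ler_pdivrMr// mulrAC ler_pdivlMr//.
have -> : 6 * (1 + ln cstar^-1) * s%:R * l = s%:R * (6 * (1 + ln cstar^-1) * l) by ring.
by rewrite ler_pM2l.
Qed.

End dense_rate.

(** * Moments of the relative noise of the characteristic function *)

Section nu_moment.
Variables (R : realType) (d : nat) (A : 'M[R]_d) (theta : 'I_d -> R) (sigma cstar : R) (s : nat).
Let Sig := A *m A^T.
Hypotheses (d0 : (0 < d)%N) (s0 : (0 < s)%N) (cs0 : 0 < cstar) (sigma0 : 0 < sigma).
Hypotheses (Sig1 : forall i, Sig i i <= 1) (Sigc : forall i, cstar <= Sig i i).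
Hypothesis theta_s : (l0norm theta <= s)%N.
Hypothesis sF : frob Sig < s%:R.
Hypothesis sd : (s <= d)%N.
Let T := frob (Sigtil Sig).
Let Fr := frob Sig.
Let dR : 0 < d%:R :> R. Proof. by rewrite ltr0n. Qed.
Let sR : 0 < s%:R :> R. Proof. by rewrite ltr0n. Qed.
Let l := lam Sig s.
Let l6 : 1 / 6 <= l. Proof. exact: lam_ge. Qed.
Let l0 : 0 < l. Proof. by have := l6; lra. Qed.
Let T0 : 0 < T. Proof. by have := frob_Sigtil_ge1 d0 cs0 Sigc; rewrite -/T; lra. Qed.
Let ci0 : 0 < cstar^-1. Proof. by rewrite invr_gt0. Qed.

Definition cnu : R := 4 * cstar^-1 * (3600 * cstar^-1 + 400).
Lemma cnu_ge0 : 0 <= cnu.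
Proof.
apply: mulr_ge0; first exact: mulr_ge0 (ler0n _ _) (ltW ci0).
exact: addr_ge0 (mulr_ge0 (ler0n _ _) (ltW ci0)) (ler0n _ _).
Qed.

(** Division by the Gaussian value multiplies second moments by [expR (l / y)]. The numerator has
    second moment of order [s * T], and the choice of [lam] makes [T * expR (l / y)] at most of
    order [s / l]. *)
Lemma mom_nu y : 9 / 32 < y ->
  upE d (fun z => nu Sig theta (noise A z) sigma s y ^+ 2) (cnu * ((s%:R / d%:R) ^+ 2 / l)).
Proof.
move=> y9; have y0 : 0 < y by lra.
pose E := expR (l / y).
have E0 : 0 < E := expR_gt0 _.
have c0 : 0 <= 2 * E / d%:R ^+ 2 by apply: divr_ge0 (sqr_ge0 _); apply: mulr_ge0 (ltW E0).
have h1 := mom_Nev theta sigma s cs0 Sigc y.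
have h2 := mom_Nod sigma cs0 Sigc theta_s y.
apply: upE_le (upE_scale c0 (upE_add h1 h2)) => [z|].
  rewrite /nu -/Sig; set a := Nev _ _ _ _ _ _; set b := Nod _ _ _ _ _ _.
  have -> : E = (expR (- (av Sig s y ^+ 2 / 2)))^-1 ^+ 2.
    rewrite -expRN opprK -expRM_natr /E; congr expR.
    have ly : 0 <= l / y by apply: divr_ge0; exact: ltW.
    by rewrite /av -/l sqr_sqrtr//; field; rewrite gt_eqF.
  set f := expR _; have f0 : 0 < f := expR_gt0 _.
  have -> : ((`|a| + `|b|) / (d%:R * f)) ^+ 2 = (`|a| + `|b|) ^+ 2 * (f^-1 ^+ 2 / d%:R ^+ 2).
    by field; rewrite !gt_eqF.
  have -> : 2 * f^-1 ^+ 2 / d%:R ^+ 2 * (a ^+ 2 + b ^+ 2) =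
     (2 * (a ^+ 2 + b ^+ 2)) * (f^-1 ^+ 2 / d%:R ^+ 2) by ring.
  apply: ler_wpM2r; first by rewrite divr_ge0 ?sqr_ge0.
  rewrite -(real_normK (num_real a)) -(real_normK (num_real b)).
  by have := sqr_ge0 (`|a| - `|b|); nra.
rewrite -/Sig -/T.
have cT := frob_Sigtil_le cs0 Sigc; rewrite -/Sig -/T in cT.
have Ts : T <= cstar^-1 * s%:R by rewrite ler_pdivlMl//; apply: le_trans cT (ltW sF).
have El : E <= expR (4 * l).
  rewrite ler_expR ler_pdivrMr//; have := l0; nra.
have TE := T_exp_lam d0 s0 cs0 Sig1 Sigc sF; rewrite -/Sig -/T -/l in TE.
have e2 : expR (4 * l) * (2 * l) <= expR (6 * l).
  have -> : 6 * l = 4 * l + 2 * l by ring.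
  rewrite expRD; apply: ler_wpM2l; first exact: expR_ge0.
  by have := expR_ge1Dx (2 * l); lra.
have TE4 : T * E <= 2 * cstar^-1 * s%:R / l.
  rewrite ler_pdivlMr//.
  have k1 : T * E * l <= T * expR (4 * l) * l by rewrite ler_pM2r// ler_pM2l.
  have k2 : T * (expR (4 * l) * (2 * l)) <= T * expR (6 * l) by rewrite ler_pM2l.
  by lra.
have k3 : 3600 * T ^+ 2 + 400 * (s%:R * T) <= (3600 * cstar^-1 + 400) * (s%:R * T).
  have : T * T <= cstar^-1 * s%:R * T by rewrite ler_pM2r.
  by rewrite expr2; lra.
have k4 : 0 <= E * (2 / d%:R ^+ 2).
  by apply: mulr_ge0; [exact: ltW|apply: divr_ge0 (sqr_ge0 _)].
have -> : 2 * E / d%:R ^+ 2 * (3600 * T ^+ 2 + 400 * (s%:R * T)) =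
   E * (2 / d%:R ^+ 2) * (3600 * T ^+ 2 + 400 * (s%:R * T)) by ring.
apply: le_trans (ler_wpM2l k4 k3) _.
pose K := 2 / d%:R ^+ 2 * (3600 * cstar^-1 + 400) * s%:R.
have K0 : 0 <= K.
  apply: mulr_ge0 (ler0n _ _); apply: mulr_ge0; first exact: divr_ge0 (ler0n _ _) (sqr_ge0 _).
  exact: addr_ge0 (mulr_ge0 (ler0n _ _) (ltW ci0)) (ler0n _ _).
have -> : E * (2 / d%:R ^+ 2) * ((3600 * cstar^-1 + 400) * (s%:R * T)) = K * (T * E).
  by rewrite /K; ring.
apply: le_trans (ler_wpM2l K0 TE4) _.
rewrite le_eqVlt; apply/orP; left; apply/eqP; rewrite /K /cnu.
by field; rewrite !gt_eqF.
Qed.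

Definition derr z y := d%:R * (5 / l * (2 * (s%:R / d%:R) + nu Sig theta (noise A z) sigma s y)
  + 52 * nu Sig theta (noise A z) sigma s y ^+ 2).

Lemma derr_ge0 z y : 0 <= derr z y.
Proof.
apply: mulr_ge0; first exact: ler0n.
apply: addr_ge0; last exact: mulr_ge0 (sqr_ge0 _).
apply: mulr_ge0; first by apply: divr_ge0 (ltW l0).
apply: addr_ge0 (nu_ge0 _ _ _ _ _ _); apply: mulr_ge0 => //; apply: divr_ge0; exact: ler0n.
Qed.

(** The term linear in [nu] is turned into a square, weighted so that the constant left over is
    [5 / 2 * (s / l)], the size of the bias term. *)
Lemma mom_derr y : 9 / 32 < y -> upE d (fun z => derr z y) ((25 / 2 + 67 * cnu) * (s%:R / l)).
Proof.
move=> y9; have h := mom_nu y9.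
have sl0 : 0 <= 25 / 2 * (s%:R / l) by apply: mulr_ge0 => //; apply: divr_ge0 (ltW _).
pose K : R := 5 * d%:R ^+ 2 / (2 * l * s%:R) + 52 * d%:R.
have K0 : 0 <= K.
  apply: addr_ge0; last exact: mulr_ge0.
  apply: divr_ge0 (mulr_ge0 (ler0n _ _) (sqr_ge0 _)) _.
  exact: mulr_ge0 (mulr_ge0 (ler0n _ _) (ltW l0)) (ler0n _ _).
apply: upE_le (upE_add (upE_cst d sl0) (upE_scale K0 h)) => [z|].
  rewrite /derr; set v := nu _ _ _ _ _ _.
  have -> : d%:R * (5 / l * (2 * (s%:R / d%:R) + v) + 52 * v ^+ 2) =
    25 / 2 * (s%:R / l) + K * v ^+ 2 - 5 / (2 * l * s%:R) * (s%:R - d%:R * v) ^+ 2.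
    by rewrite /K; field; rewrite !gt_eqF.
  rewrite gerBl; apply: mulr_ge0 (sqr_ge0 _); apply: divr_ge0 => //.
  exact: mulr_ge0 (mulr_ge0 (ler0n _ _) (ltW l0)) (ler0n _ _).
have sdR : s%:R / d%:R <= 1 :> R by rewrite ler_pdivrMr// mul1r ler_nat.
have e : K * (cnu * ((s%:R / d%:R) ^+ 2 / l)) =
   (5 / 2 * l^-1 + 52 * (s%:R / d%:R)) * (cnu * (s%:R / l)).
  by rewrite /K; field; rewrite !gt_eqF.
rewrite e [leRHS]mulrDl lerD2l -[leRHS]mulrA; apply: ler_wpM2r.
  exact: mulr_ge0 cnu_ge0 (divr_ge0 (ler0n _ _) (ltW l0)).
have : l^-1 <= 6 by rewrite invf_ple ?posrE//; have := l6; lra.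
by lra.
Qed.

End nu_moment.

Section constants.
Variables (R : realType) (cstar : R).

Definition cdense : R := 8 + (1 + cU R + 2 * (97 * cbad R + 32 * cU R)) * cstar^-1
  + 24 * (25 / 2 + 67 * cnu cstar) * (1 + ln cstar^-1).

Lemma phi2_le : phi 2 / 4 <= 1 / 9 :> R.
Proof.
have /andP[_ h] := phi0_bounds R.
have : phi 2 <= phi (0 : R).
  by rewrite (phi_le0 2) ler_piMr ?phi_ge0// -[leRHS]expR0 ler_expR; lra.
by lra.
Qed.

End constants.

(** * Dense zone: the risk bound *)

Section dense_final.
Variables (R : realType) (d : nat) (A : 'M[R]_d) (theta : 'I_d -> R) (sigma cstar : R) (s : nat).
Let Sig := A *m A^T.
Hypotheses (d0 : (0 < d)%N) (s0 : (0 < s)%N) (cs0 : 0 < cstar) (sigma0 : 0 < sigma).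
Hypotheses (Sig1 : forall i, Sig i i <= 1) (Sigc : forall i, cstar <= Sig i i).
Hypothesis theta_s : (l0norm theta <= s)%N.
Hypothesis sF : frob Sig < s%:R.
Hypothesis sd : s%:R / d%:R <= phi 2 / 4 / 40 / 2 :> R.
Let T := frob (Sigtil Sig).
Let Fr := frob Sig.
Let dR : 0 < d%:R :> R. Proof. by rewrite ltr0n. Qed.
Let sR : 0 < s%:R :> R. Proof. by rewrite ltr0n. Qed.
Let s2 : 0 < sigma ^+ 2. Proof. by rewrite exprn_gt0. Qed.
Let sd8 : s%:R / d%:R <= 1 / 8 :> R.
Proof. by have := phi2_le R; have := sd; lra. Qed.
Let sd1 : (s <= d)%N.
Proof. by rewrite -(ler_nat R) -[d%:R]mul1r -ler_pdivrMr//; have := sd8; lra. Qed.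
Let Sig0 i : 0 < Sig i i. Proof. exact: lt_le_trans (Sigc i). Qed.
Let T1 : 1 <= T. Proof. exact: frob_Sigtil_ge1 d0 cs0 Sigc. Qed.
Let l := lam Sig s.
Notation err z := ((Nstar Sig s (Ymodel Sig theta (noise A z) sigma) - l2norm theta) ^+ 2).

Section pointwise.
Variable l0 : int.
Let y0 : R := 2 ^ l0 / sigma ^+ 2.
Hypothesis y0_bounds : 9 / 32 < y0 <= 9 / 16.

(** One inequality for all outcomes. Both [y0] and [2 * y0] occur because [that] may select either;
    each summand is nonnegative, so those of the other cases can be added. *)
Let sigD2_err z :
  d%:R * `|sigma ^+ 2 - sigD2 Sig s (Ymodel Sig theta (noise A z) sigma)| <=
  sigma ^+ 2 * (derr A theta sigma s z y0 + derr A theta sigma s z (2 * y0)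
     + 97 * d%:R * badq sigma l0 (noise A z) + 32 / d%:R * Usum (noise A z) ^+ 2).
Proof.
have /andP[yl yu] := y0_bounds.
have D1 := derr_ge0 A theta sigma s z y0.
have D2 := derr_ge0 A theta sigma s z (2 * y0).
have B0 := badq_ge0 sigma l0 (noise A z).
have U0 : 0 <= 32 / d%:R * Usum (noise A z) ^+ 2.
  exact: mulr_ge0 (divr_ge0 (ler0n _ _) (ler0n _ _)) (sqr_ge0 _).
have dB0 : 0 <= 97 * d%:R * badq sigma l0 (noise A z).
  exact: mulr_ge0 (mulr_ge0 (ler0n _ _) (ler0n _ _)) B0.
have [good|bad] := leP (Delta (noise A z) sigma s l0) (phi 2 / 4 / 40).
  have h10 := sigS2_good10 d0 Sig0 sigma0 theta_s y0_bounds good.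
  have key y : 0 < y -> y <= 9 / 8 ->
      that Sig (Ymodel Sig theta (noise A z) sigma) = sigma ^+ 2 * y ->
      d%:R * `|sigma ^+ 2 - sigD2 Sig s (Ymodel Sig theta (noise A z) sigma)| <=
      sigma ^+ 2 * derr A theta sigma s z y.
    move=> yp y8 tE; rewrite /derr mulrCA ler_pM2l//.
    exact: (sigD2_good d0 Sig0 sigma0 theta_s yp y8 tE sd8 h10).
  case: (that_good d0 Sig0 sigma0 theta_s y0_bounds good) => tE.
    apply: le_trans (key y0 _ _ tE) _; [lra|lra|].
    by rewrite ler_pM2l//; move: D1 D2 U0 dB0; lra.
  apply: le_trans (key (2 * y0) _ _ tE) _; [lra|lra|].
  by rewrite ler_pM2l//; move: D1 D2 U0 dB0; lra.
have b1 := badq_ge1 sd bad.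
apply: le_trans (ler_wpM2l (ltW dR) (sigD2_bad (noise A z) d0 Sig0 sigma0 theta_s sd8)) _.
rewrite mulrCA ler_pM2l//.
have e : 32 / d%:R * Usum (noise A z) ^+ 2 = d%:R * (32 * (`|Usum (noise A z)| / d%:R) ^+ 2).
  rewrite -(real_normK (num_real (Usum (noise A z)))); field; by rewrite gt_eqF.
rewrite e; set u := `|_| / _.
have -> : 97 * d%:R * badq sigma l0 (noise A z) = d%:R * (97 * badq sigma l0 (noise A z)) by ring.
(* Here [badq >= 1], and [64 * u <= 32 + 32 * u ^+ 2]; the constants combine to 97. *)
have h : 65 + 64 * u <= 97 * badq sigma l0 (noise A z) + 32 * u ^+ 2.
  have := sqr_ge0 (u - 1); rewrite sqrrB1 => h; lra.
have := ler_wpM2l (ltW dR) h; rewrite [X in _ <= X -> _]mulrDr; lra.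
Qed.

(** [|Vsum|] is replaced by [T] plus [Vsum ^+ 2 / T], balanced because [T] is the order of its
    standard deviation. Bad-event terms have size [T ^+ 2 / d], at most [T]. *)
Lemma mom_dense :
  upE d (fun z => err z) (sigma ^+ 2 * (8 * Fr + (1 + cU R + 2 * (97 * cbad R + 32 * cU R)) * T
    + 4 * (25 / 2 + 67 * cnu cstar) * (s%:R / l))).
Proof.
have T0 : 0 < T by have := T1; lra.
have /andP[yl yu] := y0_bounds.
have Td : T <= d%:R := frob_Sigtil_le_d cs0 Sigc.
have hL := mom_Lsum theta cs0 Sigc.
have hV := mom_Vsum cs0 Sig1 Sigc; rewrite -/Sig -/T -/(cU R) in hV.
have hU := mom_Usum cs0 Sigc; rewrite -/Sig -/T -/(cU R) in hU.
have hB := mom_badq sigma l0 d0 cs0 Sigc; rewrite -/Sig -/T in hB.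
have hy1 : 9 / 32 < y0 by [].
have hy2 : 9 / 32 < 2 * y0 by lra.
have hD1 := mom_derr sigma d0 s0 cs0 Sig1 Sigc theta_s sF sd1 hy1.
have hD2 := mom_derr sigma d0 s0 cs0 Sig1 Sigc theta_s sF sd1 hy2.
have p1 : 0 <= 8 * sigma ^+ 2 := mulr_ge0 (ler0n _ _) (ltW s2).
have p2 : 0 <= sigma ^+ 2 * T := mulr_ge0 (ltW s2) (ltW T0).
have p3 : 0 <= sigma ^+ 2 / T := divr_ge0 (ltW s2) (ltW T0).
have p4 : 0 <= 2 * sigma ^+ 2 := mulr_ge0 (ler0n _ _) (ltW s2).
have p5 : 0 <= 97 * d%:R :> R := mulr_ge0 (ler0n _ _) (ler0n _ _).
have p6 : 0 <= 32 / d%:R :> R := divr_ge0 (ler0n _ _) (ler0n _ _).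
have H := upE_add (upE_add (upE_scale p1 hL) (upE_add (upE_cst d p2) (upE_scale p3 hV)))
  (upE_scale p4 (upE_add (upE_add (upE_add hD1 hD2) (upE_scale p5 hB)) (upE_scale p6 hU))).
apply: upE_le H => [z|].
  have ns : ~~ (s%:R <= frob Sig) by rewrite -ltNge.
  apply: le_trans (dense_err theta (noise A z) Sig0 sigma0 Sig1 ns) _.
  apply: lerD; last first.
    by rewrite -[leRHS]mulrA ler_pM2l//; exact: sigD2_err.
  rewrite lerD2l; set v := Vsum _ _.
  have -> : sigma ^+ 2 * T + sigma ^+ 2 / T * v ^+ 2 =
    2 * sigma ^+ 2 * `|v| + sigma ^+ 2 / T * (T - `|v|) ^+ 2.
    by rewrite -(real_normK (num_real v)); field; rewrite gt_eqF.
  by rewrite lerDl; exact: mulr_ge0 p3 (sqr_ge0 _).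
rewrite -/Fr -/l.
have TT : T ^+ 2 / d%:R <= T by rewrite ler_pdivrMr// expr2 ler_pM2l.
have c1 := cU_ge0 R; have c2 := cbad_ge0 R.
move: (cU R) (cbad R) (25 / 2 + 67 * cnu cstar) c1 c2 => u b k u0 b0.
have k1 : 0 <= u * (T - T ^+ 2 / d%:R) by apply: mulr_ge0 => //; rewrite subr_ge0.
have k2 : 0 <= b * (T - T ^+ 2 / d%:R) by apply: mulr_ge0 => //; rewrite subr_ge0.
rewrite -subr_ge0.
have -> : sigma ^+ 2 * (8 * Fr + (1 + u + 2 * (97 * b + 32 * u)) * T + 4 * k * (s%:R / l)) -
  (8 * sigma ^+ 2 * Fr + (sigma ^+ 2 * T + sigma ^+ 2 / T * (u * T ^+ 2)) +
   2 * sigma ^+ 2 * (k * (s%:R / l) + k * (s%:R / l) + 97 * d%:R * (b * (T ^+ 2 / d%:R ^+ 2)) +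
     32 / d%:R * (u * T ^+ 2))) =
  sigma ^+ 2 * (194 * (b * (T - T ^+ 2 / d%:R)) + 64 * (u * (T - T ^+ 2 / d%:R))).
  have ln0 : l != 0 by rewrite gt_eqF//; have := lam_ge Sig s; rewrite -/l; lra.
  by field; rewrite ln0 !gt_eqF.
apply: mulr_ge0 (ltW s2) _.
exact: addr_ge0 (mulr_ge0 (ler0n _ _) k2) (mulr_ge0 (ler0n _ _) k1).
Qed.

End pointwise.

Lemma dense_bound :
  (Expect theta sigma A (fun Y => ((Nstar Sig s Y - l2norm theta) ^+ 2)%R)
     <= (cdense cstar * sigma ^+ 2 * psistar s Sig)%:E)%E.
Proof.
have [l0 hl0] : exists l0 : int, 9 / 32 < 2 ^ l0 / sigma ^+ 2 <= 9 / 16.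
  have p : 0 < sigma ^+ 2 * (9 / 32) by rewrite mulr_gt0//; lra.
  have [l0 /andP[h1 h2]] := pow2_exists p; exists l0.
  by rewrite ltr_pdivlMr// ler_pdivrMr//; apply/andP; split; lra.
have H := mom_dense hl0.
rewrite /Expect.
have -> : (fun z => ((Nstar Sig s (Yobs theta sigma A z) - l2norm theta) ^+ 2)%:E) =
  (fun z => (err z)%:E).
  by apply/funext => z; rewrite (YobsE theta sigma cs0 Sigc).
apply: upE_gauss_int => [z|]; first exact: sqr_ge0.
apply: upE_le H => //.
have g1 := psi_ge_Fr d0 s0 cs0 Sigc sF; have g2 := psi_ge_T d0 s0 cs0 Sigc sF.
have g3 := psi_ge_lam d0 s0 cs0 Sig1 Sigc sF.
rewrite -/Sig -/T -/Fr -/l in g1 g2 g3.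
have -> : cdense cstar * sigma ^+ 2 * psistar s Sig = sigma ^+ 2 * (cdense cstar * psistar s Sig).
  by ring.
rewrite ler_pM2l// /cdense.
have c1 := cU_ge0 R; have c2 := cbad_ge0 R.
set K1 := 1 + cU R + _; set K2 := 25 / 2 + _.
have K10 : 0 <= K1.
  apply: addr_ge0; first by rewrite addr_ge0.
  by apply: mulr_ge0 => //; exact: addr_ge0 (mulr_ge0 (ler0n _ _) c2) (mulr_ge0 (ler0n _ _) c1).
have K20 : 0 <= 4 * K2.
  apply: mulr_ge0 => //; apply: addr_ge0; first by lra.
  exact: mulr_ge0 (ler0n _ _) (cnu_ge0 cs0).
have h2 := ler_wpM2l K10 g2; have h3 := ler_wpM2l K20 g3.
clear K10 K20.
move: g1 h2 h3; set p := psistar _ _; move: K1 K2 (ln _) (s%:R / l) => K1 K2 q r g1 h2 h3.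
have -> : (8 + K1 * cstar^-1 + 24 * K2 * (1 + q)) * p =
  8 * p + K1 * (p / cstar) + 4 * K2 * (6 * (1 + q) * p) by ring.
by lra.
Qed.

End dense_final.

Section sparse_constants.
Variables (R : realType) (cstar : R).

Definition cG : R := 3600 * 40 ^+ 2.
Definition cD : R := 16 / (phi 2 / 4) ^+ 2 * (2 + (6 * 10800) * cstar^-1 ^+ 2).
Definition cgood : R := 2 * (567 + 248 * cD + 3 * (cG * cstar^-1 ^+ 2)) + 45.
Definition cE : R := (66 * 1000) * (3 / 2 * cbad R + cU R / 2) * cstar^-1 ^+ 2.

Lemma cG_ge0 : 0 <= cG. Proof. exact: mulr_ge0 (ler0n _ _) (sqr_ge0 _). Qed.

Lemma cD_ge0 : 0 <= cD.
Proof.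
apply: mulr_ge0; first exact: divr_ge0 (ler0n _ _) (sqr_ge0 _).
exact: addr_ge0 (ler0n _ _) (mulr_ge0 (mulr_ge0 (ler0n _ _) (ler0n _ _)) (sqr_ge0 _)).
Qed.

Lemma cgood_gt0 : 0 < cgood.
Proof.
have h1 := cD_ge0; have h2 := mulr_ge0 cG_ge0 (sqr_ge0 cstar^-1).
by rewrite /cgood; move: cD (cG * _) h1 h2 => a b a0 b0; lra.
Qed.

Lemma cE_ge0 : 0 <= cE.
Proof.
apply: mulr_ge0 (sqr_ge0 _); apply: mulr_ge0; first exact: mulr_ge0 (ler0n _ _) (ler0n _ _).
by have := cbad_ge0 R; have := cU_ge0 R; lra.
Qed.

End sparse_constants.

Lemma sum_quarter_pow (R : realType) n : \sum_(j < n) (4 ^+ j)^-1 <= 2 :> R.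
Proof.
have : \sum_(j < n) (4 ^+ j)^-1 <= 2 - 2 * (4 ^+ n)^-1 :> R.
  elim: n => [|n IH]; first by rewrite big_ord0 expr0 invr1; lra.
  rewrite big_ord_recr/=; have : 0 < (4 ^+ n)^-1 :> R by rewrite invr_gt0 exprn_gt0.
  by rewrite exprS invfM; lra.
have : 0 < (4 ^+ n)^-1 :> R by rewrite invr_gt0 exprn_gt0.
by move=> h1 h2; lra.
Qed.

(** The least [j] that covers [D] overshoots by a factor of at most 2, or is 0; an index of at most
    the truncation of [x^-1] plus 1 always works, so the list of widths is finite and
    deterministic. *)
Lemma dyadic_cover (R : realType) (x D : R) : 0 < x -> 0 <= D -> D <= 1 ->
  exists j, [/\ (j < (Num.truncn x^-1).+2)%N, D <= 2 ^+ j * x & 2 ^+ j * x <= x + 2 * D].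
Proof.
move=> x0 D0 D1.
have big : 1 <= 2 ^+ (Num.truncn x^-1).+1 * x.
  rewrite -ler_pdivrMr// mul1r; apply: ltW; apply: lt_le_trans (truncnS_gt _) _.
  by rewrite -natrX ler_nat ltnW// ltn_expl.
have exj : exists j, D <= 2 ^+ j * x by exists (Num.truncn x^-1).+1; exact: le_trans D1 big.
have [j hj jmin] := ex_minnP exj; exists j; split => //.
  by rewrite ltnS; apply: jmin; exact: le_trans D1 big.
clear big exj; case: j hj jmin => [|j] hj jmin; first by rewrite expr0 mul1r lerDl mulr_ge0.
have h : 2 ^+ j * x < D by rewrite ltNge; apply/negP => /jmin; rewrite ltnn.
rewrite exprS -mulrA; apply: le_trans (_ : 2 * D <= _); first by rewrite ler_pM2l// ltW.
by rewrite lerDr ltW.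
Qed.

(** * Sparse zone: peeling over threshold errors, risk bound and probability bound *)

Section sparse_final.
Variables (R : realType) (d : nat) (A : 'M[R]_d) (theta : 'I_d -> R) (sigma cstar : R) (s : nat).
Let Sig := A *m A^T.
Hypotheses (d0 : (0 < d)%N) (s0 : (0 < s)%N) (cs0 : 0 < cstar) (sigma0 : 0 < sigma).
Hypotheses (Sig1 : forall i, Sig i i <= 1) (Sigc : forall i, cstar <= Sig i i).
Hypothesis theta_s : (l0norm theta <= s)%N.
Hypothesis sF : s%:R <= frob Sig.
Hypothesis sd : s%:R / d%:R <= phi 2 / 4 / 40 / 2 :> R.
Let T := frob (Sigtil Sig).
Let Fr := frob Sig.
Let dR : 0 < d%:R :> R. Proof. by rewrite ltr0n. Qed.
Let sR : 0 < s%:R :> R. Proof. by rewrite ltr0n. Qed.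
Let s2 : 0 < sigma ^+ 2. Proof. by rewrite exprn_gt0. Qed.
Let sd8 : s%:R / d%:R <= 1 / 8 :> R.
Proof. by have := phi2_le R; have := sd; lra. Qed.
Let Sig0 i : 0 < Sig i i. Proof. exact: lt_le_trans (Sigc i). Qed.
Let T1 : 1 <= T. Proof. exact: frob_Sigtil_ge1 d0 cs0 Sigc. Qed.
Let F0 : 0 < Fr. Proof. exact: frob_Sig_gt0 d0 cs0 Sigc. Qed.
Let TF : T <= cstar^-1 * Fr.
Proof. by rewrite ler_pdivlMl//; exact: frob_Sigtil_le cs0 Sigc. Qed.
Let T2F : T ^+ 2 <= cstar^-1 ^+ 2 * Fr ^+ 2.
Proof.
have T0 : 0 <= T by have := T1; lra.
by rewrite -exprMn ler_sqr ?nnegrE//; exact: le_trans T0 TF.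
Qed.
Notation err z := ((Nstar Sig s (Ymodel Sig theta (noise A z) sigma) - l2norm theta) ^+ 2).

Let L := ln (1 + Fr ^+ 2 / s%:R ^+ 2).
Let kap := expR (- (tau Sig s ^+ 2 / 18)).
Let q1 : 1 <= Fr ^+ 2 / s%:R ^+ 2.
Proof. by rewrite ler_pdivlMr ?exprn_gt0// mul1r ler_sqr ?nnegrE ?ler0n// ltW. Qed.

Lemma ln_rate_ge : 1 / 2 <= L.
Proof.
rewrite -ler_expR lnK ?posrE; last by have := q1; lra.
apply: le_trans (_ : 2 <= _); last by have := q1; lra.
have e : expR (1 / 2) * expR (1 / 2) = expR 1 :> R by rewrite -expRD; congr expR; field.
have h := expR1_le4 R; have p := expR_gt0 (1 / 2 : R); nra.
Qed.

Lemma tau_sq : tau Sig s ^+ 2 = 9 * L.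
Proof.
have := ln_rate_ge => L0; rewrite /tau -/Fr -/L.
have -> : (3 * Num.sqrt L) ^+ 2 = 9 * Num.sqrt L ^+ 2 by ring.
by rewrite sqr_sqrtr//; lra.
Qed.

Let kap0 : 0 < kap := expR_gt0 _.
Let B := Fr * kap.
Let B0 : 0 < B. Proof. exact: mulr_gt0. Qed.

(** Since [tau ^+ 2] is 9 times the logarithm, [kap ^+ 2] is exactly the inverse of
    [1 + Fr ^+ 2 / s ^+ 2]. *)
Lemma frob_kap_le : B <= s%:R.
Proof.
suff : B ^+ 2 <= s%:R ^+ 2 by rewrite ler_sqr// ?nnegrE ?ler0n// ltW.
have k2 : kap ^+ 2 * (1 + Fr ^+ 2 / s%:R ^+ 2) = 1.
  have <- : expR L = 1 + Fr ^+ 2 / s%:R ^+ 2 by rewrite lnK ?posrE//; have := q1; lra.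
  by rewrite -expRM_natr -expRD tau_sq -[RHS]expR0; congr expR; field.
have e : B ^+ 2 = s%:R ^+ 2 * (kap ^+ 2 * (1 + Fr ^+ 2 / s%:R ^+ 2) - kap ^+ 2).
  by rewrite /B; field; rewrite gt_eqF.
rewrite e k2; have := sqr_ge0 kap; have := sqr_ge0 (s%:R : R).
by move: (kap ^+ 2) (s%:R ^+ 2) => a b ? ?; nra.
Qed.

Lemma kap_le1 : kap <= 1.
Proof. by rewrite -[leRHS]expR0 ler_expR oppr_le0 divr_ge0 ?sqr_ge0. Qed.

Let psiE : psistar s Sig = s%:R * L.
Proof. by rewrite /psistar sF. Qed.

Lemma s_le_psi : s%:R <= 2 * psistar s Sig.
Proof. by rewrite psiE; have := ln_rate_ge; have := sR; nra. Qed.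

(** The typical relative error of [sigS2], up to constants: the deviations of the empirical c.d.f.
    are of order [T / d], and [s / d <= Fr / d] in this zone. *)
Let dl0 := Fr / d%:R.
Let dl0_gt0 : 0 < dl0. Proof. exact: divr_gt0. Qed.
Let dlk j := Num.min (2 ^+ j * dl0) (1 / 10).

Let N := Num.truncn (dl0^-1).
(** The weights [4 ^- j] make the sum of second moments independent of the number of scales, at the
    price of a factor [4 ^ j] at the selected scale. *)
Definition peel z := \sum_(j < N.+2) (4 ^+ j)^-1 * (Mc A s (dlk j) z ^+ 2 / B).

(** The random [D] is covered by the dyadic width of some [j], where [2 * |Mc|] is at most
    [Mc ^+ 2 / (4 ^ j * B) + 4 ^ j * B]. As [2 ^ j * dl0] is at most [dl0 + 2 * D], the price
    [4 ^ j] is of order [1 + D ^+ 2 / dl0 ^+ 2], an integrable quantity. *)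
Lemma peel_le z D : 0 <= D <= 1 / 10 ->
  2 * Msum Sig (noise A z) s D <= peel z + B * (322 + 168 * (D ^+ 2 / dl0 ^+ 2)).
Proof.
move=> /andP[D0 D1].
have D1' : D <= 1 by lra.
have [j [jN hj up]] := dyadic_cover dl0_gt0 D0 D1'.
have p0 : 0 < 2 ^+ j * dl0 by rewrite mulr_gt0// exprn_gt0.
have Dk : D <= dlk j by rewrite /dlk le_min hj D1.
have kb : 0 <= dlk j <= 1 / 10.
  by rewrite (le_trans D0 Dk)/= /dlk ge_min lexx orbT.
have m1 := Msum_le (noise A z) s Sig0 Dk.
have m2 := Msum_Mc s cs0 Sig1 Sigc z kb; rewrite -/Sig -/kap in m2.
have m3 : 80 * dlk j * kap * d%:R <= 80 * (dl0 + 2 * D) * kap * d%:R.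
  rewrite !ler_pM2r//; apply: ler_wpM2l => //; apply: le_trans up.
  by rewrite /dlk ge_min lexx.
pose P : R := 4 ^+ j; have P0 : 0 < P by rewrite exprn_gt0.
have Pe : P * dl0 ^+ 2 = (2 ^+ j * dl0) ^+ 2.
  have -> : P = (2 ^+ j) ^+ 2.
    have e4 : 4 = 2 ^+ 2 :> R by rewrite expr2; ring.
    by rewrite /P e4 -!exprM mulnC.
  by rewrite -exprMn.
have P1 : P <= 2 + 8 * (D ^+ 2 / dl0 ^+ 2).
  have h : P * dl0 ^+ 2 <= 2 * dl0 ^+ 2 + 8 * D ^+ 2.
    rewrite Pe; apply: le_trans (_ : (dl0 + 2 * D) ^+ 2 <= _).
      by rewrite ler_sqr ?nnegrE//; [exact: ltW|apply: le_trans (ltW p0) up].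
    by have := sqr_ge0 (dl0 - 2 * D); nra.
  rewrite -(ler_pM2r (exprn_gt0 2 dl0_gt0)); apply: le_trans h _.
  by rewrite le_eqVlt; apply/orP; left; apply/eqP; field; rewrite gt_eqF.
have m4 : 2 * `|Mc A s (dlk j) z| <= P^-1 * (Mc A s (dlk j) z ^+ 2 / B) + B * P.
  rewrite -(real_normK (num_real (Mc _ _ _ _))); set a := `|_|.
  have -> : P^-1 * (a ^+ 2 / B) + B * P = 2 * a + (a - B * P) ^+ 2 / (B * P).
    by field; rewrite !gt_eqF.
  by rewrite lerDl divr_ge0 ?sqr_ge0// ltW// mulr_gt0.
have m5 : P^-1 * (Mc A s (dlk j) z ^+ 2 / B) <= peel z.
  rewrite /peel (bigD1 (Ordinal jN))//= lerDl; apply: sumr_ge0 => k _.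
  rewrite mulr_ge0 ?invr_ge0 ?exprn_ge0// divr_ge0 ?sqr_ge0//; exact: ltW.
have m6 : 320 * D * kap * d%:R <= 160 * B + 160 * (B * (D ^+ 2 / dl0 ^+ 2)).
  have -> : 160 * B + 160 * (B * (D ^+ 2 / dl0 ^+ 2)) =
    320 * D * kap * d%:R + 160 * (kap * d%:R / dl0 * (dl0 - D) ^+ 2).
    by rewrite /B /dl0; field; rewrite !gt_eqF.
  rewrite lerDl; apply: mulr_ge0 (ler0n _ _) _; apply: mulr_ge0 (sqr_ge0 _).
  by apply: divr_ge0 (ltW dl0_gt0); apply: mulr_ge0 (ltW _) _.
have m7 : B * P <= B * (2 + 8 * (D ^+ 2 / dl0 ^+ 2)) by rewrite ler_pM2l.
have e : 80 * (dl0 + 2 * D) * kap * d%:R = 80 * B + 160 * D * kap * d%:R.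
  by rewrite /B /dl0; field; rewrite gt_eqF.
have -> : B * (322 + 168 * (D ^+ 2 / dl0 ^+ 2)) = B * (2 + 8 * (D ^+ 2 / dl0 ^+ 2)) +
  2 * (80 * B) + (160 * B + 160 * (B * (D ^+ 2 / dl0 ^+ 2))) by ring.
by rewrite e in m3; lra.
Qed.

Lemma mom_peel : upE d peel (2 * (cG R * cstar^-1 ^+ 2 * B)).
Proof.
have H (j : 'I_N.+2) : upE d (fun z => (4 ^+ j)^-1 * (Mc A s (dlk j) z ^+ 2 / B))
    ((4 ^+ j)^-1 * (cG R * cstar^-1 ^+ 2 * B)).
  apply: upE_scale; first by rewrite invr_ge0 exprn_ge0.
  have D1 : dlk j <= 1 / 10 by rewrite /dlk ge_min lexx orbT.
  have h := mom_Mc s cs0 Sig1 Sigc D1; rewrite -/Sig -/T -/kap in h.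
  have iB : 0 <= B^-1 by rewrite invr_ge0 ltW.
  apply: upE_le (upE_scale iB h) => [z|]; first by rewrite mulrC.
  have c0 := cG_ge0 R.
  have -> : B^-1 * (3600 * (40 * kap) ^+ 2 * T ^+ 2) = cG R * (kap ^+ 2 / B) * T ^+ 2.
    by rewrite /cG; ring.
  have -> : cG R * cstar^-1 ^+ 2 * B = cG R * (kap ^+ 2 / B) * (cstar^-1 ^+ 2 * Fr ^+ 2).
    by rewrite /B; field; rewrite !gt_eqF.
  apply: ler_wpM2l T2F; apply: mulr_ge0 c0 _; apply: divr_ge0 (sqr_ge0 _) (ltW B0).
apply: upE_le (@upE_sum R d _ (index_enum _) predT _ _ (fun j _ => H j)) => //.
rewrite -mulr_suml; apply: ler_wpM2r (sum_quarter_pow _ _).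
by apply: mulr_ge0 (ltW B0); exact: mulr_ge0 (cG_ge0 R) (sqr_ge0 _).
Qed.

Section pointwise.
Variable l0 : int.
Let y0 : R := 2 ^ l0 / sigma ^+ 2.
Hypothesis y0_bounds : 9 / 32 < y0 <= 9 / 16.
Let c0 : R := phi 2 / 4.
Let c0_gt0 : 0 < c0. Proof. by rewrite divr_gt0// phi_gt0. Qed.
Let c00 : 0 <= 16 / c0 ^+ 2. Proof. exact: divr_ge0 (ler0n _ _) (sqr_ge0 _). Qed.

(** A quadratic majorant of the squared error of [sigS2] in units of [dl0]; its expectation depends
    on [cstar] only, which pays for the price of the peeling. *)
Definition Qd z := 16 / c0 ^+ 2 * (2 + 6 / dl0 ^+ 2 * devsq sigma l0 (noise A z)).

Let dl2 : 0 <= 6 / dl0 ^+ 2. Proof. exact: divr_ge0 (ler0n _ _) (sqr_ge0 _). Qed.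

Lemma Qd_ge0 z : 0 <= Qd z.
Proof.
apply: mulr_ge0; first exact: c00.
exact: addr_ge0 (ler0n _ _) (mulr_ge0 dl2 (devsq_ge0 _ _ _)).
Qed.

Lemma mom_Qd : upE d Qd (cD cstar).
Proof.
have h := mom_devsq sigma l0 d0 cs0 Sigc; rewrite -/Sig -/T in h.
apply: upE_le (upE_scale c00 (upE_add (upE_cst d (ler0n R 2)) (upE_scale dl2 h))) => //.
rewrite /cD -/c0; apply: ler_wpM2l; first exact: c00.
rewrite lerD2l.
have -> : 6 / dl0 ^+ 2 * (10800 * (T ^+ 2 / d%:R ^+ 2)) = 6 * 10800 * (T ^+ 2 / Fr ^+ 2).
  by rewrite /dl0; field; rewrite !gt_eqF.
apply: ler_wpM2l; first exact: mulr_ge0 (ler0n _ _) (ler0n _ _).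
by rewrite ler_pdivrMr ?exprn_gt0//; exact: T2F.
Qed.

Lemma Qd_ge z : (4 / c0 * Delta (noise A z) sigma s l0) ^+ 2 / dl0 ^+ 2 <= Qd z.
Proof.
have h := Delta_sq sigma s l0 (noise A z).
have dl20 : 0 < dl0 ^+ 2 by rewrite exprn_gt0.
have sdl : (s%:R / d%:R) ^+ 2 <= dl0 ^+ 2.
  rewrite ler_sqr ?nnegrE ?divr_ge0 ?ler0n//; last exact: ltW.
  by rewrite /dl0 ler_pM2r ?invr_gt0.
have -> : (4 / c0 * Delta (noise A z) sigma s l0) ^+ 2 / dl0 ^+ 2 =
   16 / c0 ^+ 2 * (Delta (noise A z) sigma s l0 ^+ 2 / dl0 ^+ 2) by field; rewrite !gt_eqF.
apply: ler_wpM2l; first exact: c00.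
have -> : 2 + 6 / dl0 ^+ 2 * devsq sigma l0 (noise A z) =
  (2 * dl0 ^+ 2 + 6 * devsq sigma l0 (noise A z)) / dl0 ^+ 2 by field; rewrite gt_eqF.
rewrite ler_pM2r ?invr_gt0//; apply: le_trans h _; rewrite lerD2r; exact: ler_wpM2l.
Qed.

(** Absolute values and cross terms have been replaced by squares balanced at the scale [B], which
    is at most [s]. The constants 402 and 248 are those of [peel_le] increased by 80 for the error
    in the correction term. *)
Definition ggood z := (B + B^-1 * Gsum Sig theta (noise A z) s ^+ 2) + (peel z + B * (402 + 248 * Qd z))
  + 160 * s%:R + 4 * (\sum_(i | theta i != 0) noise A z i ^+ 2) + 45 * (L * s%:R).

Lemma good_err z : Delta (noise A z) sigma s l0 <= phi 2 / 4 / 40 -> err z <= sigma ^+ 2 * ggood z.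
Proof.
move=> good.
have h1 := sigS2_good d0 Sig0 sigma0 theta_s y0_bounds good.
have q := Qd_ge z.
rewrite -/c0 in h1; set D := 4 / c0 * Delta _ _ _ _ in h1 q.
have D0 : 0 <= D by exact: le_trans (normr_ge0 _) h1.
have D1 : D <= 1 / 10.
  have -> : 1 / 10 = 4 / c0 * (phi 2 / 4 / 40) by rewrite -/c0; field; rewrite gt_eqF.
  by apply: ler_wpM2l good; exact: divr_ge0 (ler0n _ _) (ltW c0_gt0).
apply: le_trans (sparse_good d0 Sig0 sigma0 Sig1 theta_s sF h1 D1) _.
rewrite ler_pM2l// /ggood tau_sq.
have D01 : 0 <= D <= 1 / 10 by rewrite D0.
have hM := peel_le z D01.
have hG : 2 * `|Gsum Sig theta (noise A z) s| <= B + B^-1 * Gsum Sig theta (noise A z) s ^+ 2.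
  rewrite -(real_normK (num_real (Gsum _ _ _ _))); set a := `|_|.
  have -> : B + B^-1 * a ^+ 2 = 2 * a + (a - B) ^+ 2 / B by field; rewrite gt_eqF.
  by rewrite lerDl divr_ge0 ?sqr_ge0// ltW.
have al := alpha_le Sig s; rewrite -/kap in al.
have sp : 0 < s%:R :> R := sR.
have hA : 2 * (alpha_s Sig s * (D * d%:R + s%:R)) <= 160 * (kap * d%:R * D) + 160 * s%:R.
  have Dd : 0 <= D * d%:R + s%:R by rewrite addr_ge0 ?ler0n// mulr_ge0// ler0n.
  have k1 := ler_wpM2r Dd al.
  have k2 : kap * s%:R <= 1 * s%:R by rewrite ler_pM2r//; exact: kap_le1.
  have -> : 160 * (kap * d%:R * D) = 2 * (80 * kap * (D * d%:R + s%:R)) - 160 * (kap * s%:R).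
    by ring.
  lra.
have hA2 : 160 * (kap * d%:R * D) <= 80 * B + 80 * (B * (D ^+ 2 / dl0 ^+ 2)).
  have -> : 80 * B + 80 * (B * (D ^+ 2 / dl0 ^+ 2)) =
    160 * (kap * d%:R * D) + 80 * (kap * d%:R / dl0 * (dl0 - D) ^+ 2).
    by rewrite /B /dl0; field; rewrite !gt_eqF.
  rewrite lerDl; apply: mulr_ge0 (ler0n _ _) _; apply: mulr_ge0 (sqr_ge0 _).
  by apply: divr_ge0 (ltW dl0_gt0); apply: mulr_ge0 (ltW _) _.
have hQ : B * (D ^+ 2 / dl0 ^+ 2) <= B * Qd z by rewrite ler_pM2l.
move: hM hG hA hA2 hQ.
set M := Msum _ _ _ _; set G := `|_|; set G2 := B^-1 * _; set p := peel z.
set a := alpha_s _ _ * _; set k := kap * _ * _; set x2 := \sum_(_ | _) _.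
move: (Qd z) (D ^+ 2 / dl0 ^+ 2) => Q D2 hM hG hA hA2 hQ.
by lra.
Qed.

Lemma mom_ggood : upE d ggood (cgood cstar * psistar s Sig).
Proof.
have h := mom_Gsum theta s cs0 Sig1 Sigc; rewrite -/Sig -/T -/kap in h.
have hX := mom_Xsupp cs0 Sigc theta_s.
have B00 : 0 <= B := ltW B0.
have iB : 0 <= B^-1 by rewrite invr_ge0.
have L0 := ln_rate_ge.
have Ls : 0 <= 45 * (L * s%:R) by apply: mulr_ge0 => //; apply: mulr_ge0 => //; lra.
have s160 : 0 <= 160 * s%:R :> R := mulr_ge0 (ler0n _ _) (ler0n _ _).
have H := upE_add (upE_add (upE_add (upE_add (upE_add (upE_cst d B00) (upE_scale iB h))
  (upE_add mom_peel (upE_scale B00 (upE_add (upE_cst d (ler0n R 402)) (upE_scale (ler0n R 248) mom_Qd)))))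
  (upE_cst d s160)) (upE_scale (ler0n R 4) hX)) (upE_cst d Ls).
apply: upE_le H => //.
have g : B^-1 * (3600 * (40 * kap) ^+ 2 * T ^+ 2) <= cG R * cstar^-1 ^+ 2 * B.
  have -> : B^-1 * (3600 * (40 * kap) ^+ 2 * T ^+ 2) = cG R * (kap ^+ 2 / B) * T ^+ 2.
    by rewrite /cG; ring.
  have -> : cG R * cstar^-1 ^+ 2 * B = cG R * (kap ^+ 2 / B) * (cstar^-1 ^+ 2 * Fr ^+ 2).
    by rewrite /B; field; rewrite !gt_eqF.
  apply: ler_wpM2l T2F; apply: mulr_ge0 (cG_ge0 R) _; apply: divr_ge0 (sqr_ge0 _) (ltW B0).
have c1 := cD_ge0 cstar; have c2 := mulr_ge0 (cG_ge0 R) (sqr_ge0 cstar^-1).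
have b1 := frob_kap_le; have sp := s_le_psi.
rewrite /cgood psiE; rewrite psiE in sp.
have e : L * s%:R = s%:R * L by rewrite mulrC.
move: g c1 c2 b1 sp; rewrite e.
set Gm := B^-1 * _; set S : R := s%:R.
move: (cD cstar) (cG R * cstar^-1 ^+ 2) (S * L) => p q P g p0 q0 b1 sp.
have h1 : p * B <= p * S by apply: ler_wpM2l.
have h2 : q * B <= q * S by apply: ler_wpM2l.
have h3 : p * S <= p * (2 * P) by apply: ler_wpM2l.
have h4 : q * S <= q * (2 * P) by apply: ler_wpM2l.
lra.
Qed.

(** On the bad event [badq >= 1] stands in for the indicator: [d + |Usum|] is at most [3 / 2 * d]
    plus a multiple of [Usum ^+ 2], and the first term is multiplied by [badq]. *)
Definition gbad z := 6000 * (1 + 9 * L) *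
  (3 / 2 * d%:R * badq sigma l0 (noise A z) + 1 / (2 * d%:R) * Usum (noise A z) ^+ 2).

Let L11 : 0 <= 6000 * (1 + 9 * L).
Proof. by have h := ln_rate_ge; apply: mulr_ge0; [exact: ler0n|lra]. Qed.

Lemma bad_err z : phi 2 / 4 / 40 < Delta (noise A z) sigma s l0 -> err z <= sigma ^+ 2 * gbad z.
Proof.
move=> bad; have b1 := badq_ge1 sd bad.
apply: le_trans (sparse_bad (noise A z) d0 Sig0 sigma0 Sig1 theta_s sF sd8) _.
rewrite ler_pM2l// tau_sq; apply: ler_wpM2l; first exact: L11.
rewrite -(real_normK (num_real (Usum _))); set u := `|_|.
have h1 : u <= d%:R / 2 + 1 / (2 * d%:R) * u ^+ 2.
  have -> : d%:R / 2 + 1 / (2 * d%:R) * u ^+ 2 = u + (u - d%:R) ^+ 2 / (2 * d%:R).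
    by field; rewrite gt_eqF.
  by rewrite lerDl; apply: divr_ge0 (sqr_ge0 _) (mulr_ge0 (ler0n _ _) (ler0n _ _)).
have h2 : d%:R * 1 <= d%:R * badq sigma l0 (noise A z) by rewrite ler_pM2l.
rewrite -[3 / 2 * d%:R * _]mulrA; move: h1 h2; set v := 1 / _ * _; set w := d%:R * badq _ _ _; lra.
Qed.

Lemma gbad_ge0 z : 0 <= gbad z.
Proof.
apply: mulr_ge0; first exact: L11.
apply: addr_ge0; first by apply: mulr_ge0 (badq_ge0 _ _ _); apply: mulr_ge0 (ler0n _ _); lra.
exact: mulr_ge0 (divr_ge0 (ler0n _ 1) (mulr_ge0 (ler0n _ _) (ler0n _ _))) (sqr_ge0 _).
Qed.

(** A loss of order [d * L] on an event of probability of order [(T / d) ^+ 2]: this is where the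
    extra term with [frob Sig ^+ 2 / d] in the expectation bound originates. *)
Lemma mom_gbad : upE d gbad (cE cstar * (Fr ^+ 2 / d%:R * L)).
Proof.
have p1 : 0 <= 3 / 2 * d%:R :> R by apply: mulr_ge0 (ler0n _ _); lra.
have p2 : 0 <= 1 / (2 * d%:R) :> R := divr_ge0 (ler0n _ 1) (mulr_ge0 (ler0n _ _) (ler0n _ _)).
have hU := mom_Usum cs0 Sigc; rewrite -/Sig -/T -/(cU R) in hU.
have hB := mom_badq sigma l0 d0 cs0 Sigc; rewrite -/Sig -/T in hB.
apply: upE_le (upE_scale L11 (upE_add (upE_scale p1 hB) (upE_scale p2 hU))) => //.
have L0 := ln_rate_ge; have cb := cbad_ge0 R; have cu := cU_ge0 R.
pose k := 3 / 2 * cbad R + cU R / 2.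
have k0 : 0 <= k by rewrite /k; lra.
have -> : 3 / 2 * d%:R * (cbad R * (T ^+ 2 / d%:R ^+ 2)) + 1 / (2 * d%:R) * (cU R * T ^+ 2) =
   k / d%:R * T ^+ 2 by rewrite /k; field; rewrite gt_eqF.
have kd : 0 <= k / d%:R by exact: divr_ge0 k0 (ler0n _ _).
have h1 := ler_wpM2l kd T2F.
have h2 : 6000 * (1 + 9 * L) <= 66 * 1000 * L by lra.
apply: le_trans (ler_pM _ _ h2 h1) _; first exact: L11.
  exact: mulr_ge0 kd (sqr_ge0 _).
rewrite /cE -/k le_eqVlt; apply/orP; left; apply/eqP; ring.
Qed.

Lemma ggood_ge0 z : 0 <= ggood z.
Proof.
have L0 := ln_rate_ge; have B00 := ltW B0.
have p0 : 0 <= peel z.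
  apply: sumr_ge0 => j _; apply: mulr_ge0; first by rewrite invr_ge0 exprn_ge0.
  exact: divr_ge0 (sqr_ge0 _) B00.
apply: addr_ge0; last by apply: mulr_ge0 => //; apply: mulr_ge0 (ler0n _ _); lra.
apply: addr_ge0; last by apply: mulr_ge0 => //; apply: sumr_ge0 => i _; exact: sqr_ge0.
apply: addr_ge0; last exact: mulr_ge0 (ler0n _ _) (ler0n _ _).
apply: addr_ge0.
  have iB : 0 <= B^-1 by rewrite invr_ge0.
  exact: addr_ge0 B00 (mulr_ge0 iB (sqr_ge0 _)).
apply: addr_ge0 p0 _; apply: mulr_ge0 B00 _.
exact: addr_ge0 (ler0n _ _) (mulr_ge0 (ler0n _ _) (Qd_ge0 z)).
Qed.

End pointwise.

Let y0_exists : exists l0 : int, 9 / 32 < 2 ^ l0 / sigma ^+ 2 <= 9 / 16.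
Proof.
have p : 0 < sigma ^+ 2 * (9 / 32) by rewrite mulr_gt0//; lra.
have [l0 /andP[h1 h2]] := pow2_exists p; exists l0.
by rewrite ltr_pdivlMr// ler_pdivrMr//; apply/andP; split; lra.
Qed.

Lemma sparse_expect :
  (Expect theta sigma A (fun Y => ((Nstar Sig s Y - l2norm theta) ^+ 2)%R)
     <= (sigma ^+ 2 * (cgood cstar * psistar s Sig + cE cstar * (Fr ^+ 2 / d%:R * L)))%:E)%E.
Proof.
have [l0 hl0] := y0_exists.
rewrite /Expect.
have -> : (fun z => ((Nstar Sig s (Yobs theta sigma A z) - l2norm theta) ^+ 2)%:E) =
  (fun z => (err z)%:E).
  by apply/funext => z; rewrite (YobsE theta sigma cs0 Sigc).
apply: upE_gauss_int => [z|]; first exact: sqr_ge0.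
apply: upE_le (upE_scale (ltW s2) (upE_add (mom_ggood l0) (mom_gbad l0))) => // z.
have g0 := ggood_ge0 l0 z; have b0 := gbad_ge0 l0 z.
have [good|bad] := leP (Delta (noise A z) sigma s l0) (phi 2 / 4 / 40).
  by apply: le_trans (good_err hl0 good) _; rewrite ler_pM2l// lerDl.
by apply: le_trans (bad_err bad) _; rewrite ler_pM2l// lerDr.
Qed.

(** The level [eta] is shared equally: half for Markov's inequality on [ggood], half for the bad
    event, whose probability is of order [T ^+ 2 / d ^+ 2] and hence at most of order
    [frob Sig / d]. The loss on the bad event plays no part in this bound. *)
Lemma sparse_prob eta : 0 < eta -> 2 * cbad R / cstar * Fr / d%:R < eta ->
  ((1 - eta)%:E <= Prob theta sigma A (fun Y =>
     ((Nstar Sig s Y - l2norm theta) ^+ 2 <= 2 * cgood cstar / eta * sigma ^+ 2 * psistar s Sig)%R))%E.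
Proof.
move=> e0 he; have [l0 hl0] := y0_exists.
have cg := cgood_gt0 cstar; have L0 := ln_rate_ge.
have psi0 : 0 < psistar s Sig by rewrite psiE mulr_gt0//; lra.
pose K := 2 * cgood cstar / eta * psistar s Sig.
have K0 : 0 < K by rewrite mulr_gt0// divr_gt0// mulr_gt0.
have iK : 0 <= K^-1 by rewrite invr_ge0 ltW.
have H := upE_add (upE_scale iK (mom_ggood l0)) (mom_badq sigma l0 d0 cs0 Sigc).
have H' : upE d (fun z => K^-1 * ggood l0 z + badq sigma l0 (noise A z)) eta.
  apply: upE_le H => //; rewrite -/Sig -/T.
  have -> : K^-1 * (cgood cstar * psistar s Sig) = eta / 2.
    by rewrite /K; field; rewrite !gt_eqF.
  have cb := cbad_ge0 R.
  have Td : T <= d%:R := frob_Sigtil_le_d cs0 Sigc.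
  have h1 : T ^+ 2 / d%:R ^+ 2 <= T / d%:R.
    have -> : T ^+ 2 / d%:R ^+ 2 = T / d%:R * (T / d%:R) by field; rewrite gt_eqF.
    apply: ler_piMr; first by apply: divr_ge0 (ler0n _ _); have := T1; lra.
    by rewrite ler_pdivrMr// mul1r.
  have h2 : T / d%:R <= cstar^-1 * Fr / d%:R by rewrite ler_pM2r ?invr_gt0.
  have h3 := ler_wpM2l cb (le_trans h1 h2).
  have e : 2 * cbad R / cstar * Fr / d%:R = 2 * (cbad R * (cstar^-1 * Fr / d%:R)) by ring.
  by rewrite e in he; lra.
apply: (upE_prob H') => z hz.
rewrite (YobsE theta sigma cs0 Sigc).
have g0 := ggood_ge0 l0 z; have b0 := badq_ge0 sigma l0 (noise A z).
have gK : 0 <= K^-1 * ggood l0 z by rewrite mulr_ge0.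
(* The hypothesis [hz] says that a sum of two nonnegative terms is below 1; [badq < 1] excludes the
   bad event, and the other term bounds [ggood] by [K]. *)
have [good|bad] := leP (Delta (noise A z) sigma s l0) (phi 2 / 4 / 40); last first.
  by have := badq_ge1 sd bad; lra.
apply: le_trans (good_err hl0 good) _.
have -> : 2 * cgood cstar / eta * sigma ^+ 2 * psistar s Sig = sigma ^+ 2 * K by rewrite /K; ring.
by rewrite ler_pM2l// -[leRHS]mulr1 -ler_pdivrMl//; lra.
Qed.

End sparse_final.

(** * Assembly of the two zones *)

Lemma psistar_ge0 (R : realType) (d s : nat) (Sig : 'M[R]_d) : 0 <= psistar s Sig.
Proof.
rewrite /psistar; case: ifP => _.
  by rewrite mulr_ge0// ln_ge0// lerDl divr_ge0 ?sqr_ge0.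
by rewrite divr_ge0// le_max ler01.
Qed.

Theorem theorem7 (R : realType) (cstar : R) (hcstar : 0 < cstar) :
  exists alpha : R, 0 < alpha < 1 /\
  exists c1 c2 c3 : R, 0 < c1 /\ 0 < c2 /\ 0 < c3 /\
  exists ceta : R -> R, (forall eta : R, 0 < ceta eta) /\
  forall (d s : nat) (sigma : R) (theta : 'I_d -> R) (A : 'M[R]_d),
    (1 <= d)%N -> (1 <= s)%N -> s%:R <= alpha * d%:R -> 0 < sigma ->
    (l0norm theta <= s)%N ->
    let Sig := A *m A^T in
    (forall i : 'I_d, Sig i i <= 1) ->
    (forall i : 'I_d, cstar <= Sig i i) ->
    let err := fun Y : 'I_d -> R => (Nstar Sig s Y - l2norm theta) ^+ 2 in
    (frob Sig < s%:R ->
       (Expect theta sigma A err <= (c1 * sigma ^+ 2 * psistar s Sig)%:E)%E)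
    /\
    (s%:R <= frob Sig ->
       forall eta : R, c2 * frob Sig / d%:R < eta < 1 ->
       ((1 - eta)%:E <=
          Prob theta sigma A
            (fun Y => (err Y <= ceta eta * sigma ^+ 2 * psistar s Sig)%R))%E)
    /\
    (pos_def Sig ->
       (Expect theta sigma A err <=
          (c3 * (Num.sqrt (lambda_max (invmx Sig)) + 1) * sigma ^+ 2 * psistar s Sig
           + c3 * sigma ^+ 2 * (frob Sig ^+ 2 / d%:R)
               * ln (1 + frob Sig ^+ 2 / s%:R ^+ 2))%:E)%E).
Proof.
have al0 : 0 < phi 2 / 4 / 40 / 2 :> R by rewrite !divr_gt0// phi_gt0.
exists (phi 2 / 4 / 40 / 2); split; first by rewrite al0/=; have := phi2_le R; lra.
have cb := cbad_ge0 R; have cg := cgood_gt0 cstar; have ce := cE_ge0 cstar.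
(* The constants are fixed before any covariance matrix is given, when [cstar] may still exceed 1
   and [ln cstar^-1] be negative; the absolute value secures positivity. *)
pose c1 := 1 + `|cdense cstar|.
have c10 : 0 < c1 by rewrite ltr_pwDl.
have cd : cdense cstar <= c1 by rewrite /c1; have := ler_norm (cdense cstar); lra.
(* The added 1 makes the second constant positive, as only [0 <= cbad R] is at hand; the third is a
   sum so that it dominates the constants of both zones. *)
exists c1, (2 * cbad R / cstar + 1), (c1 + cgood cstar + cE cstar); split; first exact: c10.
have k0 : 0 <= 2 * cbad R / cstar := divr_ge0 (mulr_ge0 (ler0n _ _) cb) (ltW hcstar).
split; first exact: ltr_wpDl k0 ltr01.
split; first exact: ltr_pwDl (addr_gt0 c10 cg) ce.
(* The value 1 for nonpositive [eta] only serves to make the function positive everywhere; part (ii)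
   forces [eta] to be positive. *)
exists (fun eta => if 0 < eta then 2 * cgood cstar / eta else 1); split.
  move=> eta; case: ifP => [e0|_]; last exact: ltr01.
  exact: divr_gt0 (mulr_gt0 (ltr0Sn _ 1) cg) e0.
move=> d s sigma theta A d0 s0 sd sigma0 theta_s Sig Sig1 Sigc err.
have dR : 0 < d%:R :> R by rewrite ltr0n.
have {}sd : s%:R / d%:R <= phi 2 / 4 / 40 / 2 :> R by rewrite ler_pdivrMr.
have s2 : 0 <= sigma ^+ 2 := sqr_ge0 _.
have psi0 := psistar_ge0 s Sig.
have sp0 := mulr_ge0 s2 psi0.
have dense : frob Sig < s%:R ->
    (Expect theta sigma A err <= (c1 * sigma ^+ 2 * psistar s Sig)%:E)%E.
  move=> sF; apply: le_trans (dense_bound d0 s0 hcstar sigma0 Sig1 Sigc theta_s sF sd) _.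
  by rewrite lee_fin -[leLHS]mulrA -[leRHS]mulrA; exact: ler_wpM2r sp0 _ _ cd.
split; [exact: dense|split].
- move=> sF eta /andP[he _].
  have F0 : 0 <= frob Sig / d%:R := divr_ge0 (sqrtr_ge0 _) (ltW dR).
  have h : 2 * cbad R / cstar * frob Sig / d%:R < eta.
    apply: le_lt_trans he; rewrite -mulrA -[leRHS]mulrA; apply: ler_wpM2r F0 _ _ _.
    by rewrite lerDl ler01.
  have e0 : 0 < eta by apply: le_lt_trans h; rewrite -mulrA; exact: mulr_ge0 k0 F0.
  rewrite e0; exact: sparse_prob.
(* The last claim covers both zones. The factor involving [lambda_max] is at least 1, so each zone's
   bound fits below it, and in the dense zone the additional term is simply nonnegative. *)
move=> _; have [sF|sF] := leP s%:R (frob Sig).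
  apply: le_trans (sparse_expect d0 s0 hcstar sigma0 Sig1 Sigc theta_s sF sd) _.
  rewrite lee_fin -/Sig; set L := ln _.
  have L0 : 0 <= L by rewrite ln_ge0// lerDl divr_ge0 ?sqr_ge0.
  have FL : 0 <= sigma ^+ 2 * (frob Sig ^+ 2 / d%:R * L).
    by apply: mulr_ge0 s2 (mulr_ge0 (divr_ge0 (sqr_ge0 _) (ltW dR)) L0).
  have l0 := sqrtr_ge0 (lambda_max (invmx Sig)).
  set c3 := c1 + _ + _; set q := Num.sqrt _ in l0 *.
  have -> : c3 * (q + 1) * sigma ^+ 2 * psistar s Sig + c3 * sigma ^+ 2 * (frob Sig ^+ 2 / d%:R) * L =
    c3 * (q + 1) * (sigma ^+ 2 * psistar s Sig) + c3 * (sigma ^+ 2 * (frob Sig ^+ 2 / d%:R * L)).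
    by ring.
  have -> : sigma ^+ 2 * (cgood cstar * psistar s Sig + cE cstar * (frob Sig ^+ 2 / d%:R * L)) =
    cgood cstar * (sigma ^+ 2 * psistar s Sig) + cE cstar * (sigma ^+ 2 * (frob Sig ^+ 2 / d%:R * L)).
    by ring.
  apply: lerD; apply: ler_wpM2r => //; last by rewrite /c3; lra.
  apply: le_trans (_ : c3 <= _); first by rewrite /c3; lra.
  by rewrite ler_peMr; rewrite /c3; lra.
apply: le_trans (dense sF) _; rewrite lee_fin; set L := ln _.
have L0 : 0 <= L by rewrite ln_ge0// lerDl divr_ge0 ?sqr_ge0.
have FL : 0 <= sigma ^+ 2 * (frob Sig ^+ 2 / d%:R) by apply: mulr_ge0 s2 (divr_ge0 (sqr_ge0 _) (ltW dR)).
have l0 := sqrtr_ge0 (lambda_max (invmx Sig)).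
set c3 := c1 + _ + _; set q := Num.sqrt _ in l0 *.
have c30 : 0 <= c3 by rewrite /c3; lra.
apply: ler_wpDr; first by rewrite -(mulrA c3) mulr_ge0// mulr_ge0.
rewrite -!(mulrA _ (sigma ^+ 2)); apply: ler_wpM2r => //.
apply: le_trans (_ : c3 <= _); first by rewrite /c3; lra.
by rewrite ler_peMr; rewrite /c3; lra.
Qed.
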